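(* For each $\varepsilon>0$, there exists some $k_0$ such that, for each $k\geq k_0$, in almost every $n$-vertex random graph process $\{G_M\}_{M\geq 0}$, the following holds for each $0\leq M\leq \binom{n}{2}$: if $G_M^{(k)}\neq \emptyset$, then $G_M^{(k)}$ is $(1/2-\varepsilon)$-resiliently Hamiltonian, but not $(1/2+\varepsilon)$-resiliently Hamiltonian.
   Context: The $n$-vertex random graph process $\{G_M\}_{M\geq 0}$: $G_0$ is the empty graph on vertex set $[n]$, and $G_M$ is obtained from $G_{M-1}$ by adding an edge chosen uniformly at random among the non-edges, until the complete graph is reached. ''In almost every random graph process'' means with probability tending to $1$ as $n\to\infty$. For a graph $G$, the $k$-core $G^{(k)}$ is the (possibly empty) maximal subgraph of $G$ with minimum degree at least $k$. A graph $G$ is $\alpha$-resiliently Hamiltonian if for every subgraph $H\subset G$ with $d_H(v)\le \alpha d_G(v)$ for every $v\in V(G)$, the graph $G-H$ (same vertex set, edge set $E(G)\setminus E(H)$) is Hamiltonian. *)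

(* Defs.v *)
From HB Require Import structures.
From mathcomp Require Import all_boot all_order all_algebra.
From mathcomp Require Import zify.
From mathcomp Require Import all_classical all_reals all_analysis.
Set Implicit Arguments.
Unset Strict Implicit.
Unset Printing Implicit Defensive.
Import Order.TTheory GRing.Theory Num.Theory.
Import numFieldNormedType.Exports.
Local Open Scope ring_scope.

Section Graphs.
Variable T : finType.
Implicit Types (v : T) (e : {set T}).

(* A graph carries its own vertex set, because the k-core of a graph on [n]
   usually has fewer than n vertices. *)
Definition wf_graph (p : {set T} * {set {set T}}) : bool :=
  [forall e in p.2, (e \subset p.1) && (#|e| == 2)%N].

Record graph := Graph {
  graph_val :> {set T} * {set {set T}};
  _ : wf_graph graph_val }.

HB.instance Definition _ := [isSub for graph_val].
HB.instance Definition _ := [Finite of graph by <:].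

Implicit Types G H K L : graph.

Definition vset G : {set T} := (graph_val G).1.
Definition eset G : {set {set T}} := (graph_val G).2.

Lemma edgeP G e : e \in eset G -> (e \subset vset G) && (#|e| == 2)%N.
Proof. exact: (forall_inP (valP G)). Qed.

Definition adj G : rel T := fun x y => [set x; y] \in eset G.

Definition degree G v : nat := #|[set e in eset G | v \in e]|.

Definition subgraph H G : bool :=
  (vset H \subset vset G) && (eset H \subset eset G).

Fact wf_edgeless (V : {set T}) : wf_graph (V, finset.set0).
Proof. by apply/forall_inP => e; rewrite inE. Qed.

Definition edgeless (V : {set T}) : graph := Graph (wf_edgeless V).

Definition nonedges G : {set {set T}} :=
  [set e : {set T} | [&& e \subset vset G, #|e| == 2%N & e \notin eset G]].

Definition adds_edge G e G' : bool :=
  (vset G' == vset G) && (eset G' == e |: eset G).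

Fact wf_remove_edges G H : wf_graph (vset G, eset G :\: eset H).
Proof.
apply/forall_inP => e /=; rewrite inE => /andP[_]; exact: edgeP.
Qed.

Definition remove_edges G H : graph := Graph (wf_remove_edges G H).

Definition min_degree_ge (k : nat) G : Prop :=
  forall v, v \in vset G -> (k <= degree G v)%N.

Definition is_kcore (k : nat) G K : Prop :=
  [/\ subgraph K G, min_degree_ge k K
    & forall L, subgraph L G -> min_degree_ge k L -> subgraph K L -> L = K].

Definition hamiltonian G : Prop :=
  exists c : seq T,
    [/\ (3 <= size c)%N, ucycle (adj G) c & c =i vset G].

Definition resiliently_hamiltonian (R : realType) (alpha : R) G : Prop :=
  forall H, subgraph H G ->
    (forall v, v \in vset G -> (degree H v)%:R <= alpha * (degree G v)%:R) ->
    hamiltonian (remove_edges G H).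

Lemma graph_eq G H : vset G = vset H -> eset G = eset H -> G = H.
Proof.
move=> eV eE; apply: val_inj => /=.
by rewrite [LHS]surjective_pairing [RHS]surjective_pairing; congr pair.
Qed.

Lemma subgraph_degree H G v : subgraph H G -> (degree H v <= degree G v)%N.
Proof.
case/andP=> _ sE; apply/subset_leq_card/fintype.subsetP => e.
by rewrite !inE => /andP[/(fintype.subsetP sE) -> ->].
Qed.

Fact wf_union G H : wf_graph (vset G :|: vset H, eset G :|: eset H).
Proof.
apply/forall_inP => e /=; rewrite inE => /orP[] /edgeP/andP[se ->].
  by rewrite andbT (fintype.subset_trans se) // finset.subsetUl.
by rewrite andbT (fintype.subset_trans se) // finset.subsetUr.
Qed.

Definition graph_union G H : graph := Graph (wf_union G H).

Lemma is_kcore_max k G K L :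
  is_kcore k G K -> subgraph L G -> min_degree_ge k L -> subgraph L K.
Proof.
move=> [/andP[KV KE] Kd Kmax] /andP[LV LE] Ld.
have subl : subgraph K (graph_union K L).
  by apply/andP; split; apply: finset.subsetUl.
have subr : subgraph L (graph_union K L).
  by apply/andP; split; apply: finset.subsetUr.
suff <- : graph_union K L = K by [].
apply: Kmax => //.
  by apply/andP; rewrite /vset /eset /= !finset.subUset; split; apply/andP.
move=> v; rewrite inE => /orP[/Kd|/Ld] kv; apply: leq_trans kv _;
  exact: subgraph_degree.
Qed.

Lemma is_kcore_unique k G K L : is_kcore k G K -> is_kcore k G L -> K = L.
Proof.
move=> hK [LG Ld Lmax]; have [KG Kd _] := hK.
by apply: Lmax => //; apply: (is_kcore_max hK).
Qed.

Lemma is_kcore_exists k G : exists K, is_kcore k G K.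
Proof.
pose P K := subgraph K G && [forall v in vset K, k <= degree K v]%N.
have P0 : P (edgeless finset.set0).
  apply/andP; split; first by apply/andP; split; apply: finset.sub0set.
  by apply/forall_inP => v; rewrite inE.
case: (@arg_maxnP _ (edgeless finset.set0) P (fun K => #|vset K| + #|eset K|)%N P0)
  => K /andP[KG /forall_inP Kd] Kmax.
exists K; split=> // L LG Ld KL.
have /Kmax : P L by rewrite /P LG; apply/forall_inP.
move/andP: KL => [sV sE] le.
have lV := subset_leq_card sV; have lE := subset_leq_card sE.
have eV : #|vset L| = #|vset K| by move: le lV lE => /=; lia.
have eE : #|eset L| = #|eset K| by move: le lV lE => /=; lia.
apply/esym/graph_eq; apply/eqP.
  by rewrite eqEcard sV eV leqnn.
by rewrite eqEcard sE eE leqnn.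
Qed.

End Graphs.

Section RandomGraphProcess.
Variables (R : realType) (n : nat).

Definition process := {ffun 'I_('C(n, 2)).+1 -> graph 'I_n}.

(* Transition probability: uniform over the non-edges of G. *)
Definition step_prob (G G' : graph 'I_n) : R :=
  if [exists e in nonedges G, adds_edge G e G']
  then (#|nonedges G|%:R)^-1 else 0.

(* Probability of a trajectory: G_0 is the empty graph on [n] and each step
   follows step_prob conditionally on the past. *)
Definition process_weight (G : process) : R :=
  (G ord0 == edgeless finset.setT)%:R *
  \prod_(M < 'C(n, 2)) step_prob (G (widen_ord (leqnSn _) M)) (G (lift ord0 M)).

Definition process_prob (A : set process) : R :=
  \sum_(G : process | G \in A) process_weight G.

End RandomGraphProcess.

Definition almost_every_process (R : realType)
    (A : forall n : nat, set (process n)) : Prop :=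
  ((fun n => process_prob R (A n)) @ \oo --> (1 : R))%classic.

(* Main.v *)
Require Import Defs.
From mathcomp Require Import all_boot all_order all_algebra.
From mathcomp Require Import zify ring lra.
From mathcomp Require Import all_classical all_reals all_analysis.
From mathcomp Require Import fintype finset bigop.
Set Implicit Arguments.
Unset Strict Implicit.
Unset Printing Implicit Defensive.
Import Order.TTheory GRing.Theory Num.Theory.

(** Upper bound. By a theorem of Stiebitz, a graph with degrees [d(v) > a(v) + b(v)] splits into
    two nonempty parts in which every vertex keeps at least [a(v)], respectively [b(v)], neighbours.
    With [a] and [b] just below [d/2], deleting the edges of the cut disconnects the k-core while
    removing at most a [1/2 + eps] proportion of the edges at each vertex.

    Lower bound. The marginal of the process at time [M] is the uniform graph with [M] edges, which
    costs a factor [N + 1], with [N = binom(n, 2)], over the binomial graph of density [p = M / N];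
    a union bound over [M] costs another [N + 1], so it suffices that the bad event has probability
    [O(n^-9)] for each [p]. Write [D = p n]. If [D < k / 6] the core is empty. Otherwise it has
    linearly many vertices, all but [n / D^2] of which have degree at least [D / 100]. Let [F] be
    the core minus [H]. A few edges chosen at each vertex and a random sparse subset of [F] form a
    sparse subgraph of [F] in which small sets expand. Adding a longest path of [F], with vertex
    set [V], Posa rotations give linearly many starting points [s], each with linearly many ends
    [t] of Hamiltonian paths on [V]. Now fix this sparse graph [S] in advance: since [S] has at
    most [delta p n^2] edges, a union bound over all [S] still shows that the remaining edges of
    the random graph are well distributed among the pairs that rotate or close one of these
    paths. As [H] has less than half of the edges at each vertex, one more rotation along an edge
    of [F] reaches more than half of the core as endpoints, hence [F] contains an edge closing some
    path into a cycle on [V]; as [V] is the vertex set of a longest path and [F] is connected,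
    this cycle is Hamiltonian. *)

(** The deleted graph [H] is chosen after the random graph is seen, so [F] is not random, and there
    are too many [H] for a union bound. Only [S] is guessed: the event [S \subset E] has probability
    [p ^+ #|S|], which offsets most of the number of choices of [S]. Guessing then costs exp(c p
    n^2), with c small when delta is, against deviation probabilities exp(-eta^2 p n^2 / 8). Hence
    every subgraph on which paths are built must be sparse relative to [p n^2], and the last
    rotation cannot use all of [F]. Since [D] need only exceed a constant, degrees do not
    concentrate at every vertex, and the core may have vertices of degree near [k] while [D] is much
    larger. Edge counts are therefore controlled only up to errors proportional to [p n^2], and
    vertices of low degree are treated separately when small sets have to expand. The proportion 1/2
    enters in the last count: each start has ends in at least a (1/2 + 4 eps / 5) share of the core,
    more than the (1/2 - eps) share of edges that [H] can delete. *)

Section DegreeIn.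
Variables (T : finType) (r : rel T).
Implicit Types (A B X : {set T}) (x : T).

Definition deg_in (X : {set T}) (v : T) : nat := #|[set u in X | r v u]|.

Lemma deg_in_mono A B x : A \subset B -> deg_in A x <= deg_in B x.
Proof.
move=> sAB; apply/subset_leq_card/subsetP => u; rewrite !inE.
by case/andP=> /(subsetP sAB) -> ->.
Qed.

Lemma deg_inU A B x : [disjoint A & B] -> deg_in (A :|: B) x = deg_in A x + deg_in B x.
Proof.
move=> dAB; rewrite /deg_in -cardsUI -[LHS]addn0; congr (_ + _).
  by apply: eq_card => u; rewrite !inE; case: (u \in A); case: (u \in B); case: (r x u).
apply/esym/eqP; rewrite cards_eq0; apply/eqP/setP => u; rewrite !inE.
move/disjointFr: dAB => /(_ u); case: (u \in A) => //= ->; rewrite //=.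
by case: (r x u).
Qed.

Lemma deg_in_sum A x : deg_in A x = \sum_(u in A) r x u.
Proof.
rewrite /deg_in -sum1dep_card big_mkcondr /=.
by apply: eq_bigr => u _; case: (r x u).
Qed.

Lemma deg_inD1 A x y : deg_in A x <= (deg_in (A :\ y) x).+1.
Proof.
have [yA|yA] := boolP (y \in A); last first.
  have -> : A :\ y = A by apply/setDidPl; rewrite disjoint_sym disjoints1.
  exact: leqnSn.
rewrite -{1}(setD1K yA) deg_inU ?disjoints1 ?setD11 // -add1n leq_add2r.
by rewrite /deg_in -(cards1 y); apply/subset_leq_card/subsetP=> u; rewrite !inE => /andP[].
Qed.

End DegreeIn.

(** * Partitions into two parts of prescribed minimum degrees (Stiebitz) *)

Section Stiebitz.
Variables (T : finType) (r : rel T) (V : {set T}).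
Hypothesis r_sym : symmetric r.
Hypothesis r_irr : irreflexive r.
Implicit Types (A B X Y : {set T}) (f a b : T -> nat).

Notation dg := (deg_in r).

Definition satisfactory f A : bool := [forall x in A, f x <= dg A x].

Definition degenerate f A : bool :=
  [forall X : {set T}, (X \subset A) && (X != set0) ==> [exists x in X, dg X x <= f x]].

Definition feasible a b A B : bool :=
  [&& A != set0, B != set0, A \subset V, B \subset V, [disjoint A & B],
      satisfactory a A & satisfactory b B].

Lemma degenerateS f A B : A \subset B -> degenerate f B -> degenerate f A.
Proof.
move=> sAB /forallP dB; apply/forallP => X; apply/implyP => /andP[sXA X0].
by have /implyP := dB X; apply; rewrite X0 (subset_trans sXA).
Qed.

(** A vertex outside [A] with fewer than [b x] neighbours in [V :\: A] is not in [B], and has more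
    than [a x] neighbours in [A] because [a x + b x < dg V x]; so it can join [A]. When no such
    vertex is left, the whole complement of [A] is a valid second part. *)
Lemma feasible_extends a b A B :
  {in V, forall x, a x + b x < dg V x} -> feasible a b A B ->
  exists A', feasible a b A' (V :\: A').
Proof.
move=> dV; have [m] := ubnP (#|V| - #|A :|: B|).
elim: m A B => // m IH A B; rewrite ltnS => mAB fAB.
have /and5P[A0 B0 sA sB /andP[dAB /andP[/forall_inP tA /forall_inP tB]]] := fAB.
have sAB : A :|: B \subset V by rewrite subUset sA.
have B_sub : B \subset V :\: A by rewrite subsetD sB disjoint_sym.
have [tVA|] := boolP (satisfactory b (V :\: A)).
  exists A; rewrite /feasible A0 sA subsetDl tVA andbT /=.
  rewrite -setI_eq0 setIDA setIC -setIDA setDv setI0 eqxx /=; apply/andP; split.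
    by apply: contraNneq B0 => VA0; rewrite VA0 subset0 in B_sub.
  exact/forall_inP.
rewrite negb_forall_in => /exists_inP[x]; rewrite inE => /andP[xA xV]; rewrite -ltnNge => ltx.
have xB : x \notin B.
  apply: contraL ltx => xB; rewrite -leqNgt; apply: leq_trans (tB _ xB) _.
  exact: deg_in_mono.
apply: (IH (x |: A) B).
  have -> : x |: A :|: B = x |: (A :|: B) by rewrite setUA.
  have xAB : x \notin A :|: B by rewrite inE negb_or xA.
  have : x |: (A :|: B) \subset V by rewrite subUset sub1set xV.
  move/subset_leq_card; rewrite cardsU1 xAB; move: mAB; clear; lia.
have VE : V = A :|: (V :\: A).
  by apply/setP=> u; rewrite !inE; case: (boolP (u \in A)) => //= /(subsetP sA).
have dx : a x <= dg A x.
  have := dV x xV; rewrite {1}VE deg_inU; first by move: ltx; clear; lia.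
  by rewrite -setI_eq0 setIDA setIC -setIDA setDv setI0.
rewrite /feasible B0 sB subUset sub1set xV sA /=; apply/and4P; split.
- by apply/set0Pn; exists x; rewrite !inE eqxx.
- rewrite disjoints_subset subUset sub1set inE xB -disjoints_subset dAB //.
- apply/forall_inP => u; rewrite !inE => /orP[/eqP ->|uA].
    by apply: leq_trans dx _; apply/deg_in_mono/subsetUr.
  by apply: leq_trans (tA _ uA) _; apply/deg_in_mono/subsetUr.
- exact/forall_inP.
Qed.

Let cut A := \sum_(x in A) dg (V :\: A) x.

Lemma cut_move A x : A \subset V -> x \in A ->
  cut (A :\ x) + dg (V :\: A) x = cut A + dg (A :\ x) x.
Proof.
move=> sA xA; rewrite /cut.
have VE : V :\: (A :\ x) = x |: (V :\: A).
  apply/setP=> u; rewrite !inE; have [->|] := eqVneq u x => //=.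
  by rewrite (subsetP sA).
have dxV : [disjoint [set x] & V :\: A] by rewrite disjoints1 !inE xA.
rewrite [in RHS](big_setD1 x xA) /= addnC -addnA; congr (_ + _).
rewrite VE (eq_bigr (fun y => dg [set x] y + dg (V :\: A) y)); last first.
  by move=> y _; rewrite deg_inU.
rewrite big_split /= addnC; congr (_ + _).
rewrite deg_in_sum; apply: eq_bigr => y _.
by rewrite deg_in_sum big_set1 r_sym.
Qed.

(** A set violating degeneracy of [x |: B] must contain [x], otherwise it would lie in [B]. *)
Lemma degenerate_or_large b B x :
  degenerate b B -> ~~ degenerate b (x |: B) ->
  exists X, [/\ X \subset x |: B, x \in X & {in X, forall y, b y < dg X y}].
Proof.
move=> dB; rewrite negb_forall => /existsP[X]; rewrite negb_imply => /andP[/andP[sX X0]].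
rewrite negb_exists_in => /forall_inP nX; exists X; split=> //; last first.
  by move=> y /nX; rewrite -ltnNge.
apply: contraT => xX; have /forallP/(_ X)/implyP := dB; rewrite X0 andbT.
have -> : X \subset B.
  apply/subsetP=> u uX; have := subsetP sX u uX; rewrite !inE => /orP[/eqP ux|//].
  by rewrite -ux uX in xX.
by case/(_ isT)/exists_inP => y /nX /negPf ->.
Qed.

(** If no feasible pair exists, take a partition into an [a]-degenerate and a [b]-degenerate part
    that minimises [wt]. Moving a vertex of low degree across lowers [wt], hence destroys degeneracy
    of the other part; done from both sides, this yields two sets of high internal degree, which
    form a feasible pair after all. *)
Theorem Stiebitz_partition a b :
  V != set0 -> {in V, forall x, 0 < a x} -> {in V, forall x, 0 < b x} ->
  {in V, forall x, a x + b x < dg V x} ->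
  exists A, feasible a b A (V :\: A).
Proof.
move=> V0 a0 b0 dV.
have [/existsP[A /existsP[B fAB]]|] :=
    boolP [exists A : {set T}, exists B : {set T}, feasible a b A B].
  exact: feasible_extends fAB.
move=> nf; have {nf} nfeas A B : feasible a b A B = false.
  by apply: contraNF nf => fAB; apply/existsP; exists A; apply/existsP; exists B.
exfalso.
pose ok A := [&& A != set0, A \subset V, V :\: A != set0, degenerate a A & degenerate b (V :\: A)].
(* An inclusion-minimal satisfactory [A] has a tight vertex and is degenerate. Its complement is
   degenerate too, since a subset violating this would form a feasible pair with [A]. *)
have [A0 okA0] : exists A, ok A.
  pose P A := [&& A != set0, A \subset V & satisfactory a A].
  have PV : P V.
    rewrite /P V0 subxx /=; apply/forall_inP => x xV.
    by have := dV x xV; clear; lia.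
  have [A /minsetP[/and3P[An0 sA tA] Amin]] : {A : {set T} | minset P A & A \subset V}.
    exact: minset_exists.
  move=> _; exists A.
  have tight : exists2 x, x \in A & dg A x = a x.
    have /set0Pn[y yA] := An0.
    have [A1|A1] := eqVneq (A :\ y) set0.
      have := forall_inP tA y yA.
      rewrite -(setD1K yA) A1 setU0 /deg_in.
      rewrite (_ : [set _ in _ | _] = set0) ?cards0; last first.
        by apply/setP=> u; rewrite !inE; have [->|] := eqVneq u y; rewrite ?r_irr.
      by move: (a0 y (subsetP sA _ yA)); clear; lia.
    have : ~~ P (A :\ y).
      apply: contraTN (yA) => /Amin e; rewrite -e ?subD1set // !inE eqxx //.
    rewrite /P A1 (subset_trans (subD1set _ _) sA) /= negb_forall_in.
    case/exists_inP => x; rewrite !inE => /andP[_ xA]; rewrite -ltnNge => ltx; exists x => //.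
    move: ltx (forall_inP tA x xA) (deg_inD1 r A x y); clear; lia.
  apply/and5P; split=> //.
  - have [x xA dx] := tight; apply: contraTneq (dV x (subsetP sA x xA)) => VA.
    have -> : V = A by apply/eqP; rewrite eqEsubset sA -setD_eq0 VA eqxx.
    by rewrite dx; clear; lia.
  - apply/forallP => X; apply/implyP => /andP[sX X0].
    have [->|nXA] := eqVneq X A.
      by have [x xA dx] := tight; apply/exists_inP; exists x => //; rewrite dx.
    have : ~~ P X by apply: contraNN nXA => /Amin ->.
    rewrite /P X0 (subset_trans sX sA) /= negb_forall_in.
    case/exists_inP => x xX; rewrite -ltnNge => /ltnW lx.
    by apply/exists_inP; exists x.
  - apply/forallP => X; apply/implyP => /andP[sX X0].
    have := nfeas A X; rewrite /feasible An0 X0 sA (subset_trans sX (subsetDl _ _)) tA /=.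
    have -> /= : [disjoint A & X].
      by move: sX; rewrite subsetD disjoint_sym => /andP[_ ->].
    move/negbT; rewrite negb_forall_in => /exists_inP[x xX]; rewrite -ltnNge => /ltnW lx.
    by apply/exists_inP; exists x.
(* Moving [x] with [dg A x <= a x] out of [A] changes [wt] by at most [a x + b x - dg V x < 0], and
   symmetrically for the other part. *)
pose wt A := cut A + \sum_(x in V :\: A) b x + \sum_(x in A) a x.
have [A /and5P[An0 sA Bn0 dA dB] Amin] := @arg_minnP _ A0 ok wt okA0.
have AB_disj : [disjoint A & V :\: A].
  by rewrite -setI_eq0 setIDA setIC -setIDA setDv setI0.
have VE : V = A :|: (V :\: A).
  by apply/setP=> u; rewrite !inE; case: (boolP (u \in A)) => //= /(subsetP sA).
have dgV x : dg V x = dg A x + dg (V :\: A) x by rewrite {1}VE deg_inU.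
have dgD1 x : dg (A :\ x) x <= dg A x by apply/deg_in_mono/subD1set.
have [x xA lx] : exists2 x, x \in A & dg A x <= a x.
  have /forallP/(_ A)/implyP := dA; rewrite subxx An0 => /(_ isT)/exists_inP[x]; by exists x.
have [y yB ly] : exists2 y, y \in V :\: A & dg (V :\: A) y <= b y.
  have /forallP/(_ (V :\: A))/implyP := dB.
  by rewrite subxx Bn0 => /(_ isT)/exists_inP[y]; exists y.
have xV := subsetP sA x xA.
have yV : y \in V by move: yB; rewrite inE => /andP[].
have yA : y \notin A by move: yB; rewrite inE => /andP[].
have BxE : V :\: (A :\ x) = x |: (V :\: A).
  apply/setP=> u; rewrite !inE; have [->|] := eqVneq u x => //=.
have ByE : V :\: (y |: A) = (V :\: A) :\ y.
  by apply/setP=> u; rewrite !inE negb_or andbA.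
have [X [sX xX tX]] : exists X, [/\ X \subset x |: (V :\: A), x \in X & {in X, forall z, b z < dg X z}].
  apply: degenerate_or_large => //; apply/negP => dBx.
  have Ax0 : A :\ x != set0.
    apply/eqP => Ax0; have Ae : A = [set x] by rewrite -(setD1K xA) Ax0 setU0.
    have := dV y yV; rewrite dgV.
    have : dg A y <= 1.
      by rewrite -(cards1 x) /deg_in Ae; apply/subset_leq_card/subsetP=> u; rewrite !inE => /andP[].
    have := a0 y yV; move: ly; clear; lia.
  have /Amin : ok (A :\ x).
    rewrite /ok Ax0 BxE dBx (subset_trans (subD1set _ _) sA) (degenerateS _ dA) ?subD1set // !andbT /=.
    by apply/set0Pn; exists x; rewrite !inE eqxx.
  rewrite /wt BxE; have := cut_move sA xA.
  rewrite (big_setU1 x) ?inE ?xA //= (big_setD1 x xA) /=.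
  by have := dV x xV; rewrite dgV; have := dgD1 x; move: lx; clear; lia.
have [Y [sY yY tY]] : exists Y, [/\ Y \subset y |: A, y \in Y & {in Y, forall z, a z < dg Y z}].
  apply: degenerate_or_large => //; apply/negP => dAy.
  have By0 : (V :\: A) :\ y != set0.
    apply/eqP => By0; have Be : V :\: A = [set y] by rewrite -(setD1K yB) By0 setU0.
    have := dV x xV; rewrite dgV.
    have : dg (V :\: A) x <= 1.
      by rewrite -(cards1 y) /deg_in Be; apply/subset_leq_card/subsetP=> u; rewrite !inE => /andP[].
    have := b0 x xV; move: lx; clear; lia.
  have yAA : y \in y |: A by rewrite !inE eqxx.
  have sAy : y |: A \subset V by rewrite subUset sub1set yV.
  have /Amin : ok (y |: A).
    rewrite /ok ByE By0 dAy sAy (degenerateS _ dB) ?subD1set // !andbT /=.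
    by apply/set0Pn; exists y.
  have := cut_move sAy yAA; rewrite setU1K // /wt ByE.
  rewrite (big_setU1 y) //= (big_setD1 y yB) /=.
  have : dg (V :\: A :\ y) y <= dg (V :\: A) y by apply/deg_in_mono/subD1set.
  by have := dV y yV; rewrite dgV; move: ly; clear; lia.
have xy : x != y by apply: contraNneq yA => <-.
(* [X] and [Y] can meet only in [x] and [y]. Removing one vertex from each makes them disjoint, and
   the strict inequalities [tX] and [tY] pay for the loss of one neighbour. *)
suff /idP : feasible a b (Y :\ x) (X :\ y) by rewrite nfeas.
rewrite /feasible; apply/and5P; split.
- by apply/set0Pn; exists y; rewrite !inE eq_sym xy.
- by apply/set0Pn; exists x; rewrite !inE xy.
- apply/subsetP=> u; rewrite !inE => /andP[_ /(subsetP sY)]; rewrite !inE.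
  by case/orP => [/eqP ->//|/(subsetP sA)].
- apply/subsetP=> u; rewrite !inE => /andP[_ /(subsetP sX)]; rewrite !inE.
  by case/orP => [/eqP ->//|/andP[]].
apply/and3P; split.
- rewrite -setI_eq0; apply/eqP/setP=> u; rewrite !inE; apply/negbTE.
  apply/negP => /andP[/andP[ux uY] /andP[uy uX]].
  move: (subsetP sY _ uY) (subsetP sX _ uX).
  by rewrite !inE (negbTE ux) (negbTE uy) /= => ->.
- apply/forall_inP => u; rewrite inE => /andP[_ uY].
  by have := tY u uY; have := deg_inD1 r Y u x; clear; lia.
- apply/forall_inP => u; rewrite inE => /andP[_ uX].
  by have := tX u uX; have := deg_inD1 r X u y; clear; lia.
Qed.

End Stiebitz.

(** * Rotations of Hamiltonian paths (Posa) *)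

Section Consecutive.
Variable T : eqType.
Implicit Types (c u w : seq T).

Let infix_consE (s : seq T) y c : infix s (y :: c) = prefix s (y :: c) || infix s c.
Proof. by []. Qed.

Lemma infix2_rcons_cat (a b x : T) u w :
  infix [:: a; b] (rcons u x ++ w) ->
  [\/ infix [:: a; b] (rcons u x), infix [:: a; b] w | a = x /\ ohead w = Some b].
Proof.
elim: u => [|y u IH].
  change (rcons [::] x ++ w) with (x :: w); rewrite infix_consE => /orP[|]; last by constructor 2.
  rewrite prefix_cons => /andP[/eqP ->]; case: w => // z w; rewrite prefix_cons => /andP[/eqP -> _].
  by constructor 3.
rewrite rcons_cons cat_cons infix_consE => /orP[|/IH[h|h|h]].
- rewrite prefix_cons => /andP[/eqP ay bu]; constructor 1; rewrite infix_consE ay prefix_cons eqxx /=.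
  case: u bu {IH} => [|z u]; last by rewrite rcons_cons cat_cons !prefix_cons => /andP[-> _]; rewrite prefix0s.
  by change (rcons [::] x ++ w) with (x :: w); rewrite !prefix_cons => /andP[-> _]; rewrite prefix0s.
- by constructor 1; rewrite infix_consE h orbT.
- by constructor 2.
- by constructor 3.
Qed.

Lemma infix2_nth (x0 x y : T) c : uniq c -> infix [:: x; y] c ->
  y = nth x0 c (index x c).+1 /\ x = nth x0 c (index y c).-1.
Proof.
move=> cu /infixP[u [w cE]]; move: cu; rewrite cE cat_uniq => /and3P[_ uN /= /and3P[xN yN _]].
have xu : x \notin u by apply: contraNN uN => xu; apply/hasP; exists x; rewrite ?inE ?eqxx.
have yu : y \notin u by apply: contraNN uN => yu; apply/hasP; exists y; rewrite ?inE ?eqxx ?orbT.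
have xy : x == y = false by apply: contraNF xN => /eqP ->; rewrite inE eqxx.
rewrite !index_cat (negbTE xu) (negbTE yu) /= eqxx xy eqxx addn0 addn1 /=.
split; rewrite nth_cat; first by rewrite ltnNge leqnSn subSnn.
by rewrite ltnn subnn.
Qed.

Lemma infix2_rev (a b : T) c : infix [:: a; b] (rev c) = infix [:: b; a] c.
Proof. by rewrite -[RHS]infix_rev. Qed.

End Consecutive.

Section Posa.
Variables (T : finType) (e : rel T).
Hypothesis e_sym : symmetric e.
Implicit Types (c u w p : seq T) (V A : {set T}) (s t x y : T).

Definition ham_path V s t : Prop :=
  exists p, [/\ path e s p, uniq (s :: p), last s p = t & s :: p =i V].

Lemma sorted_cat_cons u x w : sorted e (u ++ x :: w) = sorted e (rcons u x) && path e x w.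
Proof.
case: u => [|y u] //=.
by rewrite cat_path rcons_path /= andbA.
Qed.

Lemma path_rev x w : path e x w -> e (last x w) x -> path e x (rev w).
Proof.
case: w => [|y w] //= /andP[_ pw] ex.
rewrite lastI rev_rcons /= e_sym ex /= rev_path.
by rewrite (eq_path (e' := e)) // => a b; rewrite e_sym.
Qed.

(* Rotating [s .. x y .. t] along the edge [t x] gives [s .. x t .. y]. *)
Lemma sorted_rotation u x w :
  sorted e (u ++ x :: w) -> e (last x w) x -> sorted e (u ++ x :: rev w).
Proof. by rewrite !sorted_cat_cons => /andP[-> /= pw ex]; apply: path_rev. Qed.

Section Rotations.
Variables (V : {set T}) (s : T) (c0 : seq T).
Hypothesis c0_sorted : sorted e c0.
Hypothesis c0_uniq : uniq c0.
Hypothesis c0_V : c0 =i V.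
Hypothesis c0_head : ohead c0 = Some s.

(** Closure under arbitrarily many rotations with [s] fixed: a rotation applied to a path ending in
    [rotation_ends] must again end there. *)
Inductive rotated : seq T -> Prop :=
| rotated0 : rotated c0
| rotatedS u x w : rotated (u ++ x :: w) -> w != [::] -> e (last x w) x ->
    rotated (u ++ x :: rev w).

Lemma rotated_ham c : rotated c -> [/\ sorted e c, uniq c, c =i V & ohead c = Some s].
Proof.
elim=> {c} [|u x w _ [cs cu cV ch] w0 ex]; first by split.
split; first exact: sorted_rotation.
- rewrite cat_uniq cons_uniq rev_uniq mem_rev.
  move: cu; rewrite cat_uniq cons_uniq => /and3P[-> hu ->] /=; rewrite andbT.
  apply: contraNN hu => /=; case/orP => [->//|/hasP[z]]; rewrite mem_rev => zw zu.
  by apply/orP; right; apply/hasP; exists z.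
- by move=> z; rewrite -cV !mem_cat !inE mem_rev.
- by case: u ch {cs cu cV}.
Qed.

Definition rotation_ends : {set T} :=
  [set t | `[< exists2 c, rotated c & last s c = t >]].

Let R := rotation_ends.

Lemma rotation_ends_ham t : t \in R -> ham_path V s t.
Proof.
rewrite inE => /asboolP[c /rotated_ham[cs cu cV ch] lt].
case: c ch cs cu cV lt => // _ p [->] /= cs cu cV lt.
by exists p.
Qed.

Lemma rotation_end_next u x y w :
  rotated (u ++ x :: y :: w) -> e (last x (y :: w)) x -> y \in R.
Proof.
move=> rc ex; rewrite inE; apply/asboolP; exists (u ++ x :: rev (y :: w)).
  by apply: rotatedS.
by rewrite last_cat /= rev_cons last_rcons.
Qed.

(* A rotation deletes only an edge one of whose ends becomes an endpoint. *)
Lemma rotated_keeps_edges a b c : rotated c -> a \notin R -> b \notin R ->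
  infix [:: a; b] c0 -> infix [:: a; b] c || infix [:: b; a] c.
Proof.
move=> rc aR bR ab; elim: rc => [|u x w rc IH w0 ex]; first by rewrite ab.
case: w w0 rc IH ex => // y w _ rc IH ex.
have yR := rotation_end_next rc ex.
have step a' b' : b' != y -> infix [:: a'; b'] (u ++ x :: y :: w) ->
    infix [:: a'; b'] (u ++ x :: rev (y :: w)) || infix [:: b'; a'] (u ++ x :: rev (y :: w)).
  rewrite -[u ++ x :: y :: w]cat_rcons -[u ++ x :: rev _]cat_rcons => b'y /infix2_rcons_cat[h|h|[_ [/eqP]]].
  - by rewrite infix_catr.
  - by rewrite orbC infix_catl // infix2_rev.
  - by rewrite eq_sym (negbTE b'y).
have ay : a != y by apply: contraNneq aR => ->.
have bY : b != y by apply: contraNneq bR => ->.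
case/orP: IH => h; first exact: step.
by rewrite orbC; apply: step.
Qed.

(** The heart of Posa's lemma. If no neighbour of [x] on [c0] is an end, all edges of [c0] at [x]
    survive in the rotated path [c] ending at [t]. But rotating [c] along [t x] makes the successor
    of [x] in [c] an end, so both old neighbours would have to be the predecessor of [x]. *)
Lemma rotation_ends_nbr t x : t \in R -> e t x -> x \in V -> x \notin R ->
  exists2 z, z \in R & infix [:: x; z] c0 || infix [:: z; x] c0.
Proof.
move=> tR etx xV xR.
have [/existsP[z /andP[zR h]]|nz] :=
  boolP [exists z, (z \in R) && (infix [:: x; z] c0 || infix [:: z; x] c0)]; first by exists z.
exfalso; have nbr z : infix [:: x; z] c0 || infix [:: z; x] c0 -> z \notin R.
  by move=> h; apply: contraNN nz => zR; apply/existsP; exists z; rewrite zR.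
move: (tR); rewrite inE => /asboolP[c rc lt].
have [cs cu cV ch] := rotated_ham rc.
have xc : x \in c by rewrite cV.
case/splitPr: xc rc lt cs cu cV ch => u w rc lt cs cu cV ch.
have lw : last x w = t by rewrite -lt last_cat.
case: w rc lt cs cu cV ch lw => [|y w] rc lt cs cu cV ch lw.
  by move: xR; rewrite [x]lw tR.
have yR : y \in R by apply: rotation_end_next rc _; rewrite lw.
have xyc : infix [:: x; y] (u ++ x :: y :: w) by apply/infixP; exists u, w.
have only z : z \notin R -> infix [:: x; z] (u ++ x :: y :: w) = false.
  move=> zR; apply: contraNF zR => h.
  have [-> _] := infix2_nth x cu h.
  by have [<- _] := infix2_nth x cu xyc.
have t0R : last s c0 \in R by rewrite inE; apply/asboolP; exists c0 => //; apply: rotated0.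
have xc0 : x \in c0 by rewrite c0_V.
have [u0 [w0 c0E]] : exists u0 w0, c0 = u0 ++ x :: w0.
  by case/splitPr: xc0 => u0 w0; exists u0, w0.
have [z [w1 w0E]] : exists z w1, w0 = z :: w1.
  case: w0 c0E => [|z w1] c0E; last by exists z, w1.
  by move: xR; rewrite (_ : x = last s c0) ?t0R // c0E last_cat.
have xz : infix [:: x; z] c0 by apply/infixP; exists u0, w1; rewrite c0E w0E.
have zR : z \notin R by apply: nbr; rewrite xz.
have := rotated_keeps_edges rc xR zR xz; rewrite only //= => zxc.
(* If [x = s], then [x] heads [c] as well and has no predecessor there; [infix2_nth] at index 0
   would give [z = x]. *)
case/lastP: u0 c0E => [|u0 z0] c0E.
  have xs : x = s by move: c0_head; rewrite c0E => -[].
  have [_ zE] := infix2_nth x cu zxc.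
  case: u {rc lt cs cV xyc only zxc} ch cu zE => [|v u].
    move=> _ _; rewrite /= eqxx /= => zx; move: c0_uniq.
    by rewrite c0E w0E zx /= inE eqxx.
  by case=> ->; rewrite -xs cat_cons cons_uniq mem_cat inE eqxx orbT.
have z0x : infix [:: z0; x] c0 by apply/infixP; exists u0, w0; rewrite c0E -cats1 -catA.
have z0R : z0 \notin R by apply: nbr; rewrite z0x orbT.
have := rotated_keeps_edges rc z0R xR z0x; rewrite orbC only //= => z0xc.
have [_ zE] := infix2_nth x cu zxc; have [_ z0E] := infix2_nth x cu z0xc.
have zz0 : z = z0 by rewrite zE -z0E.
move: c0_uniq; rewrite c0E w0E zz0 cat_uniq => /and3P[_ /negP[]].
by apply/hasP; exists z0; rewrite ?mem_rcons !inE eqxx ?orbT.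
Qed.

(** Each outside neighbour of an end is a neighbour along [c0] of some end, and an end has at most
    two of those. *)
Lemma card_rotation_ends :
  (forall t x, t \in R -> e t x -> x \in V) ->
  #|R :|: [set x | [exists t in R, e t x]]| <= 3 * #|R|.
Proof.
move=> RV; pose nx z := nth s c0 (index z c0).+1; pose pv z := nth s c0 (index z c0).-1.
have sub : R :|: [set x | [exists t in R, e t x]] \subset R :|: (nx @: R :|: pv @: R).
  apply/subsetP => x; rewrite !in_setU; have [//|xR] := boolP (x \in R).
  rewrite orFb inE => /exists_inP[t tR etx].
  have [z zR] := rotation_ends_nbr tR etx (RV _ _ tR etx) xR.
  rewrite orFb; case/orP => /(infix2_nth s c0_uniq) [h1 h2]; apply/orP.
    by right; apply/imsetP; exists z.
  by left; apply/imsetP; exists z.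
apply: leq_trans (subset_leq_card sub) _.
apply: leq_trans (leq_card_setU _ _) _.
have [+ _] := leq_card_setU (nx @: R) (pv @: R).
have := leq_imset_card nx R; have := leq_imset_card pv R.
clear; lia.
Qed.

End Rotations.

(** A set of at most [a] ends would expand by more than the factor 3 allowed by
    [card_rotation_ends]. The ends are thinned to exactly [a.+1], so that later counts over them
    have a fixed size. *)
Theorem Posa_endpoints V s t a :
  ham_path V s t ->
  (forall t' x, ham_path V s t' -> e t' x -> x \in V) ->
  (forall A : {set T}, A \subset V -> 0 < #|A| <= a ->
     3 * #|A| < #|A :|: [set x | [exists t' in A, e t' x]]|) ->
  exists2 S : {set T}, #|S| = a.+1 & forall t', t' \in S -> ham_path V s t'.
Proof.
move=> [p [pp up lp pV]] NV expand.
have tR : last s (s :: p) \in rotation_ends s (s :: p).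
  by rewrite inE; apply/asboolP; exists (s :: p) => //; apply: rotated0.
have RH t' : t' \in rotation_ends s (s :: p) -> ham_path V s t'.
  exact: rotation_ends_ham.
have aR : a < #|rotation_ends s (s :: p)|.
  rewrite ltnNge; apply/negP => Ra.
  have := expand (rotation_ends s (s :: p)).
  rewrite Ra andbT => /(_ _ _)/wrap[].
  - apply/subsetP=> x /RH[q [_ _ <- qV]]; rewrite -qV; exact: mem_last.
  - by rewrite card_gt0; apply/set0Pn; exists (last s (s :: p)).
  apply/negP; rewrite -leqNgt; apply: (@card_rotation_ends V) => //.
  by move=> t' x /RH; apply: NV.
have /set0Pn[S] : [set S : {set T} | S \subset rotation_ends s (s :: p) & #|S| == a.+1] != set0.
  by rewrite -card_gt0 cards_draws bin_gt0.
rewrite inE => /andP[sS /eqP cS]; exists S => // t' /(subsetP sS); exact: RH.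
Qed.

End Posa.

(** * Random subsets *)

Section RandomSubset.
Local Open Scope ring_scope.
Variables (R : realType) (I : finType) (p : R) (U : {set I}).
Hypothesis p01 : 0 <= p <= 1.
Implicit Types (E Q W S : {set I}) (A B : pred {set I}).

Let p0 : 0 <= p. Proof. by case/andP: p01. Qed.
Let p1 : p <= 1. Proof. by case/andP: p01. Qed.

(* Elements of [U] are kept independently with probability [p], the others never. *)
Definition bern E : R :=
  \prod_(e : I) (if e \in E then (if e \in U then p else 0) else (if e \in U then 1 - p else 1)).

Definition Pr A : R := \sum_(E : {set I} | A E) bern E.

Lemma bern_ge0 E : 0 <= bern E.
Proof.
apply: prodr_ge0 => e _; case: ifP => _; case: ifP => _ //.
by rewrite subr_ge0.
Qed.

(** Common source of all moments below: by independence the expectation of a product over elements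
    factors, with weight [c e] for a present and [d e] for an absent element. *)
Lemma bern_expectation (c d : I -> R) :
  \sum_(E : {set I}) bern E * \prod_(e : I) (if e \in E then c e else d e) =
  \prod_(e in U) (p * c e + (1 - p) * d e) * \prod_(e in ~: U) d e.
Proof.
transitivity (\prod_(e : I) ((if e \in U then p else 0) * c e + (if e \in U then 1 - p else 1) * d e)).
  rewrite bigA_distr; apply: eq_bigr => E _.
  rewrite /bern -big_split /=; apply: eq_bigr => e _.
  by case: (e \in E).
rewrite (bigID (mem U)) /=; congr (_ * _).
  by apply: eq_bigr => e ->.
apply: eq_big => [e|e /negbTE ->]; first by rewrite inE.
by rewrite mul0r add0r mul1r.
Qed.

Lemma bern_sum1 : \sum_(E : {set I}) bern E = 1.
Proof.
have := bern_expectation (fun=> 1) (fun=> 1).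
rewrite (eq_bigr bern); last first.
  by move=> E _; rewrite big1 ?mulr1 // => e _; case: ifP.
move=> ->; rewrite [X in _ * X]big1 // mulr1 big1 // => e _.
by rewrite !mulr1 addrC subrK.
Qed.

Lemma bern_support E : ~~ (E \subset U) -> bern E = 0.
Proof.
case/subsetPn => e eE eU; rewrite /bern (bigD1 e) //= eE (negbTE eU).
by rewrite mul0r.
Qed.

Lemma Pr_ge0 A : 0 <= Pr A.
Proof. by apply: sumr_ge0 => E _; apply: bern_ge0. Qed.

Lemma Pr_le A B : (forall E, E \subset U -> A E -> B E) -> Pr A <= Pr B.
Proof.
move=> AB; rewrite /Pr big_mkcond [leRHS]big_mkcond /=; apply: ler_sum => E _.
have [sE|/bern_support ->] := boolP (E \subset U); last by do 2!case: ifP.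
by case: ifP => [/(AB E sE) ->//|_]; case: ifP => // _; apply: bern_ge0.
Qed.

Lemma Pr_markov A (f : {set I} -> R) :
  (forall E, E \subset U -> 0 <= f E) -> (forall E, E \subset U -> A E -> 1 <= f E) ->
  Pr A <= \sum_(E : {set I}) bern E * f E.
Proof.
move=> f0 f1; rewrite /Pr big_mkcond /=; apply: ler_sum => E _.
have [sE|/bern_support ->] := boolP (E \subset U); last by rewrite mul0r; case: ifP.
case: ifP => [/(f1 E sE) h|_]; last by rewrite mulr_ge0 ?bern_ge0 ?f0.
by rewrite ler_peMr ?bern_ge0.
Qed.

Lemma Pr_union (J : finType) (P : pred J) (A : J -> pred {set I}) :
  Pr (fun E => [exists (i | P i), A i E]) <= \sum_(i | P i) Pr (A i).
Proof.
rewrite /Pr (exchange_big_dep predT) //= [leLHS]big_mkcond /=; apply: ler_sum => E _.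
rewrite sumr_const; case: ifP => [/exists_inP[i Pi AE]|_].
  rewrite -[leLHS]mulr1n ler_wpMn2l ?bern_ge0 //.
  by apply/card_gt0P; exists i; rewrite unfold_in Pi.
by rewrite mulrn_wge0 ?bern_ge0.
Qed.

Lemma Pr_or A B : Pr (fun E => A E || B E) <= Pr A + Pr B.
Proof.
rewrite /Pr [X in X + _]big_mkcond [X in _ + X]big_mkcond -big_split /= [leLHS]big_mkcond /=.
apply: ler_sum => E _; have := bern_ge0 E.
by case: (A E); case: (B E) => /= h; rewrite ?addr0 ?add0r // lerDl.
Qed.

Lemma prodr_if (S W : {set I}) (x : R) : \prod_(e in S) (if e \in W then x else 1) = x ^+ #|S :&: W|.
Proof.
rewrite -big_mkcondr /= prodr_const; congr (_ ^+ _).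
by apply: eq_card => e; rewrite !inE.
Qed.

Lemma expR_sum_mem (S E : {set I}) (l : R) :
  expR (l * #|E :&: S|%:R) = \prod_(e : I) (if e \in E then (if e \in S then expR l else 1) else 1).
Proof.
rewrite mulrC expRM_natl -prodr_if big_mkcond.
by apply: eq_bigr => e _.
Qed.

(* The Chernoff bound comes with the factor [p ^+ #|S|], which pays for the union bound over [S]. *)
Lemma Pr_sub_low S Q (l x : R) : S \subset U -> Q \subset U -> 0 <= l ->
  Pr (fun E => (S \subset E) && (#|E :&: Q|%:R <= x)) <=
  p ^+ #|S| * expR (l * x - p * #|Q :\: S|%:R * (l - l ^+ 2)).
Proof.
move=> SU QU l0.
pose c e : R := if e \in Q :\: S then expR (- l) else 1.
(* Weight 0 for an absent element of [S] builds the indicator of [S \subset E] into the exponential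
   moment; only [Q :\: S] is left to fluctuate. *)
pose d e : R := if e \in S then 0 else 1.
pose f E : R := expR (l * x) * \prod_(e : I) (if e \in E then c e else d e).
have fE E : S \subset E -> f E = expR (l * x - l * #|E :&: (Q :\: S)|%:R).
  move=> SE; rewrite /f expRD; congr (_ * _).
  rewrite -mulNr expR_sum_mem; apply: eq_bigr => e _; rewrite /c /d.
  by case: ifP => // /negbT eE; case: ifP => // /(subsetP SE); rewrite (negbTE eE).
apply: le_trans (Pr_markov (f := f) _ _) _.
- move=> E _; rewrite mulr_ge0 ?expR_ge0 //; apply: prodr_ge0 => e _.
  by rewrite /c /d; do 2![case: ifP => // _]; rewrite expR_ge0.
- move=> E _ /andP[SE lE]; rewrite fE // -[leLHS]expR0 ler_expR -mulrBr mulr_ge0 // subr_ge0.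
  apply: le_trans lE; rewrite ler_nat; apply/subset_leq_card/setIS/subsetDl.
rewrite (eq_bigr (fun E => expR (l * x) * (bern E * \prod_(e : I) (if e \in E then c e else d e)))); last first.
  by move=> E _; rewrite /f mulrCA.
rewrite -mulr_sumr bern_expectation.
rewrite [X in _ * (_ * X)]big1 ?mulr1; last first.
  move=> e; rewrite inE /d => eU; case: ifP => // /(subsetP SU) eU'; by rewrite eU' in eU.
rewrite (big_setID S) /= (setIidPr SU).
have -> : \prod_(i in S) (p * c i + (1 - p) * d i) = p ^+ #|S|.
  rewrite -prodr_const; apply: eq_bigr => e eS.
  by rewrite /c /d inE eS /= mulr1 mulr0 addr0.
rewrite mulrCA ler_wpM2l ?exprn_ge0 // expRD ler_wpM2l ?expR_ge0 //.
have le1 e : e \in U :\: S -> p * c e + (1 - p) * d e <=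
    (if e \in Q :\: S then expR (- (p * (l - l ^+ 2))) else 1).
  rewrite inE => /andP[eS eU]; rewrite /c /d inE eS /= (negbTE eS).
  case: ifP => _; last by rewrite !mulr1 addrC subrK.
  (* Follows from [1 + l <= expR l] and (1 - l + l^2)(1 + l) = 1 + l^3 >= 1. *)
  have h : expR (- l) <= 1 - l + l ^+ 2.
    have : expR (- l) * (1 + l) <= 1.
      rewrite -{2}(@mulVf _ (expR l)) ?gt_eqF ?expR_gt0 // expRN ler_wpM2l ?invr_ge0 ?expR_ge0 //.
      exact: expR_ge1Dx.
    have e0 := expR_gt0 (- l); move: l0 e0; set y := expR _ => l0 e0.
    rewrite !expr2 => yl; rewrite -(ler_pM2r (x := 1 + l)); last by lra.
    by apply: (le_trans yl); have := mulr_ge0 l0 (mulr_ge0 l0 l0); lra.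
  have := expR_ge1Dx (- (p * (l - l ^+ 2))).
  have := ler_wpM2l p0 h; lra.
apply: (@le_trans _ _ (\prod_(e in U :\: S) (if e \in Q :\: S then expR (- (p * (l - l ^+ 2))) else 1))).
  apply: ler_prod => e eUS; rewrite le1 // andbT addr_ge0 // mulr_ge0 ?subr_ge0 // /c /d.
    by case: ifP => //; rewrite expR_ge0.
  by case: ifP.
rewrite prodr_if -expRM_natl ler_expR.
have -> : (U :\: S) :&: (Q :\: S) = Q :\: S.
  by apply/setIidPr; rewrite setSD.
by rewrite le_eqVlt; apply/orP; left; apply/eqP; ring.
Qed.

Lemma Pr_up Q (l x : R) : Q \subset U -> 0 <= l ->
  Pr (fun E => x <= #|E :&: Q|%:R) <= expR (p * #|Q|%:R * (expR l - 1) - l * x).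
Proof.
move=> QU l0.
pose c e : R := if e \in Q then expR l else 1.
pose f E : R := expR (- (l * x)) * \prod_(e : I) (if e \in E then c e else 1).
have fE E : f E = expR (l * #|E :&: Q|%:R - l * x).
  by rewrite /f expRD mulrC; congr (_ * _); rewrite expR_sum_mem.
apply: le_trans (Pr_markov (f := f) _ _) _.
- by move=> E _; rewrite fE expR_ge0.
- by move=> E _ lE; rewrite fE -[leLHS]expR0 ler_expR -mulrBr mulr_ge0 // subr_ge0.
rewrite (eq_bigr (fun E => expR (- (l * x)) * (bern E * \prod_(e : I) (if e \in E then c e else 1)))); last first.
  by move=> E _; rewrite /f mulrCA.
rewrite -mulr_sumr bern_expectation [X in _ * (_ * X)]big1 ?mulr1; last by [].
rewrite [in leRHS]addrC expRD ler_wpM2l ?expR_ge0 //.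
apply: (@le_trans _ _ (\prod_(e in U) (if e \in Q then expR (p * (expR l - 1)) else 1))).
  apply: ler_prod => e eU; have [hc hc0] : p * c e + (1 - p) <= (if e \in Q then expR (p * (expR l - 1)) else 1)
     /\ 0 <= c e.
    rewrite /c; case: ifP => _; last by split=> //; rewrite !mulr1 addrC subrK.
    by split; [have := expR_ge1Dx (p * (expR l - 1)); lra | rewrite expR_ge0].
  by rewrite hc andbT addr_ge0 ?subr_ge0 // mulr_ge0.
rewrite prodr_if -expRM_natl ler_expR (setIidPr QU).
by rewrite le_eqVlt; apply/orP; left; apply/eqP; ring.
Qed.

Lemma Pr_disjoint W : W \subset U -> Pr (fun E => E :&: W == set0) = (1 - p) ^+ #|W|.
Proof.
move=> WU; have := bern_expectation (fun e => if e \in W then 0 else 1) (fun=> 1).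
rewrite [X in _ = _ * X]big1 ?mulr1 // => h.
transitivity (\sum_(E : {set I}) bern E * \prod_(e : I) (if e \in E then (if e \in W then 0 else 1) else 1)).
  rewrite /Pr big_mkcond /=; apply: eq_bigr => E _; case: ifP => EW.
    rewrite big1 ?mulr1 // => e _; case: ifP => // eE; case: ifP => // eW.
    by move/eqP/setP/(_ e): EW; rewrite !inE eE eW.
  have /set0Pn[e] : E :&: W != set0 by rewrite EW.
  by rewrite inE => /andP[eE eW]; rewrite (bigD1 e) //= eE eW mul0r mulr0.
rewrite h -{2}(setIidPr WU) -prodr_if; apply: eq_bigr => e _.
by case: ifP; rewrite ?mulr0 ?add0r ?mulr1 // addrC subrK.
Qed.

Lemma expectation_card S : S \subset U ->
  \sum_(E : {set I}) bern E * #|E :&: S|%:R = p * #|S|%:R.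
Proof.
move=> SU.
have mem1 e : e \in U -> \sum_(E : {set I}) bern E * (e \in E)%:R = p.
  move=> eU; have := bern_expectation (fun=> 1) (fun i => if i == e then 0 else 1).
  rewrite [X in _ = _ * X]big1 ?mulr1; last first.
    by move=> i; rewrite inE => iU; case: eqP => // ie; rewrite ie eU in iU.
  rewrite [RHS](_ : _ = p) => [<-|]; last first.
    rewrite (bigD1 e eU) /= eqxx mulr0 addr0 big1 ?mulr1 // => i /andP[_ /negbTE ->].
    by rewrite mulr1 addrC subrK.
  apply: eq_bigr => E _; congr (_ * _); have [eE|eE] := boolP (e \in E).
    by rewrite big1 // => i _; case: ifP => // iE; case: eqP => // ie; rewrite ie eE in iE.
  by rewrite (bigD1 e) //= (negbTE eE) eqxx mul0r.
transitivity (\sum_(E : {set I}) \sum_(e in S) bern E * (e \in E)%:R).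
  apply: eq_bigr => E _; rewrite -mulr_sumr; congr (_ * _).
  rewrite -natr_sum -big_mkcondr sum1_card; congr (_ %:R).
  by apply: eq_card => e; rewrite !inE andbC.
rewrite exchange_big /= (eq_bigr (fun=> p)) => [|e /(subsetP SU) /mem1 //].
by rewrite sumr_const mulr_natr.
Qed.

End RandomSubset.

Lemma exists_of_average (R : realType) (I : finType) (w f : I -> R) (c : R) :
  (forall i, 0 <= w i)%R -> (\sum_i w i = 1)%R -> (\sum_i w i * f i < c)%R ->
  exists2 i, (0 < w i)%R & (f i < c)%R.
Proof.
move=> w0 w1 wf; have [/existsP[i /andP[h1 h2]]|] := boolP [exists i, (0 < w i)%R && (f i < c)%R].
  by exists i.
rewrite negb_exists => /forallP h; exfalso; move: wf; apply/negP; rewrite -leNgt.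
rewrite -[leLHS]mul1r -w1 mulr_suml; apply: ler_sum => i _.
have := h i; rewrite negb_and -!leNgt => /orP[wi|]; last by move=> fi; apply: ler_wpM2l.
have -> : w i = 0%R by apply/eqP; rewrite eq_le wi w0.
by rewrite !mul0r.
Qed.

(** Deterministic in [F], so applicable to an [F] chosen by the adversary: fresh randomness keeps
    each element of [F] with probability [q]. Size over [3 * q * B] and misses over [2 * mu] have
    expectations at most 1/3 and 1/2, with sum below 1, so some sample meets both bounds. *)
Lemma sparse_hitting (R : realType) (I J : finType) (F : {set I}) (W : J -> {set I}) (P : pred J)
    (q B mu : R) :
  (0 < q <= 1 -> 0 < B -> #|F|%:R <= B -> 0 < mu ->
   (forall j, P j -> W j \subset F) -> \sum_(j | P j) (1 - q) ^+ #|W j| <= mu ->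
   exists F' : {set I}, [/\ F' \subset F, #|F'|%:R <= 3 * q * B &
     #|[set j | P j & F' :&: W j == set0]|%:R < 2 * mu])%R.
Proof.
move=> /andP[q0 q1] B0 FB mu0 WF hmu.
have q01 : (0 <= q <= 1)%R by rewrite ltW.
pose miss F' := [set j | P j & F' :&: W j == set0].
pose f F' : R := (#|F' :&: F|%:R / (3 * q * B) + #|miss F'|%:R / (2 * mu))%R.
have cB : (0 < 3 * q * B)%R by rewrite !mulr_gt0.
have cm : (0 < 2 * mu)%R by rewrite mulr_gt0.
have [||F' wF' fF'] := @exists_of_average R _ (bern q F) f 1%R (bern_ge0 F q01).
- exact: bern_sum1.
- have -> : (\sum_i bern q F i * f i = q * #|F|%:R / (3 * q * B) +
       (\sum_(j | P j) (1 - q) ^+ #|W j|) / (2 * mu))%R.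
    rewrite (eq_bigr (fun i : {set I} => bern q F i * #|i :&: F|%:R / (3 * q * B) +
        bern q F i * #|miss i|%:R / (2 * mu)))%R; last first.
      by move=> i _; rewrite /f mulrDr !mulrA.
    rewrite big_split /= -!mulr_suml expectation_card //; congr (_ + _ / _)%R.
    rewrite (eq_bigr (fun i : {set I} => \sum_(j | P j) bern q F i * (i :&: W j == set0)%:R)%R); last first.
      move=> i _; rewrite -mulr_sumr; congr (_ * _)%R; rewrite -natr_sum -big_mkcondr sum1_card.
      by congr (_ %:R)%R; apply: eq_card => j; rewrite !inE.
    rewrite exchange_big /=; apply: eq_bigr => j /WF /(Pr_disjoint q) <-.
    rewrite /Pr [in RHS]big_mkcond /=; apply: eq_bigr => i _.
    by case: ifP; rewrite ?mulr1 ?mulr0.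
  have h1 : (q * #|F|%:R / (3 * q * B) <= 1 / 3)%R.
    by rewrite ler_pdivrMr // mulrC; have := ler_wpM2l (ltW q0) FB; lra.
  have h2 : ((\sum_(j | P j) (1 - q) ^+ #|W j|) / (2 * mu) <= 1 / 2)%R.
    by rewrite ler_pdivrMr //; lra.
  by apply: le_lt_trans (lerD h1 h2) _; lra.
have sF' : F' \subset F by apply: contraLR wF' => /bern_support ->; rewrite ltxx.
exists F'; split=> //; move: fF'; rewrite /f (setIidPl sF').
  move=> h; have : (#|F'|%:R / (3 * q * B) <= 1)%R.
    by apply: le_trans (ltW h); rewrite lerDl divr_ge0 // ltW.
  by rewrite ler_pdivrMr // mul1r.
move=> h; have : (#|miss F'|%:R / (2 * mu) < 1)%R.
  by apply: le_lt_trans h; rewrite lerDr divr_ge0 // ltW.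
by rewrite ltr_pdivrMr // mul1r.
Qed.

Lemma expR1_le4 (R : realType) : (expR 1 <= 4 :> R)%R.
Proof.
have h : (expR (2^-1) <= 2 :> R)%R.
  have := @expR_ge1Dx R (- 2^-1)%R; rewrite expRN => h.
  have h2 : (2^-1 <= (expR 2^-1)^-1 :> R)%R by apply: le_trans h; lra.
  by rewrite -lef_pV2 ?posrE ?expR_gt0.
have -> : (1 = 2%:R * 2^-1 :> R)%R by rewrite mulfV.
rewrite expRM_natl; have := expR_ge0 (2^-1 : R)%R.
move: h; set y := expR _ => h y0; rewrite expr2.
by have := ler_pM y0 y0 h h; lra.
Qed.

(** The estimate binom(n, s) <= (e n / s)^s, with 4 for e and multiplied out: the left side is one
    term of the expansion of (1 + s/n)^n <= exp s. *)
Lemma bin_le_pow (R : realType) n s : (s <= n)%N ->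
  ('C(n, s)%:R * (s%:R / n%:R) ^+ s <= 4 ^+ s :> R)%R.
Proof.
case: n => [|n] sn; first by move: sn; rewrite leqn0 => /eqP ->; rewrite bin0 !expr0 mulr1.
set x := (s%:R / n.+1%:R : R)%R.
have x0 : (0 <= x)%R by rewrite divr_ge0.
have h : ('C(n.+1, s)%:R * x ^+ s <= (x + 1) ^+ n.+1)%R.
  rewrite exprD1n (bigD1 (Ordinal (sn : (s < n.+2)%N))) //= mulr_natl lerDl.
  by apply: sumr_ge0 => i _; rewrite mulrn_wge0 ?exprn_ge0.
apply: (le_trans h).
have : (x + 1 <= expR x)%R by rewrite addrC expR_ge1Dx.
move=> h1; apply: le_trans (_ : expR x ^+ n.+1 <= _)%R.
  by rewrite lerXn2r ?nnegrE ?addr_ge0 ?expR_ge0.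
rewrite -expRM_natl mulrC /x -mulrA mulVf ?pnatr_eq0 // mulr1.
rewrite -[s%:R%R]mulr1 expRM_natl lerXn2r ?nnegrE ?expR_ge0 //.
exact: expR1_le4.
Qed.

Lemma ler_sum_card (R : realType) (J : finType) (F : J -> R) (c : R) :
  (forall i, F i <= c)%R -> (\sum_i F i <= #|J|%:R * c)%R.
Proof. by move=> Fc; rewrite mulr_natl -sumr_const; apply: ler_sum. Qed.

(** * Edge counts of random graphs *)

Section RandomGraph.
Local Open Scope ring_scope.
Variables (R : realType) (T : finType) (p : R).
Hypothesis p01 : 0 <= p <= 1.
Implicit Types (E S : {set {set T}}) (X Y : {set T}).

Let p0 : 0 <= p. Proof. by case/andP: p01. Qed.
Let p1 : p <= 1. Proof. by case/andP: p01. Qed.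

Definition pairs : {set {set T}} := [set e : {set T} | #|e| == 2%N].
Definition edges_in E X : {set {set T}} := [set e in E | e \subset X].
Definition edges_meeting E X : {set {set T}} := [set e in E | ~~ [disjoint e & X]].

Notation n := #|T|.
Notation Pr := (Pr p pairs).
Notation B := (p * n%:R ^+ 2 : R).

Let B0 : 0 <= B. Proof. by rewrite mulr_ge0 // exprn_ge0. Qed.

Lemma card_pairs : #|pairs| = 'C(n, 2).
Proof. exact: card_draws. Qed.

Lemma card_pairs_le : #|pairs|%:R <= n%:R ^+ 2 :> R.
Proof.
rewrite card_pairs -natrX ler_nat bin2; apply: leq_trans (half_leq (leq_mul (leqnn _) (leq_pred _))) _.
by rewrite mulnn -divn2 leq_div.
Qed.

Lemma edges_inE E X : E \subset pairs -> edges_in E X = E :&: edges_in pairs X.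
Proof. by move=> sE; apply/setP=> e; rewrite !inE; case: (boolP (e \in E)) => //= /(subsetP sE); rewrite inE => ->. Qed.

Lemma edges_meetingE E X : E \subset pairs -> edges_meeting E X = E :&: edges_meeting pairs X.
Proof. by move=> sE; apply/setP=> e; rewrite !inE; case: (boolP (e \in E)) => //= /(subsetP sE); rewrite inE => ->. Qed.

Lemma card_edges_in_pairs X : #|edges_in pairs X| = 'C(#|X|, 2).
Proof. by rewrite -cards_draws; apply: eq_card => e; rewrite !inE andbC. Qed.

(** Chernoff bound at [l = ln (4 / y)]: the hypothesis makes the exponent at most
    [h * #|X| * (1 - l)], and [expR (1 - l) <= y] because e <= 4. *)
Lemma Pr_dense1 X (h y : R) : 42 <= h -> 0 < y <= 1 -> 2 * #|X|%:R * p <= h * y ->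
  Pr (fun E => h * #|X|%:R <= #|E :&: edges_in pairs X|%:R) <= y ^+ (42 * #|X|).
Proof.
move=> h42 /andP[y0 y1] hy; set s : R := #|X|%:R in hy *.
have s0 : 0 <= s by rewrite /s.
have QU : edges_in pairs X \subset pairs by apply/subsetP=> e; rewrite inE => /andP[].
have z1 : 1 <= 4 / y by rewrite ler_pdivlMr // mul1r; lra.
have zp : 0 < 4 / y by rewrite divr_gt0.
have l0 : 0 <= ln (4 / y) by rewrite ln_ge0.
apply: le_trans (Pr_up p01 (h * s) QU l0) _.
rewrite lnK ?posrE //.
have qs : p * #|edges_in pairs X|%:R * (4 / y - 1) <= h * s.
  have q2 : #|edges_in pairs X|%:R <= s ^+ 2 / 2.
    rewrite card_edges_in_pairs /s; case: #|X| => [|m]; first by rewrite bin0n expr0n mul0r.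
    rewrite ler_pdivlMr // -natrM -natrX ler_nat muln2 bin2 /=.
    apply: leq_trans (_ : m.+1 * m <= _)%N; last by rewrite -mulnn leq_mul.
    by rewrite -[leqRHS](odd_double_half); rewrite leq_addl.
  have : p * #|edges_in pairs X|%:R <= p * (s ^+ 2 / 2) by rewrite ler_wpM2l.
  move=> h1; apply: le_trans (_ : p * (s ^+ 2 / 2) * (4 / y) <= _).
    apply: ler_pM => //; [by rewrite mulr_ge0| |]; first by rewrite subr_ge0.
    by rewrite lerBlDr lerDl.
  have -> : p * (s ^+ 2 / 2) * (4 / y) = s * (2 * s * p) / y by field; rewrite gt_eqF.
  rewrite ler_pdivrMr //.
  by have := ler_wpM2l s0 hy; lra.
set L := ln (4 / y) in l0 *.
apply: le_trans (_ : expR (h * s * (1 - L)) <= _); first by rewrite ler_expR; lra.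
have eL : expR (1 - L) <= y.
  rewrite expRB lnK ?posrE // invf_div mulrA ler_pdivrMr // mulrC.
  by rewrite ler_wpM2l ?expR1_le4 // ltW.
have L1 : 1 - L <= 0 by rewrite -ler_expR expR0; apply: le_trans y1.
apply: le_trans (_ : expR ((42 * #|X|)%:R * (1 - L)) <= _).
  rewrite ler_expR; apply: ler_wnM2r => //; rewrite natrM -/s ler_wpM2r //.
by rewrite expRM_natl lerXn2r ?nnegrE ?expR_ge0 // ltW.
Qed.

(** One factor of [w] supplies A s / n, and s 2^-(s-1) <= 1 absorbs the rest. Sets of bounded size
    thus also get an inverse power of n. *)
Lemma self_power_le (A w : R) s : (0 < s)%N -> 0 < w <= 1/2 -> w = A * s%:R / n%:R ->
  w ^+ s <= A / n%:R.
Proof.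
case: s => // s _ /andP[w0 w1] wE; rewrite exprS.
have hs : s.+1%:R * w ^+ s <= 1.
  apply: le_trans (_ : s.+1%:R * (1/2) ^+ s <= _).
    by rewrite ler_wpM2l // lerXn2r ?nnegrE // ?ltW // divr_ge0.
  rewrite expr_div_n expr1n mul1r ler_pdivrMr ?exprn_gt0 // mul1r -natrX ler_nat.
  by rewrite ltn_expl.
have An : 0 <= A / n%:R.
  rewrite -(pmulr_lge0 (x := s.+1%:R)) //; move: w0.
  by rewrite wE mulrAC => /ltW.
have -> : w * w ^+ s = (A / n%:R) * (s.+1%:R * w ^+ s) by rewrite {1}wE; ring.
by rewrite ler_piMr.
Qed.

Definition dense_subset (h : R) (rng : pred nat) E : bool :=
  [exists X : {set T}, [&& X != set0, rng #|X| & h * #|X|%:R <= #|edges_in E X|%:R]].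

(** Union bound over sets with [y] the square root of w = A s / n in [Pr_dense1]. All sets of one
    size [s] together contribute at most (A / n)^10, whence the factor n for the sizes. *)
Lemma Pr_dense (h A b : R) (rng : pred nat) : 42 <= h -> 0 < A -> b <= 1/2 -> 4 * A * b ^+ 10 <= 1 ->
  (forall s, (0 < s <= n)%N -> rng s ->
     (2 * s%:R * p / h) ^+ 2 <= A * s%:R / n%:R <= b) ->
  Pr (dense_subset h rng) <= n%:R * (A / n%:R) ^+ 10.
Proof.
move=> h42 A0 b12 Ab hrng.
have h0 : 0 < h by apply: lt_le_trans h42.
pose P X := (X != set0) && rng #|X|.
apply: le_trans (_ : Pr (fun E => [exists (X | P X), h * #|X|%:R <= #|E :&: edges_in pairs X|%:R]) <= _).
  apply: Pr_le => // E sE /existsP[X /and3P[X0 rX hX]].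
  by apply/exists_inP; exists X; [rewrite /P X0|rewrite -edges_inE].
apply: le_trans (Pr_union _ p01 _ _) _.
pose F s : R := if (0 < s)%N && rng s then 'C(n, s)%:R^-1 * (A / n%:R) ^+ 10 else 0.
apply: le_trans (_ : \sum_(X | P X) F #|X| <= _).
  apply: ler_sum => X /andP[X0 rX]; have s0 : (0 < #|X|)%N by rewrite card_gt0.
  rewrite /F s0 rX /=.
  have sn : (#|X| <= n)%N by apply: max_card.
  have n0 : 0 < n%:R :> R by rewrite ltr0n (leq_trans s0).
  have /andP[w1 w2] := hrng _ (introT andP (conj s0 sn)) rX.
  set w := A * #|X|%:R / n%:R in w1 w2.
  have w0 : 0 < w by rewrite /w !mulr_gt0 ?invr_gt0 // ltr0n.
  pose y := Num.sqrt w.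
  have y0 : 0 < y by rewrite sqrtr_gt0.
  have y2 : y ^+ 2 = w by rewrite sqr_sqrtr // ltW.
  have y1 : y <= 1 by rewrite -[leRHS]sqrtr1 ler_wsqrtr //; lra.
  have hy : 2 * #|X|%:R * p <= h * y.
    rewrite [leRHS]mulrC -ler_pdivrMr //.
    rewrite -(@ler_sqr _ (2 * #|X|%:R * p / h)) ?nnegrE ?(ltW y0) ?y2 //.
    by rewrite divr_ge0 ?(ltW h0) // !mulr_ge0.
  apply: le_trans (Pr_dense1 h42 (introT andP (conj y0 y1)) hy) _.
  have -> : (42 * #|X| = 2 * (21 * #|X|))%N by rewrite mulnA.
  rewrite exprM y2.
  have bs := @bin_le_pow R n #|X| sn.
  have c0 : 0 < 'C(n, #|X|)%:R :> R by rewrite ltr0n bin_gt0.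
  rewrite -ler_pdivrMl ?invr_gt0 // invrK.
  have xE : #|X|%:R / n%:R = w / A by rewrite /w; field; rewrite !gt_eqF.
  rewrite xE in bs.
  (* With s = [#|X|], the exponent 21 s is split as s + 10 s + 10 s: the first part pays for the
     number of sets up to 4^s A^s, the second absorbs 4^s A^s, and the third becomes (A / n)^10 by
     [self_power_le]. *)
  have -> : 'C(n, #|X|)%:R * w ^+ (21 * #|X|) =
     ('C(n, #|X|)%:R * (w / A) ^+ #|X|) * (A ^+ #|X| * w ^+ (10 * #|X|)) * (w ^+ #|X|) ^+ 10.
    have e21 : w ^+ (21 * #|X|) = w ^+ #|X| * w ^+ (10 * #|X|) * w ^+ (10 * #|X|).
      by rewrite -!exprD; congr (_ ^+ _); clear; lia.
    have e10 : (w ^+ #|X|) ^+ 10 = w ^+ (10 * #|X|) by rewrite -exprM mulnC.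
    have Ax : A ^+ #|X| != 0 by rewrite expf_neq0 // gt_eqF.
    rewrite e21 e10 [(w / A) ^+ _]expr_div_n; move: Ax.
    by move: (w ^+ #|X|) (w ^+ _) (A ^+ _) => a1 a2 a3 a30; field.
  apply: le_trans (_ : 4 ^+ #|X| * (A ^+ #|X| * w ^+ (10 * #|X|)) * (w ^+ #|X|) ^+ 10 <= _).
    rewrite ler_wpM2r ?exprn_ge0 ?(ltW w0) // ler_wpM2r //.
    by rewrite mulr_ge0 // ?exprn_ge0 // ltW.
  have -> : 4 ^+ #|X| * (A ^+ #|X| * w ^+ (10 * #|X|)) = (4 * A * w ^+ 10) ^+ #|X|.
    by rewrite [(4 * A * _) ^+ _]exprMn [(4 * A) ^+ _]exprMn -[w ^+ 10 ^+ _]exprM mulrA.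
  rewrite -[leRHS]mul1r; apply: ler_pM.
  - by rewrite exprn_ge0 // !mulr_ge0 ?exprn_ge0 // ltW.
  - by rewrite !exprn_ge0 // ltW.
  - rewrite exprn_ile1 // ?mulr_ge0 ?exprn_ge0 ?(ltW w0) ?(ltW A0) //.
    apply: le_trans Ab; rewrite ler_wpM2l ?mulr_ge0 ?(ltW A0) //.
    by rewrite lerXn2r ?nnegrE ?(ltW w0) ?(le_trans (ltW w0)).
  - rewrite lerXn2r ?nnegrE ?exprn_ge0 ?(ltW w0) ?divr_ge0 ?(ltW A0) //.
    apply: self_power_le s0 _ _; last by [].
    by rewrite w0; lra.
rewrite (partition_big (fun X : {set T} => inord #|X| : 'I_n.+1) predT) //=.
apply: le_trans (_ : \sum_(s < n.+1) (if (0 < s)%N then (A / n%:R) ^+ 10 else 0) <= _).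
  apply: ler_sum => s _.
  rewrite (eq_bigr (fun=> F s)); last first.
    move=> X /andP[_ /eqP <-]; rewrite inordK // ltnS max_card //.
  rewrite sumr_const.
  have An0 : 0 <= (A / n%:R) ^+ 10 by rewrite exprn_ge0 // divr_ge0 // ltW.
  rewrite /F; case: ifP => [/andP[s0 rs]|_]; last first.
    by rewrite mul0rn; case: ifP.
  rewrite s0; have c0 : (0 < 'C(n, s))%N by rewrite bin_gt0 -ltnS.
  apply: le_trans (_ : ('C(n, s)%:R^-1 * (A / n%:R) ^+ 10) *+ 'C(n, s) <= _).
    apply: ler_wpMn2l; first by rewrite mulr_ge0 ?invr_ge0.
    rewrite -card_draws.
    apply/subset_leq_card/subsetP => X; rewrite unfold_in inE => /andP[_ /eqP <-].
    by rewrite inordK // ltnS max_card.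
  by rewrite -mulr_natl mulrA mulfV ?mul1r // pnatr_eq0 -lt0n.
rewrite big_ord_recl /= add0r (eq_bigr (fun=> (A / n%:R) ^+ 10)) //.
by rewrite sumr_const card_ord mulr_natl.
Qed.

Definition sparse_cover (m : nat) (x : R) E : bool :=
  [exists X : {set T}, (#|X| == m) && (#|edges_meeting E X|%:R <= x)].

Lemma card_edges_meeting_pairs X : (#|X| * (n - #|X|) <= #|edges_meeting pairs X|)%N.
Proof.
have -> : (n - #|X| = #|~: X|)%N by rewrite [RHS]cardsCs setCK.
rewrite -cardsX.
pose f (u : T * T) := [set u.1; u.2].
have inj : {in setX X (~: X) &, injective f}.
  move=> [a b] [c d]; rewrite !inE /= => /andP[aX bX] /andP[cX dX] /setP h.
  have := h a; have := h b; rewrite !inE !eqxx /= orbT => /esym hb /esym ha.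
  congr (_, _).
    by case/orP: ha => /eqP // ad; rewrite -ad aX in dX.
  by case/orP: hb => /eqP // bc; rewrite bc cX in bX.
rewrite -(card_in_imset inj); apply/subset_leq_card/subsetP => e /imsetP[[a b]].
rewrite !inE /= => /andP[aX bX] ->; rewrite /f /= cards2.
have -> /= : a != b by apply: contraNneq bX => <-.
by apply/pred0Pn; exists a; rewrite !inE eqxx aX.
Qed.

(** Lower tail at [l = 1/2] with nothing guessed: as 3 m <= n, the mean is at least 2 m D / 3, so
    one set has probability at most exp(-m D / 15). Since n <= m D^2, there are at most (4 D^2)^m <=
    exp(m D / 30) sets. *)
Lemma Pr_sparse_cover (m : nat) (D : R) :
  (0 < m)%N -> (3 * m <= n)%N -> D = p * n%:R -> n%:R <= m%:R * D ^+ 2 -> 4 * D ^+ 2 <= expR (D / 30) ->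
  Pr (sparse_cover m (m%:R * D / 100)) <= expR (- (m%:R * D / 30)).
Proof.
move=> m0 mn DE nD hD.
have D0 : 0 <= D by rewrite DE mulr_ge0.
have n0 : 0 < n%:R :> R by rewrite ltr0n (leq_trans _ mn) // muln_gt0.
pose P X := #|X| == m.
apply: le_trans (_ : Pr (fun E => [exists (X | P X), (set0 \subset E) &&
    (#|E :&: edges_meeting pairs X|%:R <= m%:R * D / 100)]) <= _).
  apply: Pr_le => // E sE /existsP[X /andP[X0 hX]].
  by apply/exists_inP; exists X; rewrite // sub0set -edges_meetingE.
apply: le_trans (Pr_union _ p01 _ _) _.
have l0 : 0 <= 1/2 :> R by [].
apply: le_trans (_ : \sum_(X | P X) expR (- (m%:R * D / 15)) <= _).
  apply: ler_sum => X /eqP Xm.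
  have QU : edges_meeting pairs X \subset pairs by apply/subsetP=> e; rewrite inE => /andP[].
  apply: le_trans (Pr_sub_low p01 _ (sub0set _) QU l0) _.
  rewrite cards0 expr0 mul1r ler_expR setD0.
  have q : m%:R * n%:R * (2/3) <= #|edges_meeting pairs X|%:R :> R.
    apply: le_trans (_ : (m * (n - m))%:R <= _); last by rewrite -Xm ler_nat card_edges_meeting_pairs.
    rewrite natrM natrB; last by apply: leq_trans mn; rewrite leq_pmull.
    have : (3 * m)%:R <= n%:R :> R by rewrite ler_nat.
    rewrite natrM => h; have := ler_wpM2l (ler0n R m) h; lra.
  have := ler_wpM2l p0 q; rewrite DE expr2.
  have := mulr_ge0 p0 (mulr_ge0 (ler0n R m) (ler0n R n)); lra.
rewrite sumr_const -[#|_|]/#|P|.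
have -> : #|P| = 'C(n, m) by rewrite -card_draws cardsE.
have sn : (m <= n)%N by apply: leq_trans mn; rewrite leq_pmull.
have bs := @bin_le_pow R n m sn.
have m0r : 0 < m%:R :> R by rewrite ltr0n.
have D2 : 0 < D ^+ 2.
  by rewrite -(@pmulr_rgt0 _ m%:R) //; apply: lt_le_trans nD.
have cb : 'C(n, m)%:R <= (4 * D ^+ 2) ^+ m.
  rewrite exprMn.
  have h : 1 <= (m%:R / n%:R * D ^+ 2) ^+ m.
    by rewrite exprn_ege1 // mulrAC ler_pdivlMr // mul1r.
  apply: le_trans (_ : 'C(n, m)%:R * (m%:R / n%:R * D ^+ 2) ^+ m <= _).
    by rewrite ler_peMr.
  by rewrite exprMn mulrA ler_wpM2r // exprn_ge0 // ltW.
rewrite -[leLHS]mulr_natl.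
apply: le_trans (_ : expR (D / 30) ^+ m * expR (- (m%:R * D / 15)) <= _).
  rewrite ler_wpM2r ?expR_ge0 //; apply: le_trans cb _.
  by rewrite lerXn2r ?nnegrE ?expR_ge0 // mulr_ge0 // ltW.
by rewrite -expRM_natl -expRD ler_expR; lra.
Qed.

Definition sparse_guess_low (J : finType) (Q : {set {set T}} -> J -> {set {set T}}) (g eta : R) E : bool :=
  [exists S : {set {set T}}, exists i : J, [&& S \subset E, #|S|%:R <= g &
     #|E :&: Q S i|%:R <= p * #|Q S i|%:R - eta * B]].

(* Union bound over all small subgraphs [S] of the random graph: the sets [Q S i] may depend
   on edges already exposed through [S]. *)
Lemma Pr_sparse_guess_low (J : finType) (Q : {set {set T}} -> J -> {set {set T}}) (delta eta z : R) :
  (forall S i, Q S i \subset pairs) -> 0 < z -> z <= 1 -> 0 < eta -> eta <= 1 -> 0 <= delta -> delta <= eta / 4 ->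
  Pr (sparse_guess_low Q (delta * B) eta) <=
  #|J|%:R * expR (B * (z + delta * ln z^-1 - eta ^+ 2 / 8)).
Proof.
move=> QU z0 z1 e0 e1 d0 de.
pose P (S : {set {set T}}) := (S \subset pairs) && (#|S|%:R <= delta * B).
apply: le_trans (_ : Pr (fun E => [exists (S | P S), [exists (i | predT i),
    (S \subset E) && (#|E :&: Q S i|%:R <= p * #|Q S i|%:R - eta * B)]]) <= _).
  apply: Pr_le => // E sE /existsP[S /existsP[i /and3P[SE Sg h]]].
  apply/exists_inP; exists S; first by rewrite /P Sg (subset_trans SE).
  by apply/exists_inP; exists i; rewrite // SE.
apply: le_trans (Pr_union _ p01 _ _) _.
have l0 : 0 <= eta / 2 by rewrite divr_ge0 // ltW.
have lnz : 0 <= ln z^-1 by rewrite ln_ge0 // invf_ge1.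
(* As [#|S| <= delta * B], a factor [z ^+ #|S|] can be inserted at the price exp(B delta ln(1/z)).
   The sum of [(p * z) ^+ #|S|] over all [S] is then (1 + p z)^|pairs| <= exp(B z), with no counting
   of small [S]. *)
apply: le_trans (_ : \sum_(S | P S) #|J|%:R * (expR (B * (delta * ln z^-1 - eta ^+ 2 / 8)) * (p * z) ^+ #|S|) <= _).
  apply: ler_sum => S /andP[SU Sg].
  apply: le_trans (Pr_union _ p01 _ _) _.
  apply: ler_sum_card => i.
  apply: le_trans (Pr_sub_low p01 _ SU (QU S i) l0) _.
  rewrite [(p * z) ^+ _]exprMn [leRHS]mulrCA ler_wpM2l ?exprn_ge0 //.
  have zS : expR (- (delta * B * ln z^-1)) <= z ^+ #|S|.
    rewrite -{2}(@lnK _ z) ?posrE // -expRM_natl ler_expR lnV ?posrE //.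
    rewrite mulrN opprK; apply: ler_wnM2r => //.
    by rewrite -oppr_ge0 -lnV ?posrE.
  rewrite -ler_pdivrMl ?expR_gt0 // -expRN -expRD; apply: le_trans zS.
  rewrite ler_expR.
  have qd : #|Q S i|%:R - delta * B <= #|Q S i :\: S|%:R.
    rewrite lerBlDr; apply: le_trans (_ : #|Q S i :\: S|%:R + #|S|%:R <= _); last by rewrite lerD2l.
    rewrite -natrD ler_nat -[leqLHS](cardsID S) addnC leq_add2l.
    exact/subset_leq_card/subsetIr.
  have qB : p * #|Q S i|%:R <= B.
    by rewrite ler_wpM2l // (le_trans _ card_pairs_le) // ler_nat subset_leq_card.
  have pq0 : 0 <= p * #|Q S i|%:R by rewrite mulr_ge0.
  have dB : 0 <= delta * B by rewrite mulr_ge0.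
  have pd : p * (delta * B) <= delta * B by rewrite ler_piMl.
  have c0 : 0 <= eta / 2 - (eta / 2) ^+ 2.
    have -> : eta / 2 - (eta / 2) ^+ 2 = eta / 2 * (1 - eta / 2) by ring.
    by rewrite mulr_ge0 // subr_ge0; lra.
  have h1 : p * (#|Q S i|%:R - delta * B) * (eta / 2 - (eta / 2) ^+ 2) <=
            p * #|Q S i :\: S|%:R * (eta / 2 - (eta / 2) ^+ 2).
    by rewrite ler_wpM2r // ler_wpM2l.
  have h2 : delta * B * eta <= eta / 4 * B * eta by rewrite ler_wpM2r ?(ltW e0) // ler_wpM2r.
  have h3 : p * #|Q S i|%:R * (eta * eta) <= B * (eta * eta) by rewrite ler_wpM2r // mulr_ge0 ?ltW.
  have h4 : p * (delta * B) * (eta / 2 - (eta / 2) ^+ 2) <= delta * B * (eta / 2).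
    apply: ler_pM => //; first by rewrite mulr_ge0.
    by rewrite lerBlDr lerDl sqr_ge0.
  move: h1 h2 h3 h4; rewrite !expr2.
  set q1 := #|Q S i|%:R; set q2 := #|Q S i :\: S|%:R; set L := ln _; set BB := B.
  move=> h1 h2 h3 h4; lra.
rewrite -mulr_sumr -mulr_sumr ler_wpM2l //.
have -> : B * (z + delta * ln z^-1 - eta ^+ 2 / 8) = B * (delta * ln z^-1 - eta ^+ 2 / 8) + B * z by ring.
rewrite expRD ler_wpM2l ?expR_ge0 //.
apply: le_trans (_ : \sum_(S : {set {set T}}) \prod_e (if e \in S then (if e \in pairs then p * z else 0) else 1) <= _).
  rewrite big_mkcond /=; apply: ler_sum => S _.
  case: ifP => [/andP[SU _]|_]; last first.
    by apply: prodr_ge0 => e _; do 2![case: ifP => // _]; rewrite mulr_ge0 // ltW.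
  rewrite -prodr_const big_mkcond /= le_eqVlt; apply/orP; left; apply/eqP.
  by apply: eq_bigr => e _; case: ifP => // /(subsetP SU) ->.
rewrite -bigA_distr /=.
apply: le_trans (_ : \prod_(e : {set T}) (if e \in pairs then expR (p * z) else 1) <= _).
  apply: ler_prod => e _; case: ifP => _; last by rewrite add0r lexx ler01.
  by rewrite addr_ge0 ?mulr_ge0 ?(ltW z0) // addrC expR_ge1Dx.
rewrite -big_mkcond /= prodr_const -expRM_natl ler_expR.
rewrite mulrCA mulrA mulrC [B * z]mulrC ler_wpM2l ?(ltW z0) //.
by rewrite ler_wpM2l // card_pairs_le.
Qed.

Definition family_high (J : finType) (Q : J -> {set {set T}}) (eta : R) E : bool :=
  [exists i : J, p * #|Q i|%:R + eta * B <= #|E :&: Q i|%:R].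

Lemma Pr_family_high (J : finType) (Q : J -> {set {set T}}) (eta : R) :
  (forall i, Q i \subset pairs) -> 0 < eta -> eta <= 1 ->
  Pr (family_high Q eta) <= #|J|%:R * expR (- (B * eta ^+ 2 / 8)).
Proof.
move=> QU e0 e1.
apply: le_trans (_ : Pr (fun E => [exists (i | predT i),
    p * #|Q i|%:R + eta * B <= #|E :&: Q i|%:R]) <= _).
  by apply: Pr_le => // E sE /existsP[i h]; apply/exists_inP; exists i.
apply: le_trans (Pr_union _ p01 _ _) _.
have l0 : 0 <= eta / 4 by rewrite divr_ge0 // ltW.
apply: ler_sum_card => i.
apply: le_trans (Pr_up p01 _ (QU i) l0) _; rewrite ler_expR.
have qB : p * #|Q i|%:R <= B.
  by rewrite ler_wpM2l // (le_trans _ card_pairs_le) // ler_nat subset_leq_card.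
have pq0 : 0 <= p * #|Q i|%:R by rewrite mulr_ge0.
have eb : expR (eta / 4) - 1 <= eta / 4 + 2 * (eta / 4) ^+ 2.
  have h : expR (eta / 4) * (1 - eta / 4) <= 1.
    have := expR_ge1Dx (- (eta / 4)); rewrite expRN => h.
    have h0 := expR_gt0 (eta / 4).
    rewrite mulrC -ler_pdivlMr // mul1r; exact: h.
  rewrite lerBlDr -(ler_pM2r (x := 1 - eta / 4)); last by lra.
  apply: (le_trans h); rewrite !expr2.
  have := mulr_ge0 (mulr_ge0 (ltW e0) (ltW e0)) (_ : 0 <= 1 - eta); rewrite subr_ge0 => /(_ e1).
  have := mulr_ge0 (ltW e0) (ltW e0); lra.
have h1 := ler_wpM2l pq0 eb.
have h2 : p * #|Q i|%:R * (eta * eta) <= B * (eta * eta) by rewrite ler_wpM2r // mulr_ge0 ?ltW.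
by move: h1 h2; rewrite !expr2; set BB := B; lra.
Qed.

End RandomGraph.

(** * Edge sets as adjacency relations *)

Section EdgeSets.
Variable T : finType.
Implicit Types (E S F M : {set {set T}}) (A B K V : {set T}) (s t v x y : T).

Definition adjE S : rel T := fun x y => [set x; y] \in S.

Lemma adjE_sym S : symmetric (adjE S).
Proof. by move=> x y; rewrite /adjE setUC. Qed.

Lemma adjE_neq S x y : S \subset pairs T -> adjE S x y -> x != y.
Proof.
by move=> sS /(subsetP sS); rewrite inE cards2; case: (x == y).
Qed.

Lemma adjE_mono S F : S \subset F -> subrel (adjE S) (adjE F).
Proof. by move=> sSF x y; apply: (subsetP sSF). Qed.

Lemma set2_inj v x y : v != x -> v != y -> [set v; x] = [set v; y] -> x = y.
Proof.
move=> vx vy /setP/(_ x); rewrite !inE eqxx orbT [x == v]eq_sym (negbTE vx) /=.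
by move/esym/eqP.
Qed.

Lemma deg_in_edges S (X : {set T}) v : S \subset pairs T -> v \in X ->
  deg_in (adjE S) X v = #|[set e in S | (v \in e) && (e \subset X)]|.
Proof.
move=> sS vX; rewrite /deg_in -(@card_in_imset _ _ (fun u => [set v; u])).
  apply: eq_card => e; apply/imsetP/idP => [[u]|].
    rewrite inE => /andP[uX vu] ->; rewrite !inE eqxx /= subUset !sub1set vX uX !andbT; exact: vu.
  rewrite inE => /and3P[eS ve eX].
  have /cards2P[x [y [xy eE]]] : #|e| == 2 by have := subsetP sS e eS; rewrite inE.
  have [/eqP vx|vx] := boolP (v == x).
    exists y; last by rewrite eE vx.
    by rewrite inE /adjE vx -eE eS andbT (subsetP eX) // eE !inE eqxx orbT.
  have vy : v = y by move: ve; rewrite eE !inE (negbTE vx) => /eqP.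
  exists x; last by rewrite eE vy setUC.
  by rewrite inE /adjE vy setUC -eE eS andbT (subsetP eX) // eE !inE eqxx.
move=> x y; rewrite !inE => /andP[_ /(adjE_neq sS) vx] /andP[_ /(adjE_neq sS) vy].
exact: set2_inj.
Qed.

(** Double counting: an edge can lie in [C v] only for its two ends [v]. *)
Lemma sum_incident_le (A : {set T}) (C : T -> {set {set T}}) M : M \subset pairs T ->
  (forall v, v \in A -> C v \subset M) -> (forall v e, v \in A -> e \in C v -> v \in e) ->
  \sum_(v in A) #|C v| <= 2 * #|M|.
Proof.
move=> sM CM Ce.
rewrite (eq_bigr (fun v => \sum_(e in M) (e \in C v : nat))); last first.
  move=> v vA; rewrite -sum1_card [RHS]big_mkcond [LHS]big_mkcond; apply: eq_bigr => e _.
  by have := subsetP (CM v vA) e; case: (e \in C v) => [/(_ isT) ->//|_]; case: ifP.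
rewrite exchange_big /= mulnC -sum_nat_const; apply: leq_sum => e eM.
have /eqP <- : #|e| == 2 by have := subsetP sM e eM; rewrite inE.
rewrite -sum1_card [leqLHS]big_mkcond [leqRHS]big_mkcond /=; apply: leq_sum => v _.
case: ifP => // vA; have := Ce v e vA; case: (e \in C v) => [/(_ isT) ->//|_].
by case: ifP.
Qed.

Definition star_pairs A (X : T -> {set T}) : {set T * T} :=
  [set u | (u.1 \in A) && (u.2 \in X u.1)].

(** Removing [A] from the leaf sets makes centre and leaf recoverable from the unordered edge, so
    edges and ordered pairs have the same count. *)
Definition stars A (X : T -> {set T}) : {set {set T}} :=
  [set [set u.1; u.2] | u in star_pairs A (fun t => X t :\: A)].

Lemma star_pairs_inj A (X : T -> {set T}) :
  {in star_pairs A (fun t => X t :\: A) &, injective (fun u : T * T => [set u.1; u.2])}.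
Proof.
move=> [a b] [c d]; rewrite !inE /= => /and3P[aX bA _] /and3P[cX dA _] /setP h.
have := h a; have := h b; rewrite !inE !eqxx /= orbT => /esym hb /esym ha.
congr (_, _).
  by case/orP: ha => /eqP // ad; rewrite -ad aX in dA.
by case/orP: hb => /eqP // bc; rewrite bc cX in bA.
Qed.

Lemma stars_pairs A (X : T -> {set T}) : stars A X \subset pairs T.
Proof.
apply/subsetP=> e /imsetP[[a b]]; rewrite !inE /= => /and3P[aA bA _] ->; rewrite cards2.
have -> : a != b by apply: contraNneq bA => <-.
by [].
Qed.

Lemma card_star_pairs A (X : T -> {set T}) : #|star_pairs A X| = \sum_(t in A) #|X t|.
Proof.
rewrite -sum1_card (eq_bigl (fun u : T * T => (u.1 \in A) && (u.2 \in X u.1))).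
  rewrite -(pair_big_dep (mem A) (fun t => mem (X t)) (fun _ _ => 1)) /=.
  by apply: eq_bigr => t _; rewrite sum1_card.
by move=> u; rewrite inE.
Qed.

Lemma card_stars A (X : T -> {set T}) : #|stars A X| = \sum_(t in A) #|X t :\: A|.
Proof. by rewrite card_in_imset ?card_star_pairs //; apply: star_pairs_inj. Qed.

Lemma card_setI_stars E A (X : T -> {set T}) :
  #|E :&: stars A X| = \sum_(t in A) deg_in (adjE E) (X t :\: A) t.
Proof.
have -> : E :&: stars A X =
    [set [set u.1; u.2] | u in star_pairs A (fun t => [set x in X t :\: A | adjE E t x])].
  apply/setP=> e; rewrite inE; apply/andP/imsetP => [[eE /imsetP[u uS eu]]|[u uS ->]].
    exists u => //; move: uS; rewrite !inE => /and3P[-> -> ->] /=.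
    by rewrite /adjE -eu.
  move: uS; rewrite !inE => /and3P[uA /andP[uN uX] ad]; split=> //.
  by apply/imsetP; exists u; rewrite // !inE uA uN.
rewrite card_in_imset ?card_star_pairs //.
move=> u w uS wS; apply: (@star_pairs_inj A X).
  by move: uS; rewrite !inE => /and3P[-> -> _].
by move: wS; rewrite !inE => /and3P[-> -> _].
Qed.

Definition closed_nbh S A : {set T} := A :|: [set x | [exists t in A, adjE S t x]].

Lemma closed_nbh_sub S A B : A \subset B -> closed_nbh S A \subset closed_nbh S B.
Proof.
move=> sAB; apply/setUSS => //; apply/subsetP=> x; rewrite !inE.
by case/exists_inP => t /(subsetP sAB) tB h; apply/exists_inP; exists t.
Qed.

Lemma closed_nbhS S F A : S \subset F -> closed_nbh S A \subset closed_nbh F A.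
Proof.
move=> sSF; apply/setUS/subsetP=> x; rewrite !inE => /exists_inP[t tA h].
by apply/exists_inP; exists t => //; apply: (subsetP sSF).
Qed.

Lemma ham_path_mono (e f : rel T) V s t : subrel e f -> ham_path e V s t -> ham_path f V s t.
Proof. by move=> ef [p [pp up lp pV]]; exists p; split=> //; apply: sub_path pp. Qed.

Lemma ham_path_sym (e : rel T) V s t : symmetric e -> ham_path e V s t -> ham_path e V t s.
Proof.
move=> es [p [pp up lp pV]]; exists (rev (belast s p)).
have rE : t :: rev (belast s p) = rev (s :: p) by rewrite [s :: p]lastI rev_rcons lp.
split.
- by rewrite -lp rev_path (eq_path (e' := e)) // => a b; rewrite es.
- by rewrite rE rev_uniq.
- case: p pp up lp pV rE => [|z p] //= pp up lp pV rE.
  by rewrite rev_cons last_rcons.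
- by move=> x; rewrite rE mem_rev pV.
Qed.

Lemma ham_path_last_in (e : rel T) V s t : ham_path e V s t -> t \in V.
Proof. by case=> p [_ _ <- <-]; apply: mem_last. Qed.

(** The pivot of the rotation that makes [y] the new end. At [y = s] the truncated predecessor gives
    [s] itself, so that case is excluded in its uses as a pivot. *)
Definition prv s (p : seq T) y : T := nth s (s :: p) (index y (s :: p)).-1.

Lemma prv_split s p y : y \in s :: p -> y != s ->
  exists u w, s :: p = u ++ prv s p y :: y :: w.
Proof.
move=> yc ys; set c := s :: p; set i := index y c.
have i0 : 0 < i by rewrite /i /c /= eq_sym (negbTE ys).
have ic : i < size c by rewrite index_mem.
exists (take i.-1 c), (drop i.+1 c).
have yE : nth s c i = y by apply: nth_index.
rewrite /prv -/c -/i -{1}yE -(drop_nth s ic).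
rewrite -[in drop i c](prednK i0) -(drop_nth s) ?cat_take_drop //.
exact: leq_ltn_trans (leq_pred _) ic.
Qed.

Lemma prv_in s p y : prv s p y \in s :: p.
Proof.
rewrite /prv; set c := s :: p; have [yc|yc] := boolP (y \in c).
  by apply: mem_nth; apply: leq_ltn_trans (leq_pred _) _; rewrite index_mem.
by rewrite memNindex // [size c]/= [_.-1]/= mem_nth.
Qed.

Lemma prv_inj s p : uniq (s :: p) -> {in [set y in s :: p] :\ s &, injective (prv s p)}.
Proof.
move=> up y z; rewrite !inE => /andP[ys yc] /andP[zs zc].
have iy : 0 < index y (s :: p) by rewrite /= eq_sym (negbTE ys).
have iz : 0 < index z (s :: p) by rewrite /= eq_sym (negbTE zs).
move/eqP; rewrite /prv nth_uniq //; try by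
  apply: leq_ltn_trans (leq_pred _) _; rewrite index_mem inE.
move/eqP => h; have {}h : index y (s :: p) = index z (s :: p) by rewrite -(prednK iy) h prednK.
have yc' : y \in s :: p by rewrite inE.
have zc' : z \in s :: p by rewrite inE.
by rewrite -(nth_index s yc') h nth_index.
Qed.

Lemma ham_path_rotate S S' V s t p y :
  path (adjE S) s p -> uniq (s :: p) -> last s p = t -> s :: p =i V ->
  y \in V -> y != s -> S \subset S' -> adjE S' t (prv s p y) -> ham_path (adjE S') V s y.
Proof.
move=> pp up lp pV yV ys SS' ad.
have [|u [w cE]] := @prv_split s p y _ ys; first by rewrite pV.
set x := prv s p y in cE ad.
have lt : last x (y :: w) = t by rewrite -lp -[last s p]/(last s (s :: p)) cE last_cat.
have so : sorted (adjE S') (u ++ x :: rev (y :: w)).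
  apply: sorted_rotation; [exact: adjE_sym| |by rewrite lt].
  by rewrite -cE /=; apply: sub_path pp; apply: adjE_mono.
have pe : perm_eq (u ++ x :: rev (y :: w)) (s :: p).
  by rewrite cE perm_cat2l perm_cons perm_rev.
have [q qE] : exists q, u ++ x :: rev (y :: w) = s :: q.
  case: u cE {so pe} => [|z u] [-> _]; first by exists (rev (y :: w)).
  by exists (u ++ x :: rev (y :: w)).
exists q; split.
- by move: so; rewrite qE.
- by rewrite -qE (perm_uniq pe).
- have : last s (s :: q) = y by rewrite -qE last_cat /= rev_cons last_rcons.
  by [].
- by move=> z; rewrite -qE (perm_mem pe) pV.
Qed.

End EdgeSets.

Lemma sum_card_exchange (I J : finType) (A : {set I}) (B : {set J}) (P : I -> J -> bool) :
  \sum_(i in A) #|[set j in B | P i j]| = \sum_(j in B) #|[set i in A | P i j]|.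
Proof.
have h (K L : finType) (X : {set K}) (Q : L -> K -> bool) l :
    #|[set k in X | Q l k]| = \sum_(k in X) (Q l k : nat).
  by rewrite -sum1dep_card big_mkcondr; apply: eq_bigr => k _; case: (Q l k).
rewrite (eq_bigr (fun i => \sum_(j in B) (P i j : nat))); last by move=> i _; apply: h.
rewrite exchange_big /=; apply: eq_bigr => j _.
by rewrite (h _ _ A (fun j i => P i j)).
Qed.

(** One Hamiltonian path fixed as a function of [S], [V], [s], [t] alone, so that the families below
    are determined by the guess [S]. *)
Definition ham_tail (T : finType) (S : {set {set T}}) V s t : seq T :=
  if pselect (ham_path (adjE S) V s t) is left h then sval (cid h) else [::].

Lemma ham_tailP (T : finType) (S : {set {set T}}) V s t :
  ham_path (adjE S) V s t -> let p := ham_tail S V s t in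
  [/\ path (adjE S) s p, uniq (s :: p), last s p = t & s :: p =i V].
Proof. by move=> h; rewrite /ham_tail; case: pselect => // h'; apply: (svalP (cid h')). Qed.

(** * Resilience of pseudorandom graphs *)

Section Families.
Variable T : finType.

(** The boolean merges two families, edges leaving a set and edges inside a set, into one union
    bound. *)
Definition fam_up (i : bool * {set T} * {set T}) : {set {set T}} :=
  if i.1.1 then stars i.1.2 (fun=> i.2) else edges_in (pairs T) i.1.2.

Definition fam_stars (S : {set {set T}}) (i : {set T} * {set T}) : {set {set T}} :=
  stars i.1 (fun=> i.2).

(* Pairs [{t, x}] whose presence lets the Hamiltonian path of [S[V]] from [s] to [t] be rotated
   to end in [Y], or extended outside [V]. *)
Definition fam_rotations (S : {set {set T}}) (i : T * {set T} * {set T} * {set T} * {set T}) :=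
  let: (s, A, Y, V, K) := i in
  stars A (fun t => [set prv s (ham_tail S V s t) y | y in Y] :|: (K :\: V)).

(** Pairs that would close a Hamiltonian path of [S[V]] starting in the first set into a cycle. *)
Definition fam_closing (S : {set {set T}}) (i : {set T} * {set T}) : {set {set T}} :=
  stars i.1 (fun s => [set y | `[< ham_path (adjE S) i.2 s y >]]).

Lemma fam_up_pairs i : fam_up i \subset pairs T.
Proof.
rewrite /fam_up; case: ifP => _; first exact: stars_pairs.
by apply/subsetP=> e; rewrite inE => /andP[].
Qed.

End Families.

Section Counts.
Local Open Scope ring_scope.
Variables (R : realType) (T : finType) (p eps eta0 : R).
Variables (E F : {set {set T}}) (K : {set T}).
Implicit Types (A Y : {set T}) (S : {set {set T}}).
Notation n := #|T|.
Notation B := (p * n%:R ^+ 2 : R).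
Hypothesis p_gt0 : 0 < p.
Hypothesis eps0 : 0 < eps.
Hypothesis eps1 : eps <= 1/4.
Hypothesis sE : E \subset pairs T.
Hypothesis sFE : F \subset E.
Hypothesis FK : forall e, e \in F -> e \subset K.

Definition dgK v : nat := deg_in (adjE E) K v.
Definition dgF v : nat := deg_in (adjE F) K v.
Definition dgH v : nat := #|[set u in K | adjE E v u && ~~ adjE F v u]|.

Hypothesis res : forall v, v \in K -> (dgH v)%:R <= (1/2 - eps) * (dgK v)%:R.
Hypothesis Eup : ~~ family_high p (@fam_up T) eta0 E.
Hypothesis Elow : ~~ sparse_guess_low p (@fam_stars T) 0 eta0 E.

Let p0 : 0 <= p. Proof. exact: ltW. Qed.
Let al0 : 0 <= 1/2 - eps. Proof. by have := eps1; lra. Qed.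

Lemma family_high_lt (J : finType) (Q : J -> {set {set T}}) (eta : R) i :
  ~~ family_high p Q eta E -> #|E :&: Q i|%:R < p * #|Q i|%:R + eta * B.
Proof. by rewrite negb_exists => /forallP/(_ i); rewrite -ltNge. Qed.

Lemma guess_low_gt (J : finType) (Q : {set {set T}} -> J -> {set {set T}}) (g eta : R) S i :
  ~~ sparse_guess_low p Q g eta E -> S \subset E -> #|S|%:R <= g ->
  p * #|Q S i|%:R - eta * B < #|E :&: Q S i|%:R.
Proof.
rewrite negb_exists => /forallP/(_ S); rewrite negb_exists => /forallP/(_ i) h SE Sg.
by move: h; rewrite SE Sg /= -ltNge.
Qed.

Lemma dgK_split v : dgK v = (dgF v + dgH v)%N.
Proof.
rewrite /dgK /dgF /dgH /deg_in -(cardsID [set u | adjE F v u]); congr (_ + _)%N.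
  apply: eq_card => u; rewrite !inE -andbA; congr (_ && _).
  by apply/andP/idP => [[]//|h]; split=> //; apply: (adjE_mono sFE).
by apply: eq_card => u; rewrite !inE andbC -andbA.
Qed.

Lemma dgF_half v : v \in K -> (dgK v <= 2 * dgF v)%N.
Proof.
move=> vK; have := res vK; have := dgK_split v.
move=> h; rewrite h natrD => hr.
have : (dgH v)%:R <= (dgF v)%:R :> R.
  have : 0 <= (dgH v)%:R :> R by []; have : 0 <= (dgF v)%:R :> R by [].
  have := eps0; have := eps1; move: hr.
  set x := (dgH v)%:R; set y := (dgF v)%:R => hr h1 h0 y0 x0.
  have := mulr_ge0 (ltW h0) y0; have := mulr_ge0 (ltW h0) x0; lra.
rewrite ler_nat; clear; lia.
Qed.

(** Edges from [A] to [K :\: A] count once and edges inside [A] twice, which gives the main term and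
    an error of 1 + 2 times [eta0 * B]. *)
Lemma sum_dgK A : A \subset K ->
  (\sum_(t in A) dgK t)%:R <= p * (#|A|%:R * #|K|%:R) + 3 * eta0 * B.
Proof.
move=> AK.
have KE : K = (K :\: A) :|: A.
  by apply/setP=> u; rewrite !inE; case: (boolP (u \in A)) => //= [/(subsetP AK)|]; rewrite ?orbF.
have dis : [disjoint K :\: A & A].
  by rewrite -setI_eq0 setIC setIDA setIC -setIDA setDv setI0.
have -> : (\sum_(t in A) dgK t = #|E :&: fam_up (true, A, K)| + \sum_(t in A) deg_in (adjE E) A t)%N.
  rewrite /fam_up /= card_setI_stars -big_split /=; apply: eq_bigr => t _.
  by rewrite /dgK {1}KE deg_inU.
have h1 := family_high_lt (true, A, K) Eup.
have h2 := family_high_lt (false, A, K) Eup.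
have h3 : (\sum_(t in A) deg_in (adjE E) A t <= 2 * #|E :&: fam_up (false, A, K)|)%N.
  rewrite (eq_bigr (fun t => #|[set e in E | (t \in e) && (e \subset A)]|)); last first.
    by move=> t tA; rewrite deg_in_edges.
  apply: sum_incident_le.
  - by apply: subset_trans sE; apply: subsetIl.
  - move=> v vA; apply/subsetP=> e; rewrite !inE => /and3P[eE ve ->].
    by rewrite eE andbT; have := subsetP sE e eE; rewrite inE.
  - by move=> v e vA; rewrite inE => /and3P[].
have c1 : #|fam_up (true, A, K)|%:R = #|A|%:R * (#|K|%:R - #|A|%:R) :> R.
  rewrite /fam_up /= card_stars sum_nat_const natrM cardsDS // natrB //.
  exact: subset_leq_card.
have c2 : 2 * #|fam_up (false, A, K)|%:R <= #|A|%:R * #|A|%:R :> R.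
  rewrite /fam_up /= card_edges_in_pairs -!natrM ler_nat bin2 mul2n.
  apply: leq_trans (_ : #|A| * #|A|.-1 <= _)%N; last by rewrite leq_mul2l leq_pred orbT.
  by rewrite -[leqRHS]odd_double_half leq_addl.
rewrite natrD; have : (\sum_(t in A) deg_in (adjE E) A t)%:R <= 2 * #|E :&: fam_up (false, A, K)|%:R :> R.
  by rewrite -natrM ler_nat.
have := ler_wpM2l p0 c2; rewrite c1 in h1.
move: h1 h2; set x1 := #|E :&: fam_up (true, A, K)|%:R; set x2 := #|E :&: fam_up (false, A, K)|%:R.
set x3 := (\sum_(t in A) deg_in _ _ _)%:R; set x4 := #|fam_up (false, A, K)|%:R; set BB := B.
lra.
Qed.

Lemma sum_dgH A : A \subset K ->
  (\sum_(t in A) dgH t)%:R <= (1/2 - eps) * (p * (#|A|%:R * #|K|%:R) + 3 * eta0 * B).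
Proof.
move=> AK; apply: le_trans (ler_wpM2l al0 (sum_dgK AK)).
rewrite !natr_sum mulr_sumr; apply: ler_sum => t /(subsetP AK); exact: res.
Qed.

Lemma low_stars A Y :
  p * (#|A|%:R * #|Y :\: A|%:R) - eta0 * B < (\sum_(t in A) deg_in (adjE E) (Y :\: A) t)%:R.
Proof.
have := guess_low_gt (A, Y) Elow (sub0set _); rewrite cards0 => /(_ (lexx _)).
by rewrite /fam_stars /= card_setI_stars card_stars sum_nat_const natrM.
Qed.

Lemma card_E_le : eta0 <= 1/2 -> #|E|%:R <= B.
Proof.
move=> h0; have := family_high_lt (false, setT, setT) Eup.
rewrite /fam_up /= card_edges_in_pairs cardsT -edges_inE //.
have -> : edges_in E setT = E by apply/setP=> e; rewrite inE subsetT andbT.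
have c : 'C(n, 2)%:R <= n%:R ^+ 2 / 2 :> R.
  rewrite ler_pdivlMr // -natrM -natrX ler_nat bin2 muln2.
  apply: leq_trans (_ : n * n.-1 <= _)%N; last by rewrite -mulnn leq_mul2l leq_pred orbT.
  by rewrite -[leqRHS]odd_double_half leq_addl.
have B0 : 0 <= B by rewrite mulr_ge0 // exprn_ge0.
move=> /ltW h; apply: (le_trans h).
have := ler_wpM2l p0 c; have := ler_wpM2r B0 h0.
by set c2 := 'C(n, 2)%:R; set nn := n%:R ^+ 2; lra.
Qed.

Lemma deg_in_dgH A Y t : A :&: Y = set0 -> t \in A -> Y \subset K ->
  (forall x, x \in Y -> ~~ adjE F t x) -> (deg_in (adjE E) Y t <= dgH t)%N.
Proof.
move=> AY tA YK nF; apply/subset_leq_card/subsetP=> x; rewrite !inE => /andP[xY ->].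
by rewrite (subsetP YK) //= nF.
Qed.

(** Otherwise [H] contains all edges of [E] from [A] to [K :\: A], nearly p |A| |K| / 2 of them,
    more than the share 1/2 - eps allows. *)
Lemma large_cut A : A \subset K -> A != set0 -> (2 * #|A| <= #|K|)%N ->
  4 * eta0 * n%:R ^+ 2 <= eps * (#|A|%:R * #|K|%:R) -> 0 <= eta0 ->
  exists t x, [/\ t \in A, x \in K :\: A & adjE F t x].
Proof.
move=> AK A0 A2 hA e00.
have [/existsP[t /existsP[x /and3P[h1 h2 h3]]]|nex] :=
  boolP [exists t, exists x, [&& t \in A, x \in K :\: A & adjE F t x]]; first by exists t, x.
exfalso; have := low_stars A K; have := sum_dgH AK.
have : (\sum_(t in A) deg_in (adjE E) (K :\: A) t <= \sum_(t in A) dgH t)%N.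
  apply: leq_sum => t tA; apply: (deg_in_dgH (A := A)) => //; first last.
  - move=> x xKA; apply: contraNN nex => h; apply/existsP; exists t; apply/existsP; exists x.
    by rewrite tA xKA.
  - exact: subsetDl.
  - by rewrite setIDA setIC -setIDA setDv setI0.
rewrite -(ler_nat R) cardsDS // natrB ?subset_leq_card //.
have a2 : 2 * #|A|%:R <= #|K|%:R :> R by rewrite -natrM ler_nat.
set x1 := (\sum_(t in A) deg_in _ _ _)%:R; set x2 := (\sum_(t in A) dgH t)%:R.
move: a2 hA; set ka := #|K|%:R; set aa := #|A|%:R; set nn := n%:R ^+ 2 => a2 hA h1 h2 h3.
have aa0 : 0 <= aa by rewrite /aa.
have nn0 : 0 <= nn by rewrite /nn exprn_ge0.
have h4 : p * (4 * eta0 * nn) <= p * (eps * (aa * ka)) by rewrite ler_wpM2l.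
have h5 : p * (aa * (2 * aa)) <= p * (aa * ka) by rewrite !ler_wpM2l.
have h6 : 0 <= eta0 * (p * nn) by rewrite !mulr_ge0.
have h7 : 0 <= eps * (eta0 * (p * nn)) by rewrite mulr_ge0 // ltW.
move: h1 h2 h3; lra.
Qed.

End Counts.

(** * Sparse expanding subgraphs of the resilient graph *)

Section Expansion.
Local Open Scope ring_scope.
Variables (R : realType) (T : finType) (p eps eta0 : R).
Variables (E F : {set {set T}}) (K : {set T}).
Implicit Types (A X : {set T}) (S : {set {set T}}).
Notation n := #|T|.
Notation B := (p * n%:R ^+ 2 : R).
Notation D := (p * n%:R : R).
Notation dK := (dgK E K).
Notation dF := (dgF F K).
Notation dH := (dgH E F K).
Hypothesis p_gt0 : 0 < p.
Hypothesis eps0 : 0 < eps.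
Hypothesis eps1 : eps <= 1/4.
Hypothesis sE : E \subset pairs T.
Hypothesis sFE : F \subset E.
Hypothesis FK : forall e, e \in F -> e \subset K.
Hypothesis res : forall v, v \in K -> (dH v)%:R <= (1/2 - eps) * (dK v)%:R.

Let sF : F \subset pairs T. Proof. exact: subset_trans sFE sE. Qed.

Lemma adjF_in t x : adjE F t x -> (t \in K) && (x \in K).
Proof. by move=> /FK; rewrite subUset !sub1set. Qed.

Lemma edge_in_closed_nbh S A v e : S \subset pairs T -> v \in A -> e \in S -> v \in e ->
  e \subset closed_nbh S A.
Proof.
move=> sS vA eS ve; apply/subsetP=> u ue; rewrite !inE.
have [->|uv] := eqVneq u v; first by rewrite vA.
apply/orP; right; apply/exists_inP; exists v => //; rewrite /adjE.
suff -> : [set v; u] = e by [].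
apply/eqP; rewrite eqEcard subUset !sub1set ve ue /= cards2 eq_sym uv.
by have := subsetP sS e eS; rewrite inE => /eqP ->.
Qed.

(** [S] takes up to [l] edges of [F] at each vertex. If a set [A] expanded badly, its closed
    neighbourhood would be small and contain at least half the chosen edges at [A], against the
    density hypotheses. Vertices of degree below D / 100 guarantee only about [k] edges, but they
    are at most n / D^2 in number, so the second hypothesis needs only such tiny sets. The
    denominators are 18 = 2 * 9 and 60 = 2 * 5 * 6. *)
Lemma expand_small (k l a0 : nat) (d3 : R) :
  0 < d3 <= 1 -> d3 * D <= l%:R -> l%:R <= D / 200 -> k%:R <= 6 * D ->
  (forall v, v \in K -> (k <= dK v)%N) ->
  #|[set v in K | (dK v)%:R < D / 100]|%:R * D ^+ 2 <= n%:R ->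
  ~~ dense_subset (d3 * D / 18) (fun s => s <= 9 * a0)%N E ->
  ~~ dense_subset (d3 * k%:R / 60) (fun s => s%:R * D ^+ 2 <= 5 * n%:R) E ->
  exists2 S : {set {set T}}, S \subset F & (#|S| <= n * l)%N /\
    (forall A, A \subset K -> (0 < #|A| <= a0)%N -> (3 * #|A| < #|closed_nbh S A|)%N).
Proof.
move=> /andP[d0 d1] hl1 hl2 hkD hk hL nd1 nd2.
have incid v : v \in K -> #|[set e in F | v \in e]| = dF v.
  move=> vK; rewrite /dgF deg_in_edges //; apply: eq_card => e; rewrite !inE.
  by case: (boolP (e \in F)) => //= /FK ->; rewrite andbT.
have /choice[C hC] : forall v, exists C : {set {set T}},
    C \subset [set e in F | v \in e] /\ #|C| = minn #|[set e in F | v \in e]| l.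
  move=> v; have /set0Pn[C] : [set C : {set {set T}} | C \subset [set e in F | v \in e]
      & #|C| == minn #|[set e in F | v \in e]| l] != set0.
    by rewrite -card_gt0 cards_draws bin_gt0 geq_minl.
  by rewrite inE => /andP[h1 /eqP h2]; exists C.
pose S := \bigcup_(v in K) C v.
have CF v e : e \in C v -> (e \in F) && (v \in e).
  by case: (hC v) => /subsetP h _ /h; rewrite inE.
have SF : S \subset F by apply/bigcupsP => v _; apply/subsetP=> e /CF /andP[].
exists S => //; split.
  apply: leq_trans (_ : \sum_(v in K) #|C v| <= _)%N; last first.
    apply: leq_trans (_ : \sum_(v in K) l <= _)%N.
      by apply: leq_sum => v _; case: (hC v) => _ ->; apply: geq_minr.
    by rewrite sum_nat_const leq_mul2r max_card orbT.
  rewrite /S; elim/big_rec2: _ => [|v m X _ IH]; first by rewrite cards0.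
  by apply: leq_trans (leq_of_leqif (leq_card_setU _ _)) _; rewrite leq_add2l.
have sS : S \subset pairs T by apply: subset_trans sF.
have count A (c : R) : A \subset K -> (forall v, v \in A -> c <= #|C v|%:R) ->
    c * #|A|%:R <= 2 * #|edges_in E (closed_nbh S A)|%:R.
  move=> AK hc; rewrite mulr_natr -sumr_const; apply: le_trans (_ : \sum_(v in A) #|C v|%:R <= _).
    exact: ler_sum.
  rewrite -natr_sum -natrM ler_nat; apply: sum_incident_le.
  - by apply: subset_trans sE; apply/subsetP=> e; rewrite inE => /andP[].
  - move=> v vA; apply/subsetP=> e eC; have /andP[eF ve] := CF _ _ eC.
    rewrite inE (subsetP sFE) //=; apply: (edge_in_closed_nbh sS vA _ ve).
    by apply/bigcupP; exists v => //; apply: (subsetP AK).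
  - by move=> v e _ /CF /andP[].
have D0 : 0 <= D by rewrite mulr_ge0 // ltW.
have nbh0 A : A != set0 -> closed_nbh S A != set0.
  by apply: contraNneq => h; rewrite -subset0 -h subsetUl.
have dF2 v : v \in K -> (dK v)%:R <= 2 * (dF v)%:R :> R.
  by move=> vK; rewrite -natrM ler_nat; apply: (dgF_half eps0 eps1 sFE res).
have expB A : A \subset K -> A != set0 -> (#|A| <= a0)%N ->
    (forall v, v \in A -> D / 100 <= (dK v)%:R) -> (9 * #|A| < #|closed_nbh S A|)%N.
  move=> AK A0 Aa hA; rewrite ltnNge; apply/negP => hX.
  have := nd1; rewrite negb_exists => /forallP/(_ (closed_nbh S A)).
  rewrite nbh0 //= (leq_trans hX) ?leq_mul2l ?Aa ?orbT //= -ltNge.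
  have hc : forall v, v \in A -> d3 * D <= #|C v|%:R.
    move=> v vA; have vK := subsetP AK v vA; case: (hC v) => _ ->; rewrite incid //.
    have : (l <= dF v)%N.
      rewrite -(ler_nat R); have := dF2 v vK; have := hA v vA; move: hl2; lra.
    by move/minn_idPr => ->.
  have := count A _ AK hc.
  have : #|closed_nbh S A|%:R <= 9 * #|A|%:R :> R by rewrite -natrM ler_nat.
  move=> h1 h2 h3; have d3D : 0 <= d3 * D by rewrite mulr_ge0 // ltW.
  have := ler_wpM2l d3D h1; lra.
have expL A : A \subset K -> A != set0 ->
    (forall v, v \in A -> (dK v)%:R < D / 100) -> (5 * #|A| < #|closed_nbh S A|)%N.
  move=> AK A0 hA; rewrite ltnNge; apply/negP => hX.
  have hX' : #|closed_nbh S A|%:R <= 5 * #|A|%:R :> R by rewrite -natrM ler_nat.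
  have := nd2; rewrite negb_exists => /forallP/(_ (closed_nbh S A)).
  rewrite nbh0 //=.
  have -> /= : #|closed_nbh S A|%:R * D ^+ 2 <= 5 * n%:R.
    have hAL : #|A|%:R <= #|[set v in K | (dK v)%:R < D / 100]|%:R :> R.
      by rewrite ler_nat; apply/subset_leq_card/subsetP=> v vA; rewrite inE (subsetP AK) ?hA.
    have D2 : 0 <= D ^+ 2 by rewrite exprn_ge0.
    have := ler_wpM2r D2 hX'; have := ler_wpM2r D2 hAL; move: hL; lra.
  rewrite -ltNge.
  (* Either all edges of [F] at [v] are chosen, at least k / 2, or [l >= d3 * D] of them, and k <= 6
     D. *)
  have hc : forall v, v \in A -> d3 * k%:R / 6 <= #|C v|%:R.
    move=> v vA; have vK := subsetP AK v vA; case: (hC v) => _ ->; rewrite incid //.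
    have k0 : 0 <= k%:R :> R by [].
    have dk : d3 * k%:R <= k%:R by rewrite ler_piMl.
    have hkv : k%:R <= (dK v)%:R :> R by rewrite ler_nat hk.
    rewrite /minn; case: ifP => _; first by have := dF2 v vK; lra.
    apply: le_trans hl1; rewrite -mulrA ler_wpM2l ?(ltW d0) //; lra.
  have := count A _ AK hc; move=> h2 h3.
  have dk0 : 0 <= d3 * k%:R by rewrite mulr_ge0 // ltW.
  have := ler_wpM2l dk0 hX'; lra.
move=> A AK /andP[A0 Aa].
pose L := [set v | (dK v)%:R < D / 100].
have cA : #|A| = (#|A :&: L| + #|A :\: L|)%N by rewrite cardsID.
(* Either a third of [A] has high degree and expands by 9, or more than two thirds have low degree
   and expand by 5; both give more than 3 |A|. *)
have [h|h] := leqP #|A| (3 * #|A :\: L|).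
  have B0 : A :\: L != set0 by rewrite -card_gt0; move: h A0; clear; lia.
  apply: leq_trans (subset_leq_card (closed_nbh_sub S (subsetDl A L))).
  apply: leq_trans (expB _ _ B0 _ _).
  - by move: h; clear; lia.
  - by apply: subset_trans AK; apply: subsetDl.
  - by apply: leq_trans Aa; apply/subset_leq_card/subsetDl.
  - by move=> v; rewrite !inE -leNgt => /andP[].
have L0 : A :&: L != set0 by rewrite -card_gt0; move: h A0 cA; clear; lia.
apply: leq_trans (subset_leq_card (closed_nbh_sub S (subsetIl A L))).
apply: leq_trans (expL _ _ L0 _).
- by move: h cA; clear; lia.
- by apply: subset_trans AK; apply: subsetIl.
- by move=> v; rewrite !inE => /andP[].
Qed.

Hypothesis Eup : ~~ family_high p (@fam_up T) eta0 E.
Hypothesis Elow : ~~ sparse_guess_low p (@fam_stars T) 0 eta0 E.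

(** For |X| <= 3 |A| and |A| <= |K| / 16, the edges of [E] from [A] to [K :\: X] exceed what [H] can
    delete by a constant share of [p n^2]. A sparse subset of [F] that meets all these edge sets
    expands, since a badly expanding [A] fails with [X] its closed neighbourhood. *)
Lemma expand_large (q sg0 gm : R) (a : nat) :
  0 < q <= 1 -> 0 < sg0 -> 0 < eta0 -> eta0 <= 1/2 -> eta0 <= sg0 * gm / 24 -> (0 < n)%N ->
  0 < gm -> gm * n%:R <= #|K|%:R :> R -> 16 * a%:R <= #|K|%:R :> R -> 24 <= q * sg0 * gm * D ->
  exists2 S : {set {set T}}, S \subset F & #|S|%:R <= 3 * q * B /\
    (forall A, A \subset K -> sg0 * n%:R <= #|A|%:R -> (#|A| <= a)%N ->
       (3 * #|A| < #|closed_nbh S A|)%N).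
Proof.
move=> q01 s0 e00 e02 e0s n0 gm0 nK aK hq.
have p0 := ltW p_gt0.
pose P (j : {set T} * {set T}) := [&& j.1 \subset K, sg0 * n%:R <= #|j.1|%:R, (#|j.1| <= a)%N,
   j.1 \subset j.2 & (#|j.2| <= 3 * #|j.1|)%N].
pose W (j : {set T} * {set T}) := F :&: stars j.1 (fun=> K :\: j.2).
have nr0 : 0 < n%:R :> R by rewrite ltr0n.
have WB j : P j -> sg0 * gm / 8 * B <= #|W j|%:R.
  case: j => A X /and5P[/= AK sA Aa AX X3].
  have := low_stars Elow A (K :\: X); have := sum_dgH p_gt0 eps1 sE res Eup AK.
  have KXA : K :\: X :\: A = K :\: X.
    by apply/setDidPl; rewrite -setI_eq0 -subset0; apply/subsetP=> u; rewrite !inE => /andP[/andP[/negP uX _] /(subsetP AX)].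
  rewrite KXA /W /= card_setI_stars KXA.
  have : (\sum_(t in A) deg_in (adjE E) (K :\: X) t <=
     \sum_(t in A) deg_in (adjE F) (K :\: X) t + \sum_(t in A) dH t)%N.
    rewrite -big_split /=; apply: leq_sum => t tA.
    rewrite /deg_in /dgH.
    apply: leq_trans (leq_of_leqif (leq_card_setU _ _)); apply/subset_leq_card/subsetP=> x.
    by rewrite !inE => /andP[/andP[-> ->] ->] /=; case: (adjE F t x).
  rewrite -(ler_nat R) natrD.
  have cX : #|K|%:R - 3 * #|A|%:R <= #|K :\: X|%:R :> R.
    have : (#|K| <= #|K :\: X| + 3 * #|A|)%N.
      rewrite -(cardsID X K) addnC leq_add2l; apply: leq_trans X3.
      exact/subset_leq_card/subsetIr.
    by rewrite -(ler_nat R) natrD natrM; lra.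
  have a16 : 16 * #|A|%:R <= #|K|%:R :> R by apply: le_trans aK; rewrite ler_wpM2l // ler_nat.
  have k4 : #|K|%:R / 4 <= #|K :\: X|%:R - #|K|%:R / 2 :> R.
    by have := ler0n R #|K|; lra.
  set x1 := (\sum_(t in A) deg_in (adjE E) _ _)%:R; set x2 := (\sum_(t in A) dH t)%:R.
  set x3 := (\sum_(t in A) deg_in (adjE F) _ _)%:R.
  move: k4 sA nK; set kx := #|K :\: X|%:R; set ka := #|K|%:R; set aa := #|A|%:R; set nn := n%:R.
  move=> k4 sA nK h1 h2 h3.
  have aa0 : 0 <= aa by rewrite /aa.
  have ka0 : 0 <= ka by rewrite /ka.
  have nn0 : 0 <= nn by rewrite /nn.
  have pa0 : 0 <= p * aa by rewrite mulr_ge0.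
  have g1 := ler_wpM2l pa0 k4.
  have g2 : sg0 * nn * (gm * nn) <= aa * ka by rewrite ler_pM // mulr_ge0 // ltW.
  have g3 := ler_wpM2l p0 g2.
  have g4 : 0 <= eps * (p * (aa * ka)) by rewrite !mulr_ge0 // ltW.
  have g5 : 0 <= eta0 * (p * nn ^+ 2) by rewrite !mulr_ge0 ?exprn_ge0 // ltW.
  have g6 : 0 <= eps * (eta0 * (p * nn ^+ 2)) by rewrite mulr_ge0 // ltW.
  have g7 : eta0 * (p * nn ^+ 2) <= sg0 * gm / 24 * (p * nn ^+ 2) by rewrite ler_wpM2r // mulr_ge0 ?exprn_ge0.
  move: h1 h2 h3 g1 g3 g4 g5 g6 g7; rewrite !expr2; lra.
have B0 : 0 < B by rewrite mulr_gt0 // exprn_gt0.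
have FB : #|F|%:R <= B.
  apply: le_trans (_ : #|E|%:R <= _); first by rewrite ler_nat subset_leq_card.
  exact: (card_E_le p_gt0 sE Eup).
have /andP[q0 q1] := q01.
have e2 : 2 <= expR 1 :> R by have := @expR_ge1Dx R 1; lra.
(* With [mu = 1/2] fewer than one pair is missed, that is none: at most 4^n pairs, each missed with
   probability at most exp(-3 n). *)
have := @sparse_hitting R _ _ F W P q B (1/2) q01 B0 FB.
case=> //.
- by move=> j _; apply: subsetIl.
- apply: le_trans (_ : \sum_(j : {set T} * {set T} | P j) expR (- (3 * n%:R)) <= _).
    apply: ler_sum => j Pj; have h := WB j Pj.
    apply: le_trans (_ : expR (- q) ^+ #|W j| <= _).
      by rewrite lerXn2r ?nnegrE ?expR_ge0 ?subr_ge0 // expR_ge1Dx.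
    rewrite -expRM_natl ler_expR mulrN lerN2.
    have h2 := ler_wpM2r (ltW q0) h; apply: le_trans h2.
    have := ler_wpM2r (ltW nr0) hq; rewrite expr2; lra.
  rewrite sumr_const.
  apply: le_trans (_ : expR (- (3 * n%:R)) *+ (2 ^ n * 2 ^ n) <= _).
    apply: ler_wpMn2l; first exact: expR_ge0.
    apply: leq_trans (max_card _) _; rewrite card_prod -!cardsT -powersetT card_powerset cardsT //.
  rewrite -[leLHS]mulr_natr natrM natrX.
  have h2n : (2 : R) ^+ n <= expR n%:R.
    by rewrite -[n%:R]mulr1 expRM_natl lerXn2r ?nnegrE ?expR_ge0.
  apply: le_trans (_ : expR (- (3 * n%:R)) * (expR n%:R * expR n%:R) <= _).
    by rewrite ler_wpM2l ?expR_ge0 // ler_pM ?exprn_ge0.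
  rewrite -!expRD; apply: le_trans (_ : expR (-1) <= _).
    have : 1 <= n%:R :> R by rewrite ler1n.
    by rewrite ler_expR; lra.
  by rewrite expRN div1r lef_pV2 ?posrE ?expR_gt0.
move=> S [SF SB miss]; exists S => //; split=> // A AK sA Aa.
rewrite ltnNge; apply/negP => hX.
have : [set j | P j & S :&: W j == set0] = set0.
  apply/eqP; rewrite -cards_eq0 -leqn0 -ltnS -(ltr_nat R).
  by apply: lt_le_trans miss _; lra.
move/setP/(_ (A, closed_nbh S A)); rewrite !inE /P /= AK sA Aa hX subsetUl /=.
move/negP; apply; apply/eqP/setP=> e; rewrite !inE; apply/negbTE/negP => /and3P[eS _].
case/imsetP=> -[t x]; rewrite !inE /= => /and3P[tA _ /andP[]]; rewrite negb_or => /andP[_ /negP h _] eE.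
by apply: h; apply/exists_inP; exists t => //; rewrite /adjE -eE.
Qed.

End Expansion.

(** * Longest paths *)

Section LongestPath.
Variables (T : finType) (F : {set {set T}}) (K V : {set T}).
Hypothesis FK : forall e, e \in F -> e \subset K.
Hypothesis VK : V \subset K.
Hypothesis Vmax : forall c : seq T, sorted (adjE F) c -> uniq c -> {subset c <= K} -> size c <= #|V|.

Lemma size_of_mem_eq (c : seq T) : uniq c -> c =i V -> size c = #|V|.
Proof. by move=> /card_uniqP <- h; apply: eq_card. Qed.

Lemma longest_end_nbr s t x : ham_path (adjE F) V s t -> adjE F t x -> x \in V.
Proof.
move=> [p [pp up lp pV]] tx; apply: contraT => xV.
have := Vmax (c := rcons (s :: p) x); rewrite size_rcons (size_of_mem_eq up pV) ltnn => ->//.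
- by rewrite rcons_cons /= rcons_path pp lp.
- by rewrite rcons_uniq pV xV.
- move=> y; rewrite mem_rcons inE => /orP[/eqP ->|]; last by rewrite pV => /(subsetP VK).
  by have /andP[] := adjF_in FK tx.
Qed.

(* A cycle on [V] with an edge leaving [V] contains a longer path. *)
Lemma longest_cycle_closed s t v x : ham_path (adjE F) V s t -> adjE F t s ->
  v \in V -> adjE F v x -> x \in V.
Proof.
move=> [p [pp up lp pV]] ts vV vx; apply: contraT => xV.
have cy : cycle (adjE F) (s :: p) by rewrite /= rcons_path pp lp.
have [|i q rE] := @rot_to _ (s :: p) v; first by rewrite pV.
have cq : cycle (adjE F) (v :: q) by rewrite -rE rot_cycle.
have uq : uniq (v :: q) by rewrite -rE rot_uniq.
have qV : v :: q =i V by move=> y; rewrite -rE mem_rot pV.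
have := Vmax (c := x :: v :: q); rewrite -[size _]/((size (v :: q)).+1) (size_of_mem_eq uq qV) ltnn => ->//.
- move: cq; rewrite /= rcons_path => /andP[-> _]; by rewrite andbT adjE_sym.
- by rewrite cons_uniq qV xV.
- move=> y; rewrite inE => /orP[/eqP ->|]; last by rewrite qV => /(subsetP VK).
  by have /andP[] := adjF_in FK vx.
Qed.

End LongestPath.

Lemma exists_longest_path (T : finType) (F : {set {set T}}) (K : {set T}) : K != set0 ->
  exists s p, [/\ path (adjE F) s p, uniq (s :: p), {subset s :: p <= K} &
    forall c : seq T, sorted (adjE F) c -> uniq c -> {subset c <= K} -> size c <= size (s :: p)].
Proof.
move=> /set0Pn[v vK].
pose P m := `[< exists c : seq T, [/\ sorted (adjE F) c, uniq c, {subset c <= K} & size c = m] >].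
have exP : exists m, P m.
  exists 1; apply/asboolP; exists [:: v]; split=> // x.
  by rewrite inE => /eqP ->.
have bP m : P m -> m <= #|T|.
  by move=> /asboolP[c [_ /card_uniqP <- _ <-]]; apply: max_card.
have [m /asboolP[c [cs cu cK cm]] mmax] := ex_maxnP exP bP.
have m1 : 0 < m.
  by apply: mmax; apply/asboolP; exists [:: v]; split=> // x; rewrite inE => /eqP ->.
case: c cs cu cK cm => [|s p] cs cu cK cm; first by rewrite -cm in m1.
exists s, p; split=> // c c1 c2 c3; rewrite cm; apply: mmax; apply/asboolP.
by exists c.
Qed.

Lemma path_edges_sparse (T : finType) (F : {set {set T}}) s p :
  path (adjE F) s p -> uniq (s :: p) ->
  exists2 S : {set {set T}}, S \subset F & #|S| <= #|T| /\ path (adjE S) s p.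
Proof.
move=> pp up; pose nx x := nth s (s :: p) (index x (s :: p)).+1.
exists (F :&: [set [set x; nx x] | x in T]); first exact: subsetIl.
split.
  apply: leq_trans (subset_leq_card (subsetIr _ _)) _.
  by apply: leq_trans (leq_imset_card _ _) _; rewrite max_card.
apply/(pathP s) => i ip; rewrite /adjE inE.
have := pathP s pp i ip; rewrite {1}/adjE => ->/=.
apply/imsetP; exists (nth s (s :: p) i) => //.
by rewrite /nx index_uniq //= ltnS ltnW.
Qed.

(** * Rotating and closing a longest path *)

Section Rotate.
Local Open Scope ring_scope.
Variables (R : realType) (T : finType) (p eps eta eta0 sg gm delta q : R) (a : nat).
Variables (E F S0 : {set {set T}}) (K : {set T}).
Implicit Types (A Y S : {set T}) (G : {set {set T}}).
Notation n := #|T|.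
Notation b := a.+1.
Notation B := (p * n%:R ^+ 2 : R).
Notation D := (p * n%:R : R).
Notation dK := (dgK E K).
Notation dH := (dgH E F K).
Hypothesis p_gt0 : 0 < p.
Hypothesis eps0 : 0 < eps.
Hypothesis eps1 : eps <= 1/4.
Hypothesis sE : E \subset pairs T.
Hypothesis sFE : F \subset E.
Hypothesis FK : forall e, e \in F -> e \subset K.
Hypothesis res : forall v, v \in K -> (dH v)%:R <= (1/2 - eps) * (dK v)%:R.
Hypothesis Eup : ~~ family_high p (@fam_up T) eta0 E.
Hypothesis Elow : ~~ sparse_guess_low p (@fam_stars T) 0 eta0 E.
Hypothesis Erot : ~~ sparse_guess_low p (@fam_rotations T) (delta * B) eta E.
Hypothesis Eclo : ~~ sparse_guess_low p (@fam_closing T) (delta * B) eta E.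
Hypothesis n0 : (0 < n)%N.
Hypothesis gm0 : 0 < gm.
Hypothesis nK : gm * n%:R <= #|K|%:R.
Hypothesis sg0 : 0 < sg.
Hypothesis sg1 : 80 * sg <= eps * gm.
Hypothesis bl : sg * n%:R <= b%:R.
Hypothesis bu : b%:R <= 2 * (sg * n%:R).
Hypothesis etaE : 100 * eta = eps * gm * sg.
Hypothesis eta00 : 0 < eta0.
Hypothesis eta01 : eta0 <= eta.
Hypothesis eta02 : eta0 <= 1/2.
Hypothesis K10 : 10 <= eps * #|K|%:R.
Hypothesis b3 : (2 < b)%N.
Hypothesis S0F : S0 \subset F.
Hypothesis S0exp : forall A, A \subset K -> (0 < #|A| <= a)%N -> (3 * #|A| < #|closed_nbh S0 A|)%N.
Hypothesis q01 : 0 < q <= 1.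
Hypothesis Dsize : #|S0|%:R + n%:R + 3 * q * B <= delta * B.
Hypothesis hmiss : expR (- (q * (eta * D / 2))) <= gm * eps / 20.

Let p0 : 0 <= p. Proof. exact: ltW. Qed.
Let nr0 : 0 < n%:R :> R. Proof. by rewrite ltr0n. Qed.
Let eta_gt0 : 0 < eta. Proof. exact: lt_le_trans eta01. Qed.
Let B0 : 0 < B. Proof. by rewrite mulr_gt0 // exprn_gt0. Qed.
Let K0 : 0 < #|K|%:R :> R.
Proof. by apply: lt_le_trans nK; rewrite mulr_gt0. Qed.
Let br0 : 0 < b%:R :> R. Proof. by rewrite ltr0n. Qed.

Let eta_small : eta * n%:R ^+ 2 <= eps / 100 * (b%:R * #|K|%:R).
Proof.
have h : sg * n%:R * (gm * n%:R) <= b%:R * #|K|%:R by rewrite ler_pM // mulr_ge0 // ltW.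
have := ler_wpM2l (ltW eps0) h; have := etaE.
move=> h1 h2.
have -> : eta * n%:R ^+ 2 = (100 * eta) * n%:R ^+ 2 / 100 by field.
by rewrite h1 expr2; lra.
Qed.

Let b_small : b%:R <= eps / 40 * #|K|%:R.
Proof.
have h := ler_wpM2r (ltW nr0) sg1; have := ler_wpM2l (ltW eps0) nK; have := bu; lra.
Qed.

(** Connectivity of [F]: sets of at most [a] vertices expand already in [S0], larger ones are
    covered by [large_cut]. *)
Lemma leaving_edge A : A \subset K -> A != set0 -> (2 * #|A| <= #|K|)%N ->
  exists t x, [/\ t \in A, x \in K :\: A & adjE F t x].
Proof.
move=> AK A0 A2; have [Aa|Aa] := leqP #|A| a.
  have A1 : (0 < #|A|)%N by rewrite card_gt0.
  have /subsetPn[x] : ~~ (closed_nbh S0 A \subset A).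
    apply/negP => /subset_leq_card; have := S0exp AK (introT andP (conj A1 Aa)).
    by move: A1; clear; lia.
  rewrite inE => /orP[->//|]; rewrite inE => /exists_inP[t tA h] xA.
  have h' := adjE_mono S0F h; exists t, x; split=> //.
  by rewrite inE xA; have /andP[] := adjF_in FK h'.
apply: (large_cut p_gt0 eps0 eps1 sE res Eup Elow) => //; last exact: ltW.
have bA : b%:R <= #|A|%:R :> R by rewrite ler_nat.
have h1 : b%:R * #|K|%:R <= #|A|%:R * #|K|%:R :> R by rewrite ler_wpM2r // ltW.
have h2 := ler_wpM2l (ltW eps0) h1.
have h3 : eta0 * n%:R ^+ 2 <= eta * n%:R ^+ 2 by rewrite ler_wpM2r // exprn_ge0.
have h4 : 0 <= eps * (b%:R * #|K|%:R) by rewrite !mulr_ge0 // ltW.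
by have := eta_small; lra.
Qed.

Section FixedVertexSet.
Variable V : {set T}.
Hypothesis VK : V \subset K.
Hypothesis Vmax : forall c : seq T, sorted (adjE F) c -> uniq c -> {subset c <= K} -> (size c <= #|V|)%N.

Definition witnesses G S s y : {set T} :=
  [set t in S | adjE F t (prv s (ham_tail G V s t) y)].

(** Many witnesses are demanded, not just one, so that a random sparse part of [F] is likely to
    contain an edge making [y] an end. *)
Definition good_ends G S s : {set T} :=
  [set y in V :\ s | eta * D <= #|witnesses G S s y|%:R].

(** Let [Y] be the vertices of [V :\ s] that are not good. [E] has about p b (|Y| + |K \ V|) edges
    in the rotation family. Those in [F] cannot leave [V], a longest path, and witness vertices of
    [Y], hence are few; the others lie in [H]. So |Y| + |K \ V| is below about (1/2 - eps) |K|. *)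
Lemma many_good_ends G S s : G \subset F -> #|G|%:R <= delta * B -> #|S| = b ->
  (forall t, t \in S -> ham_path (adjE G) V s t) ->
  (1/2 + 4/5 * eps) * #|K|%:R <= #|good_ends G S s|%:R.
Proof.
move=> GF Gd Sb hS.
have GE := subset_trans GF sFE.
pose Y := (V :\ s) :\: good_ends G S s.
pose X t := [set prv s (ham_tail G V s t) y | y in Y] :|: (K :\: V).
have low := guess_low_gt (s, S, Y, V, K) Erot GE Gd.
rewrite /fam_rotations -/X in low.
have SK : S \subset K.
  by apply/subsetP=> t /hS /ham_path_last_in /(subsetP VK).
have imV t y : t \in S -> prv s (ham_tail G V s t) y \in V.
  by move=> /hS /ham_tailP[_ _ _ <-]; apply: prv_in.
have cX t : t \in S -> #|X t| = (#|Y| + #|K :\: V|)%N.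
  move=> tS; have [_ up _ pV] := ham_tailP (hS t tS).
  rewrite /X cardsU (_ : _ :&: _ = set0) ?cards0 ?subn0; last first.
    apply/setP=> u; rewrite !inE; apply/negbTE/negP => /andP[/imsetP[y _ ->]].
    by rewrite imV.
  rewrite card_in_imset // => y z yY zY; apply: (prv_inj up).
    by rewrite in_setD1 in_set pV; move: yY; rewrite in_setD in_setD1 => /andP[_].
  by rewrite in_setD1 in_set pV; move: zY; rewrite in_setD in_setD1 => /andP[_].
(* The term [b * b] pays for the leaves inside [S], which [stars] drops. *)
have c1 : (b * (#|Y| + #|K :\: V|) <= #|stars S X| + b * b)%N.
  rewrite card_stars -{1 2}Sb -!sum_nat_const -big_split /=; apply: leq_sum => t tS.
  rewrite -(cX t tS) -(cardsID S (X t)) addnC leq_add2l -Sb.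
  exact/subset_leq_card/subsetIr.
have c2 : (#|E :&: stars S X| <= \sum_(y in Y) #|witnesses G S s y| + \sum_(t in S) dH t)%N.
  rewrite card_setI_stars.
  rewrite -(sum_card_exchange S Y (fun t y => adjE F t (prv s (ham_tail G V s t) y))).
  rewrite -big_split /=; apply: leq_sum => t tS.
  apply: leq_trans (_ : #|[set prv s (ham_tail G V s t) y | y in
      [set y in Y | adjE F t (prv s (ham_tail G V s t) y)]] :|:
      [set u in K | adjE E t u && ~~ adjE F t u]| <= _)%N.
    apply/subset_leq_card/subsetP=> x; rewrite inE => /andP[]; rewrite inE => /andP[_ xX] Etx.
    have xK : x \in K.
      move: xX; rewrite inE => /orP[/imsetP[y _ ->]|]; last by rewrite inE => /andP[].
      exact: (subsetP VK) (imV _ _ tS).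
    rewrite inE; have [Ftx|nF] := boolP (adjE F t x); last first.
      by apply/orP; right; rewrite inE xK Etx nF.
    apply/orP; left; move: xX; rewrite inE => /orP[/imsetP[y yY xE]|].
      by apply/imsetP; exists y => //; rewrite inE yY -xE.
    rewrite inE => /andP[/negP[]].
    apply: (longest_end_nbr FK VK Vmax (s := s)) Ftx.
    by apply: ham_path_mono (hS t tS); apply: adjE_mono.
  apply: leq_trans (leq_of_leqif (leq_card_setU _ _)) _.
  by rewrite leq_add2r leq_imset_card.
have c3 : (\sum_(y in Y) #|witnesses G S s y|)%:R <= eta * B.
  rewrite natr_sum; apply: le_trans (_ : \sum_(y in Y) eta * D <= _).
    apply: ler_sum => y; rewrite !inE => /andP[]; rewrite negb_and => /orP[nV /andP[ys yV]|].
      by rewrite ys yV in nV.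
    by rewrite -ltNge => /ltW.
  rewrite sumr_const -[leLHS]mulr_natr -mulrA ler_wpM2l ?(ltW eta_gt0) //.
  by rewrite expr2 mulrA ler_wpM2l ?mulr_ge0 // ler_nat max_card.
have c4 := sum_dgH p_gt0 eps1 sE res Eup SK; rewrite Sb in c4.
have c5 : (#|K| <= #|good_ends G S s| + #|Y| + 1 + #|K :\: V|)%N.
  have : (#|V| <= #|V :\ s| + 1)%N.
    by rewrite (cardsD1 s V) addnC leq_add2l; case: (_ \in _).
  have : (#|V :\ s| <= #|good_ends G S s| + #|Y|)%N.
    rewrite -(cardsID (good_ends G S s) (V :\ s)) leq_add2r.
    exact/subset_leq_card/subsetIr.
  rewrite -(cardsID V K) (setIidPr VK); clear; lia.
have c5r : #|K|%:R <= #|good_ends G S s|%:R + #|Y|%:R + 1 + #|K :\: V|%:R :> R.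
  by move: c5; rewrite -(ler_nat R) !natrD.
have c1r : b%:R * (#|Y|%:R + #|K :\: V|%:R) <= #|stars S X|%:R + b%:R * b%:R :> R.
  by rewrite -!natrD -!natrM -natrD ler_nat.
have c2r : #|E :&: stars S X|%:R <= (\sum_(y in Y) #|witnesses G S s y|)%:R + (\sum_(t in S) dH t)%:R :> R.
  by rewrite -natrD ler_nat.
move: low c1r c2r c3 c4 c5r eta_small b_small K10.
set x1 := #|stars S X|%:R; set x2 := #|E :&: stars S X|%:R.
set x3 := (\sum_(y in Y) _)%:R; set x4 := (\sum_(t in S) dH t)%:R.
set gg := #|good_ends G S s|%:R; set yk := #|Y|%:R; set kv := #|K :\: V|%:R.
move: K0 br0; set ka := #|K|%:R; set bb := b%:R; set nn := n%:R ^+ 2 => ka0 bb0.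
move=> low c1r c2r c3 c4' c5r es bs k10.
have nn0 : 0 <= nn by rewrite /nn exprn_ge0.
have e0n : eta0 * nn <= eta * nn by rewrite ler_wpM2r.
have h1 : p * (bb * (yk + kv)) <= p * (x1 + bb * bb) by rewrite ler_wpM2l.
have h2 : p * (bb * (yk + kv)) < p * (bb * bb + 2 * (eta * nn) + (1/2 - eps) * (bb * ka + 3 * (eta0 * nn))).
  by move: low c2r c3 c4' h1; lra.
rewrite ltr_pM2l // in h2.
have h3 : (1/2 - eps) * (3 * (eta0 * nn)) <= 3/2 * (eta * nn).
  have : 0 <= eta0 * nn by rewrite mulr_ge0 // ltW.
  by move=> h; have := mulr_ge0 (ltW eps0) h; lra.
have h4 : bb * bb <= bb * (eps / 40 * ka) by rewrite ler_wpM2l // ltW.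
have h5 : bb * (yk + kv) < bb * ((1/2 - eps + eps / 40 + 7/200 * eps) * ka).
  by apply: lt_le_trans h2 _; move: h3 h4 es; lra.
rewrite ltr_pM2l // in h5.
by move: h5 c5r k10; lra.
Qed.

(** Posa is applied in the sparse graph [G1], first from [s0] and then, after reversal, from each
    end found. A random sparse [F'] supplies the final rotation for almost all good pairs, so [G2]
    is still sparse enough to be guessed and the closing family can be evaluated at it. *)
Lemma closing_edge s0 c0 : path (adjE F) s0 c0 -> uniq (s0 :: c0) -> s0 :: c0 =i V ->
  exists s t, ham_path (adjE F) V s t /\ adjE F t s.
Proof.
move=> pc uc cV.
have [Pe PeF [Pn pP]] := path_edges_sparse pc uc.
pose G1 := S0 :|: Pe.
have G1F : G1 \subset F by rewrite subUset S0F.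
have sF : F \subset pairs T by apply: subset_trans sFE sE.
have posa s t : ham_path (adjE G1) V s t ->
    exists2 S : {set T}, #|S| = b & forall t', t' \in S -> ham_path (adjE G1) V s t'.
  move=> hst; apply: (Posa_endpoints (adjE_sym G1) hst).
    move=> t' x h /(adjE_mono G1F); apply: (longest_end_nbr FK VK Vmax (s := s)).
    by apply: ham_path_mono h; apply: adjE_mono.
  move=> A AV Aa; apply: leq_trans (S0exp (subset_trans AV VK) Aa) _.
  exact/subset_leq_card/closed_nbhS/subsetUl.
have h0 : ham_path (adjE G1) V s0 (last s0 c0).
  by exists c0; split=> //; apply: sub_path pP; apply: adjE_mono; apply: subsetUr.
have [A0 A0b hA0] := posa _ _ h0.
have /choice[Sf hSf] : forall s, exists S : {set T},
    s \in A0 -> #|S| = b /\ forall t, t \in S -> ham_path (adjE G1) V s t.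
  move=> s; have [sA|sA] := boolP (s \in A0); last by exists set0.
  have [S Sb hS] := posa _ _ (ham_path_sym (adjE_sym G1) (hA0 s sA)).
  by exists S.
have A0K : A0 \subset K by apply/subsetP=> t /hA0 /ham_path_last_in /(subsetP VK).
have G1B : #|G1|%:R + 3 * q * B <= delta * B.
  apply: le_trans Dsize; rewrite lerD2r -natrD ler_nat.
  by apply: leq_trans (leq_of_leqif (leq_card_setU _ _)) _; rewrite leq_add2l.
have /andP[q0 q1] := q01.
have qB0 : 0 <= 3 * q * B by rewrite mulr_ge0 ?(ltW B0) // mulr_ge0 // ltW.
have gdP s : s \in A0 -> (1/2 + 4/5 * eps) * #|K|%:R <= #|good_ends G1 (Sf s) s|%:R.
  move=> sA; have [Sb hS] := hSf s sA; apply: many_good_ends => //.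
  by apply: le_trans G1B; rewrite lerDl.
pose W (j : T * T) := [set [set t; prv j.1 (ham_tail G1 V j.1 t) j.2] | t in witnesses G1 (Sf j.1) j.1 j.2].
pose P (j : T * T) := (j.1 \in A0) && (j.2 \in good_ends G1 (Sf j.1) j.1).
have WF j : W j \subset F by apply/subsetP=> e /imsetP[t]; rewrite inE => /andP[_ h] ->.
(* An edge of [W j] arises from at most two witnesses, namely its ends. *)
have WB j : P j -> eta * D / 2 <= #|W j|%:R.
  case: j => s y /andP[/= sA]; rewrite inE => /andP[_ hy].
  have : (#|witnesses G1 (Sf s) s y| <= 2 * #|W (s, y)|)%N.
    rewrite -[leqLHS]muln1 -sum_nat_const.
    pose C t : {set {set T}} := [set [set t; prv s (ham_tail G1 V s t) y]].
    rewrite (eq_bigr (fun t => #|C t|)) => [|t _]; last by rewrite cards1.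
    apply: sum_incident_le.
    - exact: subset_trans (WF _) sF.
    - by move=> t tW; rewrite sub1set; apply/imsetP; exists t.
    - by move=> t e _; rewrite inE => /eqP ->; rewrite !inE eqxx.
  rewrite -(ler_nat R) natrM => h; move: hy; lra.
have FB : #|F|%:R <= B.
  apply: le_trans (_ : #|E|%:R <= _); first by rewrite ler_nat subset_leq_card.
  exact: (card_E_le p_gt0 sE Eup).
(* The missed pairs, fewer than [2 * mu], are then at most an eps / 10 share of b |K|, below the
   surplus left by [many_good_ends]. *)
have mu0 : 0 < b%:R * #|K|%:R * eps / 20 by rewrite divr_gt0 // !mulr_gt0.
have := @sparse_hitting R _ _ F W P q B (b%:R * #|K|%:R * eps / 20) q01 B0 FB mu0 (fun j _ => WF j).
case.
  apply: le_trans (_ : \sum_(j : T * T | P j) (gm * eps / 20) <= _).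
    apply: ler_sum => j Pj; have h := WB j Pj; apply: le_trans hmiss.
    apply: le_trans (_ : expR (- q) ^+ #|W j| <= _).
      by rewrite lerXn2r ?nnegrE ?expR_ge0 ?subr_ge0 // expR_ge1Dx.
    by rewrite -expRM_natl ler_expR mulrN lerN2 mulrC ler_wpM2r // ltW.
  rewrite sumr_const -[leLHS]mulr_natr.
  have cP : (#|P| <= b * n)%N.
    rewrite -A0b -cardsT -cardsX; apply/subset_leq_card/subsetP=> j; rewrite unfold_in.
    by move=> /andP[h _]; rewrite inE h inE.
  have h1 : #|P|%:R <= b%:R * n%:R :> R by rewrite -natrM ler_nat.
  have ge : 0 <= gm * eps / 20 by rewrite divr_ge0 // mulr_ge0 // ltW.
  have h2 := ler_wpM2l ge h1; apply: (le_trans h2).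
  have h3 : b%:R * eps * (gm * n%:R) <= b%:R * eps * #|K|%:R.
    by rewrite ler_wpM2l // mulr_ge0 // ltW.
  by move: h3; lra.
move=> F' [F'F F'B miss].
pose G2 := G1 :|: F'.
have G2F : G2 \subset F by rewrite subUset G1F.
have G2B : #|G2|%:R <= delta * B.
  apply: le_trans G1B; apply: le_trans (_ : #|G1|%:R + #|F'|%:R <= _); last by rewrite lerD2l.
  by rewrite -natrD ler_nat leq_card_setU.
pose H s := [set y | `[< ham_path (adjE G2) V s y >]].
pose ms := [set j | P j & F' :&: W j == set0].
have hitH s y : s \in A0 -> y \in good_ends G1 (Sf s) s -> (s, y) \notin ms -> y \in H s.
  move=> sA yg; rewrite inE /P /= sA yg /= => /set0Pn[e]; rewrite inE => /andP[eF'].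
  case/imsetP => t; rewrite inE => /andP[/= tS _] eE.
  have [_ hS] := hSf s sA; have [tp tu tl tV] := ham_tailP (hS t tS).
  rewrite inE; apply/asboolP; move: yg; rewrite !inE => /andP[/andP[ys yV] _].
  apply: (ham_path_rotate (S := G1) tp tu tl tV yV ys); first exact: subsetUl.
  by rewrite /adjE -eE inE eF' orbT.
have [/existsP[s /existsP[y /andP[/asboolP h1 h2]]]|nex] :=
    boolP [exists s, exists y, `[< ham_path (adjE F) V s y >] && adjE F y s].
  by exists s, y.
exfalso; have ncl s y : ham_path (adjE F) V s y -> ~~ adjE F s y.
  move=> h; apply: contraNN nex => h'; apply/existsP; exists s; apply/existsP; exists y.
  by rewrite adjE_sym h' andbT; apply/asboolP.
have low := guess_low_gt (A0, V) Eclo (subset_trans G2F sFE) G2B.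
rewrite /fam_closing /= -/H in low.
have c1 : (\sum_(s in A0) #|good_ends G1 (Sf s) s| <= #|stars A0 H| + b * b + #|ms|)%N.
  have m1 : (\sum_(s in A0) #|[set y | (s, y) \in ms]| <= #|ms|)%N.
    rewrite -card_star_pairs; apply/subset_leq_card/subsetP=> -[s y].
    by rewrite inE /= inE => /andP[].
  apply: leq_trans (leq_add (leqnn _) m1).
  rewrite card_stars -{1 2}A0b -sum_nat_const -!big_split /=; apply: leq_sum => s sA.
  apply: leq_trans (_ : #|(H s :\: A0) :|: A0 :|: [set y | (s, y) \in ms]| <= _)%N.
    apply/subset_leq_card/subsetP=> y yg; rewrite 2!in_setU in_setD [y \in [set _ | _]]in_set.
    have [//|m'] := boolP ((s, y) \in ms); first by rewrite orbT.
    by rewrite hitH //; case: (y \in A0).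
  apply: leq_trans (leq_of_leqif (leq_card_setU _ _)) _; rewrite leq_add2r.
  exact: leq_of_leqif (leq_card_setU _ _).
have c2 : (#|E :&: stars A0 H| <= \sum_(s in A0) dH s)%N.
  rewrite card_setI_stars; apply: leq_sum => s sA.
  apply/subset_leq_card/subsetP=> y; rewrite !inE => /andP[/andP[_ /asboolP hy] ->] /=.
  rewrite (subsetP VK) ?(ham_path_last_in hy) //=; apply: ncl.
  by apply: ham_path_mono hy; apply: adjE_mono.
have c3 : b%:R * ((1/2 + 4/5 * eps) * #|K|%:R) <= (\sum_(s in A0) #|good_ends G1 (Sf s) s|)%:R :> R.
  by rewrite natr_sum -A0b mulr_natl -sumr_const; apply: ler_sum.
have c4 := sum_dgH p_gt0 eps1 sE res Eup A0K; rewrite A0b in c4.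
have c1r : (\sum_(s in A0) #|good_ends G1 (Sf s) s|)%:R <= #|stars A0 H|%:R + b%:R * b%:R + #|ms|%:R :> R.
  by rewrite -natrM -!natrD ler_nat.
have c2r : #|E :&: stars A0 H|%:R <= (\sum_(s in A0) dH s)%:R :> R by rewrite ler_nat.
move: low c1r c2r c3 c4 eta_small b_small miss.
rewrite -/ms.
set x1 := #|stars A0 H|%:R; set x2 := #|E :&: stars A0 H|%:R.
set x3 := (\sum_(s in A0) #|_|)%:R; set x4 := (\sum_(t in A0) dH t)%:R.
set mm := #|ms|%:R.
move: K0 br0; set ka := #|K|%:R; set bb := b%:R; set nn := n%:R ^+ 2 => ka0 bb0.
move=> low c1r c2r c3 c4' es bs mlt.
have nn0 : 0 <= nn by rewrite /nn exprn_ge0.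
have e0n : eta0 * nn <= eta * nn by rewrite ler_wpM2r.
have h1 : bb * ((1/2 + 4/5 * eps) * ka) <= x1 + bb * bb + bb * ka * eps / 10 by move: c3 c1r mlt; lra.
have h1' := ler_wpM2l p0 h1.
have h2 : p * (bb * ((1/2 + 4/5 * eps) * ka)) <
    p * (bb * bb + bb * ka * eps / 10 + eta * nn + (1/2 - eps) * (bb * ka + 3 * (eta0 * nn))).
  by move: low c2r c4' h1'; lra.
rewrite ltr_pM2l // in h2.
have h3 : (1/2 - eps) * (3 * (eta0 * nn)) <= 3/2 * (eta * nn).
  have : 0 <= eta0 * nn by rewrite mulr_ge0 // ltW.
  by move=> h; have := mulr_ge0 (ltW eps0) h; lra.
have h4 : bb * bb <= bb * (eps / 40 * ka) by rewrite ler_wpM2l // ltW.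
have h5 : bb * ((1/2 + 4/5 * eps) * ka) < bb * ((1/2 - eps + eps / 40 + eps / 10 + 5/200 * eps) * ka).
  by apply: lt_le_trans h2 _; move: h3 h4 es; lra.
rewrite ltr_pM2l // in h5.
have := mulr_gt0 eps0 ka0; move: h5; lra.
Qed.

End FixedVertexSet.

Theorem resilient_cycle : exists c : seq T, [/\ (2 < size c)%N, ucycle (adjE F) c & c =i K].
Proof.
have Kn0 : K != set0 by rewrite -card_gt0 -(ltr_nat R).
have [s0 [c0 [pc uc cK cmax]]] := exists_longest_path F Kn0.
pose V := [set x in s0 :: c0].
have cV : s0 :: c0 =i V by move=> x; rewrite /V in_set.
have VK : V \subset K by apply/subsetP=> x; rewrite -cV => /cK.
have Vmax c : sorted (adjE F) c -> uniq c -> {subset c <= K} -> (size c <= #|V|)%N.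
  by rewrite -(size_of_mem_eq uc cV); apply: cmax.
have [s [t [hst ts]]] := closing_edge VK Vmax pc uc cV.
have clV v x : v \in V -> adjE F v x -> x \in V.
  exact: (longest_cycle_closed FK VK Vmax hst ts).
have VE : V = K.
  apply/eqP; rewrite eqEsubset VK /=; apply: contraT => nKV.
  have V0 : V != set0 by apply/set0Pn; exists s0; rewrite -cV inE eqxx.
  (* [leaving_edge] handles at most half of [K], so it is applied to the smaller of [V] and its
     complement. *)
  have [h|h] := leqP (2 * #|V|) #|K|.
    have [v [x [vV]]] := leaving_edge VK V0 h; rewrite inE => /andP[xV _] vx.
    by rewrite (clV v x) in xV.
  have A0 : K :\: V != set0 by rewrite setD_eq0.
  have A2 : (2 * #|K :\: V| <= #|K|)%N.
    by move: h; rewrite cardsDS //; have := subset_leq_card VK; clear; lia.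
  have [v [x [vA]]] := leaving_edge (subsetDl K V) A0 A2.
  rewrite in_setD [x \in K :\: V]in_setD negb_and negbK => /andP[/orP[xV|/negP//] xK].
  by rewrite adjE_sym => xv; move: vA; rewrite in_setD (clV x v).
have [r [pr ur lr rV]] := hst.
exists (s :: r); split; last by move=> x; rewrite rV VE.
  rewrite (size_of_mem_eq ur rV) VE; apply: leq_trans b3 _; rewrite -(ler_nat R).
  apply: le_trans b_small _; have := eps1; have := K0.
  move=> k0 e1; have : eps / 40 * #|K|%:R <= 1 * #|K|%:R by rewrite ler_wpM2r ?(ltW k0) //; lra.
  by rewrite mul1r.
by rewrite /ucycle ur andbT /= rcons_path pr lr.
Qed.

End Rotate.

(** * The random graph process at a fixed time *)

Section FunCons.
Variables (X : Type) (m : nat).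

Definition fcons (u : X * {ffun 'I_m.+1 -> X}) : {ffun 'I_m.+2 -> X} :=
  [ffun i => if unlift ord0 i is Some j then u.2 j else u.1].

Lemma fcons0 u : fcons u ord0 = u.1.
Proof. by rewrite ffunE unlift_none. Qed.

Lemma fconsS u i : fcons u (lift ord0 i) = u.2 i.
Proof. by rewrite ffunE liftK. Qed.

Lemma fcons_bij : bijective fcons.
Proof.
exists (fun g : {ffun 'I_m.+2 -> X} => (g ord0, [ffun i => g (lift ord0 i)])).
  by move=> [x g]; rewrite fcons0; congr (_, _); apply/ffunP => i; rewrite ffunE fconsS.
move=> g; apply/ffunP => i; rewrite ffunE /=; case: unliftP => [j ->|->//].
by rewrite ffunE.
Qed.

End FunCons.

(** * Finite Markov chains and their trajectories *)

Section MarkovChain.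
Local Open Scope ring_scope.
Variables (R : realType) (X : finType) (k : X -> X -> R).
Hypothesis k_ge0 : forall x y, 0 <= k x y.
Hypothesis k_row : forall x, \sum_y k x y <= 1.
Implicit Types (a : X -> R) (bad : nat -> pred X).

Definition chain_weight m a (G : {ffun 'I_m.+1 -> X}) : R :=
  a (G ord0) * \prod_(i < m) k (G (widen_ord (leqnSn _) i)) (G (lift ord0 i)).

Definition push a y : R := \sum_x a x * k x y.

Lemma push_ge0 a : (forall x, 0 <= a x) -> forall y, 0 <= push a y.
Proof. by move=> a0 y; apply: sumr_ge0 => x _; rewrite mulr_ge0. Qed.

Lemma chain_weight_ge0 m a G : (forall x, 0 <= a x) -> 0 <= chain_weight (m := m) a G.
Proof. by move=> a0; rewrite mulr_ge0 // prodr_ge0. Qed.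

Lemma chain_weight_fcons m a x (G : {ffun 'I_m.+1 -> X}) :
  chain_weight a (fcons (x, G)) = a x * k x (G ord0) *
     \prod_(i < m) k (G (widen_ord (leqnSn _) i)) (G (lift ord0 i)).
Proof.
rewrite /chain_weight fcons0 big_ord_recl /= fconsS mulrA; congr (_ * k _ _ * _).
  have -> : widen_ord (leqnSn m.+1) ord0 = ord0 by apply: val_inj.
  by rewrite fcons0.
apply: eq_bigr => i _; rewrite fconsS.
have -> : widen_ord (leqnSn m.+1) (lift ord0 i) = lift ord0 (widen_ord (leqnSn m) i) by apply: val_inj.
by rewrite fconsS.
Qed.

Lemma sum_fcons m (f : {ffun 'I_m.+2 -> X} -> R) :
  \sum_G f G = \sum_(G : {ffun 'I_m.+1 -> X}) \sum_x f (fcons (x, G)).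
Proof.
rewrite (reindex (@fcons X m)) /=; last by apply: onW_bij; apply: fcons_bij.
rewrite exchange_big /= pair_bigA /=; apply: eq_bigr => -[x G] _ //.
Qed.

Lemma sum_ffun1 (f : {ffun 'I_1 -> X} -> R) : \sum_G f G = \sum_x f [ffun=> x].
Proof.
rewrite (reindex (fun x : X => [ffun _ : 'I_1 => x])) //=.
apply: onW_bij; exists (fun g : {ffun 'I_1 -> X} => g ord0) => [x|g]; first by rewrite ffunE.
by apply/ffunP => i; rewrite ffunE ord1.
Qed.

Lemma chain_push m a (h : {ffun 'I_m.+1 -> X} -> R) :
  \sum_(G : {ffun 'I_m.+1 -> X}) \sum_x chain_weight a (fcons (x, G)) * h G =
  \sum_G chain_weight (push a) G * h G.
Proof.
apply: eq_bigr => G _; rewrite -mulr_suml; congr (_ * _).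
rewrite /chain_weight /push mulr_suml; apply: eq_bigr => x _.
exact: chain_weight_fcons.
Qed.

Lemma chain_mass m a : (forall x, 0 <= a x) -> \sum_G chain_weight (m := m) a G <= \sum_x a x.
Proof.
elim: m a => [|m IH] a a0.
  rewrite sum_ffun1 le_eqVlt; apply/orP; left; apply/eqP; apply: eq_bigr => x _.
  by rewrite /chain_weight big_ord0 ffunE mulr1.
rewrite sum_fcons; have := chain_push a (fun _ : {ffun 'I_m.+1 -> X} => 1 : R).
under eq_bigr do under eq_bigr do rewrite mulr1.
under [in X in _ = X -> _]eq_bigr do rewrite mulr1.
move=> ->; apply: le_trans (IH _ (push_ge0 a0)) _.
rewrite /push exchange_big /=; apply: ler_sum => x _; rewrite -mulr_sumr.
by rewrite ler_piMr.
Qed.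

(* Summing over the first bad time needs only that the future has mass at most 1. *)
Lemma chain_union m (u : nat -> X -> R) bad j : (forall i x, 0 <= u i x) ->
  (forall i, (i < m)%N -> push (u (j + i)%N) =1 u (j + i).+1) ->
  \sum_G chain_weight (m := m) (u j) G * [exists i : 'I_m.+1, bad (j + i)%N (G i)]%:R <=
  \sum_(i < m.+1) \sum_(x | bad (j + i)%N x) u (j + i)%N x.
Proof.
elim: m j => [|m IH] j u0 hu.
  rewrite sum_ffun1 big_ord_recl big_ord0 addr0 [leRHS]big_mkcond; apply: ler_sum => x _.
  rewrite /chain_weight big_ord0 ffunE mulr1.
  case: existsP => [[i]|_]; last by rewrite mulr0; case: ifP.
  by rewrite ffunE (ord1 i) => ->; rewrite mulr1 /= addn0.
rewrite sum_fcons big_ord_recl /=.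
(* A trajectory bad at its first time is charged to that state; any other is charged to the shifted
   trajectory, where induction applies. *)
apply: le_trans (_ : \sum_(G : {ffun 'I_m.+1 -> X}) \sum_x
   (chain_weight (fun x => if bad (j + 0)%N x then u j x else 0) (fcons (x, G)) +
    chain_weight (u j) (fcons (x, G)) * [exists i : 'I_m.+1, bad (j.+1 + i)%N (G i)]%:R) <= _).
  apply: ler_sum => G _; apply: ler_sum => x _.
  have w0 := chain_weight_ge0 (fcons (x, G)) (u0 j).
  have [bx|nbx] := boolP (bad (j + 0)%N x).
    have -> : chain_weight (fun x => if bad (j + 0)%N x then u j x else 0) (fcons (x, G)) =
       chain_weight (u j) (fcons (x, G)) by rewrite /chain_weight fcons0 /= bx.
    by apply: ler_wpDr; [rewrite mulr_ge0|rewrite ler_piMr // lern1 leq_b1].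
  have -> : chain_weight (fun x => if bad (j + 0)%N x then u j x else 0) (fcons (x, G)) = 0.
    by rewrite /chain_weight fcons0 /= (negbTE nbx) mul0r.
  rewrite add0r ler_wpM2l // ler_nat.
  case: existsP => // -[i bi]; apply: (leq_trans (n := 1%N)) => //.
  rewrite lt0b; apply/existsP; case: (unliftP ord0 i) bi => [i' ->|->].
    by rewrite fconsS => h; exists i'; move: h; rewrite /= /bump /= addnS addSn.
  by rewrite fcons0 /= (negbTE nbx).
under [leLHS]eq_bigr => G _ do rewrite big_split /=.
rewrite big_split /=; apply: lerD.
  rewrite -sum_fcons; apply: le_trans (chain_mass _ _) _.
    by move=> x; case: ifP.
  by rewrite [leRHS]big_mkcond /= addn0.
rewrite chain_push.
have e : push (u j) =1 u j.+1 by move=> x; have := hu 0%N isT x; rewrite addn0.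
apply: le_trans (_ : \sum_G chain_weight (u j.+1) G * [exists i : 'I_m.+1, bad (j.+1 + i)%N (G i)]%:R <= _).
  by apply: ler_sum => G _; rewrite /chain_weight e.
apply: le_trans (IH j.+1 u0 _) _.
  by move=> i im x; rewrite addSn -addnS hu // addnS.
by apply: ler_sum => i _; rewrite /bump /= add1n addnS addSn.
Qed.

Lemma chain_total m (u : nat -> X -> R) j :
  (forall i, (i < m)%N -> push (u (j + i)%N) =1 u (j + i).+1) ->
  \sum_G chain_weight (m := m) (u j) G = \sum_x u (j + m)%N x.
Proof.
elim: m j => [|m IH] j hu.
  rewrite sum_ffun1 addn0; apply: eq_bigr => x _.
  by rewrite /chain_weight big_ord0 ffunE mulr1.
rewrite sum_fcons; have := chain_push (u j) (fun _ : {ffun 'I_m.+1 -> X} => 1 : R).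
under eq_bigr do under eq_bigr do rewrite mulr1.
under [in X in _ = X -> _]eq_bigr do rewrite mulr1.
move=> ->; have e : push (u j) =1 u j.+1 by move=> x; have := hu 0%N isT x; rewrite addn0.
rewrite (eq_bigr (chain_weight (u j.+1))); last by move=> G _; rewrite /chain_weight e.
rewrite IH; first by rewrite addnS.
by move=> i im x; rewrite addSn -addnS hu // addnS.
Qed.

End MarkovChain.

(** * The mode of a binomial distribution *)

Section BinomialMode.

(** Binomial probabilities at p = M / N, times N^N. The ratio of consecutive terms, (N - j) M over
    (j + 1)(N - M), is at least 1 before [M] and at most 1 from [M] on. *)
Lemma binomial_mode N M j : M <= N -> j <= N ->
  'C(N, j) * M ^ j * (N - M) ^ (N - j) <= 'C(N, M) * M ^ M * (N - M) ^ (N - M).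
Proof.
move=> MN jN; pose t j := 'C(N, j) * M ^ j * (N - M) ^ (N - j).
have rec i : i < N -> t i.+1 * (i.+1 * (N - M)) = t i * ((N - i) * M).
  move=> iN; rewrite /t; have -> : N - i = (N - i.+1).+1 by move: iN; clear; lia.
  have := mul_bin_left N i; rewrite (_ : N - i = (N - i.+1).+1); last by move: iN; clear; lia.
  move=> h; rewrite !expnS.
  have -> : 'C(N, i.+1) * (M * M ^ i) * (N - M) ^ (N - i.+1) * (i.+1 * (N - M)) =
     (i.+1 * 'C(N, i.+1)) * (M * M ^ i * (N - M) ^ (N - i.+1) * (N - M)) by clear; lia.
  rewrite h; clear; lia.
have [MN'|MN'] := leqP N M.
  have -> : M = N by apply/eqP; rewrite eqn_leq MN.
  have [->//|jN'] := eqVneq j N; rewrite subnn [X in _ * X]exp0n ?muln0 //.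
  by rewrite subn_gt0 ltn_neqAle jN'.
have NM : 0 < N - M by rewrite subn_gt0.
have up i : i < M -> t i <= t i.+1.
  move=> iM; have iN : i < N by apply: ltn_trans iM MN'.
  rewrite -(@leq_pmul2r (i.+1 * (N - M))) ?muln_gt0 // rec // leq_mul2l; apply/orP; right.
  by rewrite mulnC leq_mul // leq_sub2l // ltnW.
have down i : M <= i -> i < N -> t i.+1 <= t i.
  move=> iM iN; rewrite -(@leq_pmul2r (i.+1 * (N - M))) ?muln_gt0 // rec // leq_mul2l; apply/orP; right.
  by rewrite mulnC leq_mul ?leq_sub2l // leqW.
rewrite -/(t j) -/(t M); have [jM|Mj] := leqP j M.
  have : forall d, d <= M -> t (M - d) <= t M.
    elim=> [|d IH] dM; first by rewrite subn0.
    apply: leq_trans (IH (ltnW dM)); have -> : M - d = (M - d.+1).+1 by move: dM; clear; lia.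
    by apply: up; move: dM; clear; lia.
  by move=> /(_ (M - j) (leq_subr _ _)); rewrite subKn.
have : forall d, M + d <= N -> t (M + d) <= t M.
  elim=> [|d IH] dM; first by rewrite addn0.
  rewrite addnS in dM *; apply: leq_trans (IH (ltnW dM)); apply: down => //; exact: leq_addr.
by move=> /(_ (j - M)); rewrite subnKC ?(ltnW Mj) //; apply.
Qed.

(** The largest of N + 1 terms with sum 1; this is the cost of conditioning on exactly [M] edges. *)
Lemma binomial_mode_prob (R : realType) N M : 0 < N -> M <= N ->
  (1 <= N.+1%:R * ('C(N, M)%:R * ((M%:R / N%:R) ^+ M * (1 - M%:R / N%:R) ^+ (N - M))) :> R)%R.
Proof.
move=> N0 MN; set p := (M%:R / N%:R : R)%R.
have Nr : (N%:R != 0 :> R)%R by rewrite pnatr_eq0 -lt0n.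
have q : (1 - p = (N - M)%:R / N%:R)%R by rewrite natrB // mulrBl mulfV.
have term j : j <= N -> ('C(N, j)%:R * (p ^+ j * (1 - p) ^+ (N - j)) =
    ('C(N, j) * M ^ j * (N - M) ^ (N - j))%:R / N%:R ^+ N)%R.
  move=> jN; rewrite q /p !expr_div_n !natrM !natrX.
  have -> : (N%:R ^+ N = N%:R ^+ j * N%:R ^+ (N - j) :> R)%R by rewrite -exprD subnKC.
  have h1 : (N%:R ^+ j != 0 :> R)%R by rewrite expf_neq0.
  have h2 : (N%:R ^+ (N - j) != 0 :> R)%R by rewrite expf_neq0.
  by field; rewrite h1 h2.
have e1 : (1 = (p + (1 - p)) ^+ N :> R)%R by rewrite addrC subrK expr1n.
rewrite [leLHS]e1 exprDn -[N.+1 in leRHS]card_ord mulr_natl -sumr_const; apply: ler_sum => i _.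
have iN : i <= N by rewrite -ltnS.
rewrite -mulr_natl.
rewrite (term M MN).
rewrite -bin_sub //; have := term (N - i) (leq_subr _ _); rewrite subKn // => h.
rewrite h ler_wpM2r ?invr_ge0 ?exprn_ge0 // ler_nat.
have := binomial_mode MN (leq_subr i N); by rewrite subKn.
Qed.

End BinomialMode.

(** * Marginals of the graph process and comparison with the binomial graph *)

Section Process.
Local Open Scope ring_scope.
Variables (R : realType) (n : nat).
Notation N := 'C(n, 2).
Notation T := 'I_n.
Implicit Types (x y G : graph 'I_n) (E : {set {set 'I_n}}).

Lemma eset_pairs G : eset G \subset pairs T.
Proof. by apply/subsetP => e /edgeP/andP[_ h]; rewrite inE. Qed.

Lemma card_pairs_ord : #|pairs T| = N.
Proof. by rewrite card_pairs card_ord. Qed.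

Definition full_with (j : nat) : pred (graph 'I_n) :=
  fun x => (vset x == setT) && (#|eset x| == j)%N.

Definition unif (j : nat) x : R := if full_with j x then 'C(N, j)%:R^-1 else 0.

Lemma unif_ge0 j x : 0 <= unif j x.
Proof. by rewrite /unif; case: ifP => // _; rewrite invr_ge0. Qed.

Lemma step_prob_ge0 x y : 0 <= step_prob R x y.
Proof. by rewrite /step_prob; case: ifP => // _; rewrite invr_ge0. Qed.

Lemma step_prob_row x : \sum_y step_prob R x y <= 1.
Proof.
pose P := [set y | [exists e in nonedges x, adds_edge x e y]]; set m := #|nonedges x|.
have -> : \sum_y step_prob R x y = \sum_(y in P) m%:R^-1.
  by rewrite [RHS]big_mkcond; apply: eq_bigr => y _; rewrite inE.
have h : (#|P| <= m)%N.
  rewrite -(card_in_imset (f := @eset 'I_n) (D := P)).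
    apply: leq_trans (leq_imset_card (fun e => e |: eset x) (nonedges x)).
    apply/subset_leq_card/subsetP => E /imsetP[y]; rewrite inE => /exists_inP[e ne /andP[_ /eqP ->]] ->.
    by apply/imsetP; exists e.
  move=> y z; rewrite !inE => /exists_inP[e _ /andP[/eqP vy _]] /exists_inP[e' _ /andP[/eqP vz _]] h.
  by apply: graph_eq; rewrite // vy vz.
rewrite sumr_const; case: m h => [|m] h; first by move: h; rewrite leqn0 => /eqP ->; rewrite mulr0n ler01.
by rewrite -[leLHS]mulr_natl ler_pdivrMr ?mul1r ?ltr0n // ler_nat.
Qed.

Fact wf_delete y (e : {set 'I_n}) : wf_graph (vset y, eset y :\ e).
Proof. by apply/forall_inP => f /=; rewrite inE => /andP[_]; apply: edgeP. Qed.

Definition delete y e : graph 'I_n := Graph (wf_delete y e).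

Lemma card_nonedges x j : full_with j x -> #|nonedges x| = (N - j)%N.
Proof.
case/andP => /eqP vx /eqP <-; rewrite -card_pairs_ord -cardsDS ?eset_pairs //.
by apply: eq_card => e; rewrite !inE vx subsetT /= andbC.
Qed.

(** A graph with j + 1 edges has exactly j + 1 predecessors, one for each deleted edge, and (j + 1)
    binom(N, j + 1) = (N - j) binom(N, j). *)
Lemma push_unif j : (j < N)%N -> push (@step_prob R n) (unif j) =1 unif j.+1.
Proof.
move=> jN y; rewrite /push.
pose P x := full_with j x && [exists e in nonedges x, adds_edge x e y].
transitivity (\sum_(x | P x) ('C(N, j)%:R^-1 * (N - j)%:R^-1 : R)).
  rewrite [RHS]big_mkcond; apply: eq_bigr => x _; rewrite /unif /step_prob /P.
  case: ifP => [fx|_]; last by rewrite mul0r.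
  by case: ifP => _; rewrite ?mulr0 // (card_nonedges fx).
rewrite sumr_const /unif; case: ifP => fy; last first.
  rewrite (_ : #|P| = 0%N) ?mulr0n //; apply: eq_card0 => x; rewrite unfold_in.
  apply/negbTE/negP => /andP[/andP[/eqP vx /eqP cx] /exists_inP[e ne /andP[/eqP vy /eqP ey]]].
  move/negP: fy; apply; rewrite /full_with vy vx eqxx ey cardsU1 cx.
  by move: ne; rewrite inE => /and3P[_ _ ->]; rewrite add1n eqxx.
have cP : #|P| = j.+1.
  have /andP[/eqP vy /eqP cy] := fy; rewrite -cy.
  rewrite -[RHS](card_in_imset (f := delete y)).
    apply: eq_card => x; rewrite unfold_in; apply/idP/imsetP => [|[e ey ->]].
      case/andP => /andP[/eqP vx /eqP cx] /exists_inP[e ne /andP[/eqP vyx /eqP eyx]].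
      have nex : e \notin eset x by move: ne; rewrite inE => /and3P[].
      exists e; first by rewrite eyx !inE eqxx.
      apply: graph_eq; first by rewrite /vset /= -/(vset y) vyx.
      by rewrite [RHS]/eset /= -/(eset y) eyx setU1K.
    apply/andP; split.
      rewrite /full_with /vset /eset /= -/(vset y) -/(eset y) vy eqxx /=.
      by move: cy; rewrite (cardsD1 e) ey add1n => -[->].
    have := edgeP ey => /andP[e1 e2].
    apply/exists_inP; exists e; first by rewrite inE /vset /eset /= -/(vset y) e1 e2 !inE eqxx.
    by rewrite /adds_edge /vset /eset /= -/(vset y) -/(eset y) eqxx setD1K //= eqxx.
  move=> e f ey fy' h; have : eset (delete y e) = eset (delete y f) by rewrite h.
  rewrite /eset /= -/(eset y) => /setP/(_ e); rewrite !inE eqxx ey andbT /=.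
  by rewrite andbT => /esym/negbFE/eqP.
rewrite cP -[LHS]mulr_natl.
have c0 : 'C(N, j)%:R != 0 :> R by rewrite pnatr_eq0 -lt0n bin_gt0 ltnW.
have c1 : 'C(N, j.+1)%:R != 0 :> R by rewrite pnatr_eq0 -lt0n bin_gt0.
have c2 : (N - j)%:R != 0 :> R by rewrite pnatr_eq0 -lt0n subn_gt0.
have : (j.+1)%:R * 'C(N, j.+1)%:R = (N - j)%:R * 'C(N, j)%:R :> R by rewrite -!natrM mul_bin_left.
move=> h; apply: (mulIf c1); rewrite mulVf // mulrAC h.
by field; rewrite c0 c2.
Qed.

Lemma process_weightE (G : process n) : process_weight R G = chain_weight (@step_prob R n) (unif 0) G.
Proof.
rewrite /process_weight /chain_weight; congr (_ * _).
rewrite /unif /full_with bin0 invr1; case: eqP => [->|h].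
  by rewrite /vset /eset /= eqxx cards0.
case: ifP => // /andP[/eqP v /eqP /cards0_eq e]; case: h.
by apply: graph_eq; rewrite ?v ?e.
Qed.

(** In the binomial graph of density j / N all graphs with [j] edges have equal weight, at least 1 /
    (N + 1) times their uniform weight. The first disjunct has weight 0 under [unif]. *)
Lemma sum_unif j (bad : pred {set {set 'I_n}}) : (0 < N)%N -> (j <= N)%N ->
  \sum_(x | ~~ full_with j x || bad (eset x)) unif j x <=
  N.+1%:R * Pr (j%:R / N%:R : R) (pairs T) bad.
Proof.
move=> N0 jN; set p := j%:R / N%:R : R.
have p01 : 0 <= p <= 1.
  by rewrite divr_ge0 //= ler_pdivrMr ?ltr0n // mul1r ler_nat.
have bE (E : {set {set 'I_n}}) : E \subset pairs T -> #|E| = j -> bern p (pairs T) E = p ^+ j * (1 - p) ^+ (N - j).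
  move=> EU cE; rewrite /bern (bigID (mem E)) /=; congr (_ * _).
    rewrite -cE -prodr_const; apply: eq_bigr => e eE; rewrite eE.
    by have := subsetP EU e eE => ->.
  rewrite (bigID (mem (pairs T))) /= [X in _ * X]big1 ?mulr1; last first.
    by move=> e /andP[/negbTE -> /negbTE ->].
  rewrite (eq_bigr (fun=> 1 - p)); last by move=> e /andP[/negbTE -> ->].
  rewrite prodr_const; congr (_ ^+ _); rewrite -cE -card_pairs_ord -cardsDS //.
  by apply: eq_card => e; rewrite in_setD.
rewrite /Pr mulr_sumr.
apply: le_trans (_ : \sum_(x | full_with j x && bad (eset x)) N.+1%:R * bern p (pairs T) (eset x) <= _).
  rewrite big_mkcond [leRHS]big_mkcond; apply: ler_sum => x _; rewrite /unif.
  case: (boolP (full_with j x)) => //= fx.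
  case: ifP => // _; have /andP[_ /eqP cx] := fx.
  rewrite bE ?eset_pairs //.
  have c0 : 0 < 'C(N, j)%:R :> R by rewrite ltr0n bin_gt0.
  rewrite -(ler_pM2l c0) mulfV ?gt_eqF // mulrCA.
  exact: binomial_mode_prob.
rewrite [leRHS]big_mkcond /=.
have inj : {in [pred x | full_with j x && bad (eset x)] &, injective (@eset 'I_n)}.
  move=> x y; rewrite !inE => /andP[/andP[/eqP vx _] _] /andP[/andP[/eqP vy _] _] h.
  by apply: graph_eq; rewrite ?vx ?vy.
rewrite -[leLHS](big_imset (fun E => N.+1%:R * bern p (pairs T) E) inj) /=.
rewrite big_mkcond /=; apply: ler_sum => E _.
have b0 : 0 <= N.+1%:R * bern p (pairs T) E by rewrite mulr_ge0 ?bern_ge0.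
case: ifP => [/imsetP[x]|_]; last by case: ifP.
by rewrite inE => /andP[_ bx] ->; rewrite bx.
Qed.

(** A trajectory outside [A] has a bad time, so [chain_union] bounds the weight of the complement.
    That the total weight is 1 is read off at time [N], where only the complete graph remains. *)
Lemma process_prob_bounds (A : set (process n)) (bad : nat -> pred {set {set 'I_n}}) : (0 < N)%N ->
  (forall G : process n, (forall M : 'I_N.+1, vset (G M) = setT /\ ~~ bad M (eset (G M))) -> A G) ->
  1 - \sum_(M < N.+1) N.+1%:R * Pr (M%:R / N%:R : R) (pairs T) (bad M) <= process_prob R A <= 1.
Proof.
move=> N0 hA.
have ch i : (i < N)%N -> push (@step_prob R n) (unif (0 + i)%N) =1 unif (0 + i).+1.
  by move=> iN; rewrite add0n; apply: push_unif.
have tot : \sum_(G : process n) process_weight R G = 1.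
  rewrite (eq_bigr (chain_weight (@step_prob R n) (unif 0))); last by move=> G _; apply: process_weightE.
  rewrite (chain_total ch) add0n /unif -big_mkcond sumr_const binn invr1.
  have wfT : wf_graph (setT : {set 'I_n}, pairs T).
    by apply/forall_inP => e /=; rewrite inE => ->; rewrite subsetT.
  rewrite (_ : #|_| = 1%N) //; apply/eqP/fintype.card1P; exists (Graph wfT) => x.
  rewrite unfold_in inE; apply/idP/eqP => [/andP[/eqP v /eqP c]|->]; last first.
    by rewrite /full_with /vset /eset /= card_pairs_ord !eqxx.
  apply: graph_eq; rewrite ?v //; apply/eqP; rewrite eqEcard eset_pairs c.
  by rewrite /eset /= card_pairs_ord.
have w0 (G : process n) : 0 <= process_weight R G.
  rewrite process_weightE; apply: chain_weight_ge0; first exact: step_prob_ge0.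
  exact: unif_ge0.
pose bad' M x := ~~ full_with M x || bad M (eset x).
have un := chain_union step_prob_ge0 step_prob_row bad' unif_ge0 ch.
have un2 : \sum_(i < N.+1) \sum_(x | bad' (0 + i)%N x) unif (0 + i) x <=
    \sum_(M < N.+1) N.+1%:R * Pr (M%:R / N%:R : R) (pairs T) (bad M).
  by apply: ler_sum => M _; rewrite add0n; apply: sum_unif; rewrite // -ltnS.
have {}un := le_trans un un2.
apply/andP; split; last first.
  rewrite -tot /process_prob [leLHS]big_mkcond /=; apply: ler_sum => G _.
  by case: ifP.
rewrite lerBlDr -[leLHS]tot; apply: le_trans (lerD (lexx _) un).
rewrite /process_prob [X in X + _]big_mkcond /= -big_split /=; apply: ler_sum => G _.
rewrite -process_weightE.
case: existsP => [_|nb]; first by rewrite mulr1 lerDr; case: ifP.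
rewrite mulr0 addr0; case: ifP => // /negP[]; apply/mem_set/hA => M.
have : ~~ bad' M (G M) by apply/negP => h; apply: nb; exists M; rewrite add0n.
by rewrite negb_or negbK => /andP[/andP[/eqP ->]].
Qed.

End Process.

(** * Cores and resilience *)

Section GraphDegrees.
Variable T : finType.
Implicit Types (G H K L : graph T) (v : T).

Lemma eset_sub_pairs G : eset G \subset pairs T.
Proof. by apply/subsetP => e /edgeP/andP[_ h]; rewrite inE. Qed.

Lemma degree_deg_in G v : v \in vset G -> degree G v = deg_in (adjE (eset G)) (vset G) v.
Proof.
move=> vG; rewrite deg_in_edges ?eset_sub_pairs //; apply: eq_card => e; rewrite !inE.
by case: (boolP (e \in eset G)) => //= /edgeP/andP[-> _]; rewrite andbT.
Qed.

Fact wf_crossing G (A : {set T}) :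
  wf_graph (vset G, [set e in eset G | ~~ (e \subset A) && ~~ (e \subset vset G :\: A)]).
Proof. by apply/forall_inP => e /=; rewrite inE => /andP[/edgeP]. Qed.

Definition crossing G A : graph T := Graph (wf_crossing G A).

Lemma path_closed (e : rel T) (A : {set T}) x p :
  (forall u v, e u v -> u \in A -> v \in A) -> path e x p -> x \in A -> {subset p <= A}.
Proof.
move=> cl; elim: p x => [|y p IH] x //= /andP[xy yp] xA z.
have yA := cl _ _ xy xA; rewrite inE => /orP[/eqP ->//|]; exact: IH yA _.
Qed.

Lemma cut_not_hamiltonian G (A : {set T}) : A \subset vset G -> A != set0 -> vset G :\: A != set0 ->
  ~ hamiltonian (remove_edges G (crossing G A)).
Proof.
move=> AV /set0Pn[x xA] /set0Pn[y]; rewrite inE => /andP[yA yV] [c [_ /andP[cy uc] cV]].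
have cl u v : adj (remove_edges G (crossing G A)) u v -> u \in A -> v \in A.
  rewrite /adj inE /eset /= -/(eset G) !inE => /andP[h uvE] uA.
  apply: contraT => vA; move: h; rewrite uvE /= negb_and !negbK !subUset !sub1set uA (negbTE vA) /=.
  by rewrite inE uA.
have [|i p rE] := @rot_to _ c x; first by rewrite cV; apply: (subsetP AV).
have pth : path (adj (remove_edges G (crossing G A))) x (rcons p x).
  by move: cy; rewrite -(rot_cycle i) rE.
have yp : y \in rcons p x.
  have : y \in rot i c by rewrite mem_rot cV.
  by rewrite rE mem_rcons.
by have := path_closed cl pth xA yp; rewrite (negbTE yA).
Qed.

Lemma not_resiliently_hamiltonian (R : realType) (eps : R) (k : nat) G :
  (0 < eps)%R -> (2 <= eps * k%:R)%R -> 2 < k -> min_degree_ge k G -> vset G != set0 ->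
  ~ resiliently_hamiltonian (1 / 2 + eps)%R G.
Proof.
move=> e0 ek k2 mk V0 hres.
set V := vset G in V0 mk.
pose r := adjE (eset G); pose d v := deg_in r V v.
(* The largest integer with 2 f < d. A vertex keeping [f] neighbours in its part has at most f + 2
   across, which is at most d / 2 + 3 / 2, and eps d >= 2 covers the excess. *)
pose f v := (d v).-1./2.
have dk v : v \in V -> k <= d v by move=> vV; rewrite /d -degree_deg_in //; apply: mk.
have rirr : irreflexive r.
  move=> x; apply/negbTE/negP => /(adjE_neq (eset_sub_pairs G)); by rewrite eqxx.
have f2 v : (f v).*2 <= (d v).-1.
  by rewrite /f -[leqRHS](odd_double_half (d v).-1) leq_addl.
have f3 v : (d v).-1 <= (f v).*2.+1.
  by rewrite /f -[leqLHS](odd_double_half (d v).-1) -add1n leq_add2r leq_b1.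
have [|||A] := @Stiebitz_partition T r V (adjE_sym _) rirr f f V0.
- by move=> v /dk h; have := f3 v; move: h k2; clear; lia.
- by move=> v /dk h; have := f3 v; move: h k2; clear; lia.
- by move=> v /dk h; have := f2 v; rewrite -/(d v); move: h k2; clear; lia.
case/and5P => A0 B0 AV _ /and3P[dis /forall_inP tA /forall_inP tB].
apply: (cut_not_hamiltonian AV A0 B0); apply: hres.
  by apply/andP; split; rewrite ?subxx //; apply/subsetP=> e; rewrite inE => /andP[].
have VE : V = A :|: (V :\: A).
  by apply/setP=> u; rewrite !inE; case: (boolP (u \in A)) => //= /(subsetP AV).
have dsplit v : d v = deg_in r A v + deg_in r (V :\: A) v by rewrite /d {1}VE deg_inU.
move=> v vV.
have hv : degree (crossing G A) v <= (f v).+2.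
  rewrite degree_deg_in //.
  have [vA|vA] := boolP (v \in A).
    apply: leq_trans (_ : deg_in r (V :\: A) v <= _).
      apply/subset_leq_card/subsetP => u; rewrite !inE => /andP[uV].
      rewrite /adjE /eset /= -/(eset G) inE => /andP[uvE /andP[h _]].
      by move: h; rewrite subUset !sub1set vA /= => ->; rewrite uV.
    have := tA v vA; have := dsplit v; have := f3 v; have := dk v vV; move: k2; clear; lia.
  have vB : v \in V :\: A by rewrite inE vA.
  apply: leq_trans (_ : deg_in r A v <= _).
    apply/subset_leq_card/subsetP => u; rewrite !inE => /andP[uV].
    rewrite /adjE /eset /= -/(eset G) inE => /andP[uvE /andP[_ h]].
    move: h; rewrite subUset !sub1set vB /= inE uV andbT negbK => ->.
    by [].
  have := tB v vB; have := dsplit v; have := f3 v; have := dk v vV; move: k2; clear; lia.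
have dd : (2 <= (d v)%:R * eps :> R)%R.
  rewrite mulrC; apply: le_trans ek _; rewrite ler_wpM2l ?(ltW e0) // ler_nat; exact: dk.
rewrite [degree G v]degree_deg_in // -/(d v).
apply: le_trans (_ : (f v).+2%:R <= _)%R; first by rewrite ler_nat.
have h2 : ((f v).*2 + 1 <= d v) by have := f2 v; have := dk v vV; move: k2; clear; lia.
have : (((f v).*2 + 1)%:R <= (d v)%:R :> R)%R by rewrite ler_nat.
rewrite natrD -muln2 natrM; move: dd.
have -> : ((f v).+2%:R = (f v)%:R + 2%:R :> R)%R by rewrite -natrD addn2.
by set x := ((f v)%:R)%R; set y := ((d v)%:R)%R; lra.
Qed.

Lemma resiliently_hamiltonian_le (R : realType) (al be : R) G : (al <= be)%R ->
  resiliently_hamiltonian be G -> resiliently_hamiltonian al G.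
Proof.
move=> ab h H HG hH; apply: h => // v vG; apply: le_trans (hH v vG) _.
by rewrite ler_wpM2r.
Qed.

Fact wf_induced G (Z : {set T}) : wf_graph (Z, edges_in (eset G) Z).
Proof. by apply/forall_inP => e /=; rewrite inE => /andP[/edgeP/andP[_ ->] ->]. Qed.

Definition induced G Z : graph T := Graph (wf_induced G Z).

Lemma degree_induced G (Z : {set T}) v :
  degree (induced G Z) v = #|[set e in eset G | (v \in e) && (e \subset Z)]|.
Proof. by apply: eq_card => e; rewrite !inE -andbA [(e \subset Z) && _]andbC. Qed.

Lemma induced_sub G (Z : {set T}) : Z \subset vset G -> subgraph (induced G Z) G.
Proof. by move=> ZV; apply/andP; split=> //; apply/subsetP=> e; rewrite inE => /andP[]. Qed.

(** By maximality: adding missing edges of [G] on the same vertices only raises degrees. *)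
Lemma kcore_eset k G K : is_kcore k G K -> eset K = edges_in (eset G) (vset K).
Proof.
move=> [/andP[KV KE] Kd Kmax].
have sub : subgraph K (induced G (vset K)).
  apply/andP; split=> //; apply/subsetP=> e eK; rewrite /eset /= inE (subsetP KE) //=.
  by have /andP[] := edgeP eK.
have -> // : edges_in (eset G) (vset K) = eset (induced G (vset K)) by [].
rewrite (Kmax (induced G (vset K))) //; first exact: induced_sub.
by move=> v vK; apply: leq_trans (Kd v vK) _; apply: subgraph_degree.
Qed.

(** This turns a small nonempty core into a dense set, which is an unlikely event. *)
Lemma kcore_dense k G K : is_kcore k G K -> k * #|vset K| <= 2 * #|edges_in (eset G) (vset K)|.
Proof.
move=> hK; have [KG Kd _] := hK; rewrite -(kcore_eset hK) mulnC -sum_nat_const.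
apply: leq_trans (_ : \sum_(v in vset K) #|[set e in eset K | v \in e]| <= _).
  by apply: leq_sum => v /Kd.
apply: sum_incident_le; first exact: eset_sub_pairs.
- by move=> v _; apply/subsetP=> e; rewrite inE => /andP[].
- by move=> v e _; rewrite inE => /andP[].
Qed.

(* Removing the vertices outside the core, and then the low-degree ones, in a suitable order,
   each removed vertex sends few edges to the remaining ones. *)
Lemma kcore_peel (R : realType) (x : R) k G K j :
  is_kcore k G K -> vset G = setT -> (k%:R <= x)%R ->
  let U := ~: vset K :|: [set v in vset K | ((degree K v)%:R < x)%R] in
  j <= #|U| -> exists2 U' : {set T}, #|U'| = j /\ U' \subset U &
    (#|edges_meeting (eset G) U'|%:R <= j%:R * x)%R.
Proof.
move=> hK GT kx U; have [KG Kd _] := hK.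
elim: j => [|j IH] jU.
  exists set0; first by rewrite cards0 sub0set.
  rewrite mul0r (_ : edges_meeting _ _ = set0) ?cards0 //.
  by apply/setP=> e; rewrite !inE disjoint_sym disjoints_subset sub0set andbF.
have [U' [cU' sU'] hU'] := IH (ltnW jU).
have [v vU vx] : exists2 v, v \in U :\: U' &
    (#|[set e in eset G | (v \in e) && [disjoint e & U']]|%:R < x :> R)%R.
  have [/exists_inP[v h1 h2]|] := boolP [exists v in U :\: U',
    (#|[set e in eset G | (v \in e) && [disjoint e & U']]|%:R < x :> R)%R]; first by exists v.
  rewrite negb_exists_in => /forall_inP nv; exfalso.
  (* If every vertex of [U :\: U'] sent at least x >= k edges outside [U'], the core together with
     the remaining vertices would have minimum degree [k]. So the remaining vertices all lie in the
     core, and one of them in [U] has core degree below [x], a contradiction. *)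
  have sZ : subgraph (induced G (~: U' :|: vset K)) K.
    apply: (is_kcore_max hK); first by apply: induced_sub; rewrite GT subsetT.
    move=> v; rewrite /vset /= -/(vset K) => vZ; have [vK|vK] := boolP (v \in vset K).
      apply: leq_trans (Kd v vK) _; apply: subgraph_degree; apply/andP; split; first exact: subsetUr.
      rewrite (kcore_eset hK); apply/subsetP=> e; rewrite !inE => /andP[-> eK].
      by rewrite (subset_trans eK) // subsetUr.
    have vU' : v \notin U' by move: vZ; rewrite !inE (negbTE vK) orbF.
    have := nv v; rewrite !inE vU' vK /= => /(_ isT); rewrite -leNgt => h.
    have : (k%:R <= #|[set e in eset G | (v \in e) && [disjoint e & U']]|%:R :> R)%R by apply: le_trans h.
    rewrite ler_nat => {}h; apply: leq_trans h _; rewrite degree_induced.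
    apply/subset_leq_card/subsetP => e; rewrite !inE disjoints_subset => /and3P[-> -> eU].
    by rewrite (subset_trans eU) // subsetUl.
  have ZK : ~: U' \subset vset K.
    by move: sZ => /andP[]; rewrite {1}/vset /= subUset => /andP[].
  have /set0Pn[v vUU] : U :\: U' != set0.
    by rewrite -card_gt0 cardsDS // subn_gt0 cU'.
  have := nv v vUU; rewrite -leNgt => h.
  have vU' : v \notin U' by move: vUU; rewrite inE => /andP[].
  have vK : v \in vset K by apply: (subsetP ZK); rewrite inE.
  have : ((degree K v)%:R < x)%R.
    by move: vUU; rewrite !inE vK vU' /=.
  apply/negP; rewrite -leNgt; apply: (le_trans h); rewrite ler_nat /degree (kcore_eset hK).
  apply/subset_leq_card/subsetP => e; rewrite !inE disjoints_subset => /and3P[-> -> eU].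
  by rewrite (subset_trans eU).
exists (v |: U').
  move: vU; rewrite inE => /andP[vU' vU]; rewrite cardsU1 vU' cU' subUset sub1set vU sU'.
  by [].
have -> : (j.+1%:R * x = j%:R * x + x :> R)%R by rewrite -natr1 mulrDl mul1r.
apply: le_trans (lerD hU' (ltW vx)); rewrite -natrD ler_nat.
apply: leq_trans (leq_of_leqif (leq_card_setU _ _)); apply/subset_leq_card/subsetP => e.
rewrite !inE => /andP[eG]; rewrite eG /=; case: (boolP [disjoint e & U']) => //= dis h.
apply: contraR h; rewrite andbT => ve; rewrite disjoint_sym disjoints_subset subUset sub1set inE ve.
by rewrite -disjoints_subset disjoint_sym.
Qed.

End GraphDegrees.

(** * Choice of constants *)

(* [gm * n] bounds the core from below, expansion is required up to [sg * n] vertices, and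
   [eta], [eta0] are the errors (in units of [p * n ^ 2]) of the edge counts. Guessed subgraphs have
   at most [delta * p * n ^ 2] edges: they are built by keeping edges with probability [qq] and
   about [d3 * p * n] edges per vertex, which make sets of at most [sg0 * n] vertices expand. *)
Record resilience_constants (R : realType) (eps : R) := ResilienceConstants {
  gm : R; sg : R; eta : R; zt : R; delta : R; qq : R; d3 : R; sg0 : R; eta0 : R; D0 : R;
  rc_eps : (0 < eps <= 1/4)%R;
  rc_gm : (gm * (30 * 40) = 1)%R;
  rc_sg : (0 < sg /\ 80 * sg <= eps * gm)%R;
  rc_eta : (100 * eta = eps * gm * sg)%R;
  rc_eta1 : (0 < eta <= 1/2)%R;
  rc_delta : (0 < delta <= eta / 4)%R;
  rc_zt : (0 < zt <= 1)%R;
  rc_key : (zt + delta * ln zt^-1 <= eta ^+ 2 / 16)%R;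
  rc_q : (0 < qq <= 1)%R;
  rc_qd : (24 * qq <= delta)%R;
  rc_d3 : (0 < d3 <= 1/(20*20))%R;
  rc_d3d : (16 * d3 <= delta)%R;
  rc_sg0 : (sg0 = (d3 / 36) ^+ 2 / 36)%R;
  rc_eta0 : (0 < eta0 <= eta)%R;
  rc_eta0s : (eta0 <= sg0 * gm / 24)%R;
  rc_D0 : (12 <= D0)%R;
  rc_D : (forall D : R, D0 <= D ->
    [/\ 4 <= delta * D, 24 <= qq * sg0 * gm * D & 42 * 18 <= d3 * D] /\
    [/\ expR (- (qq * (eta * D / 2))) <= gm * eps / 20, 4 * D ^+ 2 <= expR (D / 30),
        6 * 16 <= eta ^+ 2 * D & 6 * 16 <= eta0 ^+ 2 * D])%R
}.

(** Each constant is small relative to the earlier ones it depends on; [D0] comes last, as a maximum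
    over all the conditions on [D]. *)
Lemma exists_resilience_constants (R : realType) (eps : R) :
  (0 < eps <= 1/4)%R -> inhabited (resilience_constants eps).
Proof.
move=> e01; have /andP[e0 e1] := e01.
(* Sets of at most n / 1200 vertices are unlikely to have density k / 2 when D < 100 k; see
   [Pr_dense_core]. *)
pose gm : R := ((30 * 40)^-1)%R.
have gm0 : (0 < gm)%R by rewrite invr_gt0 mulr_gt0.
have gmE : (gm * (30 * 40) = 1)%R by rewrite mulVf // mulf_neq0.
have gm1 : (gm <= 1)%R by move: gmE gm0; lra.
pose sg := (eps * gm / 80)%R.
have sg_gt0 : (0 < sg)%R by rewrite divr_gt0 ?mulr_gt0.
have eg1 : (eps * gm <= 1/4)%R by rewrite -[leRHS]mulr1 ler_pM // ltW.
have sg1 : (sg <= 1)%R by rewrite /sg; lra.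
pose eta := (eps * gm * sg / 100)%R.
have eta_gt0 : (0 < eta)%R by rewrite divr_gt0 ?mulr_gt0.
have eta1 : (eta <= 1/2)%R.
  have : (eps * gm * sg <= 1 / 4 * 1)%R by rewrite ler_pM // ?mulr_ge0 // ltW.
  rewrite /eta; lra.
(* With delta ln(1 / zt) <= zt the guess costs at most 2 zt = eta^2 / 32, well below the gain eta^2
   / 8. *)
pose zt := (eta ^+ 2 / 64)%R.
have zt0 : (0 < zt)%R by rewrite divr_gt0 ?exprn_gt0.
have eta2 : (eta ^+ 2 <= 1)%R by rewrite exprn_ile1 // ?ltW //; lra.
have zt1 : (zt < 1)%R by rewrite /zt; lra.
have lnz : (0 < ln zt^-1)%R by rewrite ln_gt0 // invf_gt1.
pose delta := (Num.min (eta / 4) (zt / ln zt^-1))%R.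
have delta0 : (0 < delta)%R by rewrite lt_min; apply/andP; split; rewrite divr_gt0.
have delta1 : (delta <= eta / 4)%R by rewrite ge_min lexx.
have delta2 : (delta * ln zt^-1 <= zt)%R.
  by rewrite -ler_pdivlMr // ge_min lexx orbT.
pose qq := (delta / 24)%R.
have qq0 : (0 < qq)%R by rewrite divr_gt0.
pose d3 := (Num.min (delta / 16) (1/(20*20)))%R.
have d30 : (0 < d3)%R by rewrite lt_min; apply/andP; split; rewrite divr_gt0 // mulr_gt0.
have d31 : (d3 <= 1/(20*20))%R by rewrite ge_min lexx orbT.
have d32 : (d3 <= delta / 16)%R by rewrite ge_min lexx.
(* Chosen so that (36 / d3) s / n equals d3 / 144 at s = 9 sg0 n, as [Pr_dense_small] requires. *)
pose sg0 := ((d3 / 36) ^+ 2 / 36)%R.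
have sg00 : (0 < sg0)%R by rewrite divr_gt0 // exprn_gt0 // divr_gt0.
pose eta0 := (Num.min eta (sg0 * gm / 24))%R.
have eta00 : (0 < eta0)%R by rewrite lt_min eta_gt0 divr_gt0 // mulr_gt0.
have eta01 : (eta0 <= eta)%R by rewrite ge_min lexx.
have eta02 : (eta0 <= sg0 * gm / 24)%R by rewrite ge_min lexx orbT.
have c1 : (0 < qq * sg0 * gm)%R by rewrite !mulr_gt0.
have c2 : (0 < qq * eta / 2)%R by rewrite divr_gt0 // mulr_gt0.
have c3 : (0 < eta ^+ 2)%R by rewrite exprn_gt0.
have c4 : (0 < eta0 ^+ 2)%R by rewrite exprn_gt0.
have c5 : (0 < gm * eps / 20)%R by rewrite divr_gt0 // mulr_gt0.
pose mx (x y : R) := Num.max x y.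
pose D0 := mx 12%R (mx (4 / delta) (mx (24 / (qq * sg0 * gm)) (mx (42 * 18 / d3)
   (mx ((gm * eps / 20)^-1 / (qq * eta / 2)) (mx (24 * 30 ^+ 3) (mx (6 * 16 / eta ^+ 2)
   (6 * 16 / eta0 ^+ 2)))))))%R.
apply: inhabits; apply: (@ResilienceConstants R eps gm sg eta zt delta qq d3 sg0 eta0 D0) => //.
- by split=> //; rewrite /sg; lra.
- by rewrite /eta; field.
- by rewrite eta_gt0.
- by rewrite delta0.
- by rewrite zt0 ltW.
- by apply: le_trans (lerD (lexx _) delta2) _; rewrite /zt; lra.
- by rewrite qq0 /qq; move: delta1 eta1; lra.
- by rewrite /qq; lra.
- by rewrite d30.
- by move: d32; lra.
- by rewrite eta00.
- by rewrite le_max lexx.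
move=> D hD.
have [h1 [h2 [h3 [h4 [h5 [h6 [h7 h8]]]]]]] : (12 <= D /\ 4 / delta <= D /\ 24 / (qq * sg0 * gm) <= D /\
  42 * 18 / d3 <= D /\ (gm * eps / 20)^-1 / (qq * eta / 2) <= D /\ 24 * 30 ^+ 3 <= D /\
  6 * 16 / eta ^+ 2 <= D /\ 6 * 16 / eta0 ^+ 2 <= D)%R.
  by move: hD; rewrite /D0 /mx !ge_max => /and5P[-> -> -> -> /and4P[-> -> -> ->]].
have Dp : (0 < D)%R by apply: lt_le_trans h1.
split; split.
- by move: h2; rewrite ler_pdivrMr // [(D * _)%R]mulrC.
- by move: h3; rewrite ler_pdivrMr // [(D * _)%R]mulrC.
- by move: h4; rewrite ler_pdivrMr // [(D * _)%R]mulrC.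
- rewrite expRN -[leRHS]invrK lef_pV2 ?posrE ?expR_gt0 ?invr_gt0 //.
  move: h5; rewrite ler_pdivrMr // => h5; apply: (le_trans h5).
  apply: le_trans (expR_ge1Dx _); lra.
(* The bound exp x >= x^3 / 6 at x = D / 30 beats 4 D^2 once D >= 24 * 30^3. *)
- apply: le_trans (_ : (D / 30) ^+ 3 / 6 <= _)%R.
    rewrite ler_pdivlMr // expr_div_n ler_pdivlMr ?exprn_gt0 //.
    have -> : (4 * D ^+ 2 * 6 * 30 ^+ 3 = (24 * 30 ^+ 3) * D ^+ 2 :> R)%R by ring.
    have -> : (D ^+ 3 = D * D ^+ 2)%R by rewrite exprS.
    by rewrite ler_wpM2r // exprn_ge0 // ltW.
  have D30 : (0 <= D / 30)%R by rewrite divr_ge0 // ltW.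
  by have := @expR_ge1Dxn R _ 2 D30; rewrite (_ : 3`! = 6)%N //; lra.
- by move: h7; rewrite ler_pdivrMr // [(D * _)%R]mulrC.
- by move: h8; rewrite ler_pdivrMr // [(D * _)%R]mulrC.
Qed.

Lemma trunc_bounds (R : realType) (x : R) : (0 <= x -> (Num.trunc x)%:R <= x /\ x < (Num.trunc x).+1%:R)%R.
Proof. by move=> x0; have /andP[] := truncn_itv x0. Qed.

(** * The bad event, and resilience of the core outside it *)

Section BadEvent.
Local Open Scope ring_scope.
Variables (R : realType) (eps : R) (C : resilience_constants eps) (T : finType) (k : nat) (p : R).
Implicit Type E : {set {set T}}.
Notation n := #|T|.
Notation B := (p * n%:R ^+ 2 : R).
Notation D := (p * n%:R : R).

Definition a0_of : nat := Num.trunc (sg0 C * n%:R).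
(** Just above n / D^2: if that many vertices were outside the core or of low degree, [kcore_peel]
    would produce a set refuting the sparse cover condition. *)
Definition m_of : nat := (Num.trunc (n%:R / D ^+ 2)).+1.

Definition not_pseudorandom E : bool :=
  [|| family_high p (@fam_up T) (eta0 C) E,
      sparse_guess_low p (@fam_stars T) (0 * B) (eta0 C) E,
      sparse_guess_low p (@fam_rotations T) (delta C * B) (eta C) E,
      sparse_guess_low p (@fam_closing T) (delta C * B) (eta C) E,
      dense_subset (d3 C * D / 18) (fun s => s <= 9 * a0_of)%N E |
      dense_subset (d3 C * k%:R / 60) (fun s => s%:R * D ^+ 2 <= 5 * n%:R) E].

(* If [D < k / 6], being good forces the k-core to be empty; otherwise the last event controls
   the size of the core and its number of vertices of low degree. *)
Definition bad E : bool :=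
  if D < k%:R / 6 then dense_subset (k%:R / 2 : R) predT E else
  not_pseudorandom E ||
  (if D < 100 * k%:R then dense_subset (k%:R / 2 : R) (fun s => 30 * (40 * s) <= n)%N E
   else sparse_cover m_of (m_of%:R * D / 100) E).

Hypothesis kD : 6 * D0 C <= k%:R.
Hypothesis n_sg : 2 <= sg C * n%:R.
Hypothesis n_eps : 10 <= eps * (gm C * n%:R).

Let e0 : 0 < eps. Proof. by case/andP: (rc_eps C). Qed.
Let e1 : eps <= 1/4. Proof. by case/andP: (rc_eps C). Qed.
Let gm_gt0 : 0 < gm C.
Proof. by have := rc_gm C; case: (ltP 0 (gm C)) => // h; move: h; lra. Qed.
Let n_gt0 : (0 < n)%N.
Proof. by rewrite lt0n; apply: contraTneq n_sg => ->; rewrite mulr0 -ltNge. Qed.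
Let nr : 0 < n%:R :> R. Proof. by rewrite ltr0n. Qed.
Let sg_gt0 : 0 < sg C. Proof. by case: (rc_sg C). Qed.
Let sg00 : 0 < sg0 C.
Proof. by rewrite (rc_sg0 C) divr_gt0 // exprn_gt0 // divr_gt0 //; case/andP: (rc_d3 C). Qed.

Theorem kcore_resilient (G K : graph T) : 0 <= p -> p <= 1 -> vset G = setT ->
  ~~ bad (eset G) -> is_kcore k G K -> vset K != set0 ->
  resiliently_hamiltonian (1 / 2 - eps) K.
Proof.
move=> p0 p1 GT nbad hK K0.
have D_ge0 : 0 <= D by rewrite mulr_ge0.
have K1 : (0 < #|vset K|)%N by rewrite card_gt0.
have dense2 : k%:R / 2 * #|vset K|%:R <= #|edges_in (eset G) (vset K)|%:R :> R.
  have := kcore_dense hK; rewrite -(ler_nat R) !natrM; lra.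
move: nbad; rewrite /bad; case: ltP => hDk.
  rewrite negb_exists => /forallP/(_ (vset K)); rewrite K0 /= -ltNge.
  by move=> h; have := lt_le_trans h dense2; rewrite ltxx.
rewrite negb_or => /andP[psr hsize].
have hD : D0 C <= D by move: kD hDk; lra.
have D12 : 12 <= D by apply: le_trans hD; apply: rc_D0.
have [[cD1 cD2 cD3] [cD4 cD5 cD6 cD7]] := rc_D hD.
have p_gt0 : 0 < p.
  rewrite lt_neqAle p0 andbT; apply: contraTneq D12 => <-; by rewrite mul0r -ltNge.
have hk v : v \in vset K -> (k <= dgK (eset G) (vset K) v)%N.
  have [_ hd _] := hK; move=> vK; have := hd v vK; rewrite degree_deg_in // (kcore_eset hK).
  move=> h; apply: leq_trans h _; apply/subset_leq_card/subsetP=> u.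
  by rewrite !inE /adjE inE => /andP[-> /andP[-> _]].
have dgKE v : v \in vset K -> dgK (eset G) (vset K) v = degree K v.
  move=> vK; rewrite degree_deg_in // (kcore_eset hK); apply: eq_card => u.
  by rewrite !inE /adjE inE subUset !sub1set vK; case: (u \in vset K); rewrite ?andbT ?andbF.
(* If D < 100 k, no core vertex has degree below D / 100, and the core is large because small sets
   are not dense. If D >= 100 k, peeling bounds both the complement and the low-degree vertices. *)
have [hL nK] : #|[set v in vset K | (dgK (eset G) (vset K) v)%:R < D / 100]|%:R * D ^+ 2 <= n%:R /\
    gm C * n%:R <= #|vset K|%:R.
  move: hsize; case: ltP => hDk2 hsize.
    split.
      rewrite (_ : [set _ in _ | _] = set0) ?cards0 ?mul0r //.
      apply/setP=> v; rewrite !inE; apply/negbTE/negP => /andP[vK].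
      have : k%:R <= (dgK (eset G) (vset K) v)%:R :> R by rewrite ler_nat hk.
      by move: hDk2; lra.
    move: hsize; rewrite negb_exists => /forallP/(_ (vset K)); rewrite K0 /=.
    rewrite negb_and -ltnNge -ltNge => /orP[|h]; last by have := lt_le_trans h dense2; rewrite ltxx.
    move=> /ltnW; rewrite -(ler_nat R) !natrM => h.
    have := ler_wpM2l (ltW gm_gt0) h; have := rc_gm C; move: (gm C) #|vset K|%:R => g x h1 h2.
    have h3 : x = g * (30 * 40) * x by rewrite h1 mul1r.
    by rewrite [leRHS]h3; move: h2; lra.
  pose U := ~: vset K :|: [set v in vset K | (degree K v)%:R < D / 100].
  have cU : (#|U| < m_of)%N.
    rewrite ltnNge; apply/negP => mU.
    have kx : k%:R <= D / 100 by move: hDk2; lra.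
    have [U' [cU' _] hU'] := kcore_peel hK GT kx mU.
    move: hsize; rewrite negb_exists => /forallP/(_ U'); rewrite cU' eqxx /= -ltNge.
    by rewrite -mulrA => h; have := lt_le_trans h hU'; rewrite ltxx.
  have D2 : 0 < D ^+ 2 by rewrite exprn_gt0 //; move: D12; lra.
  have cUr : #|U|%:R * D ^+ 2 <= n%:R.
    rewrite -ler_pdivlMr //; have [h _] := @trunc_bounds R (n%:R / D ^+ 2) (divr_ge0 (ltW nr) (ltW D2)).
    by apply: le_trans h; rewrite ler_nat -ltnS.
  split.
    apply: le_trans cUr; rewrite ler_wpM2r ?(ltW D2) // ler_nat.
    apply/subset_leq_card/subsetP=> v; rewrite !inE => /andP[vK]; rewrite dgKE // vK /= => ->.
    by [].
  have cK : n%:R - #|U|%:R <= #|vset K|%:R :> R.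
    have : (n <= #|U| + #|vset K|)%N.
      rewrite -(cardsC (vset K)) addnC leq_add2r; exact/subset_leq_card/subsetUl.
    by rewrite -(ler_nat R) natrD; lra.
  have D22 : 2 <= D ^+ 2.
    rewrite expr2; have : 12 * 12 <= D * D by apply: ler_pM.
    lra.
  have u0 : 0 <= #|U|%:R :> R by [].
  have := ler_wpM2l u0 D22; have := rc_gm C => gE h.
  have gn : gm C * n%:R <= n%:R / 2.
    have : gm C <= 1/2 by move: gE gm_gt0; lra.
    move=> g2; have := ler_wpM2r (ltW nr) g2; lra.
  by move: cK cUr h gn; lra.
move: psr; rewrite /not_pseudorandom !negb_or mul0r => /and5P[Eup Elow Erot Eclo /andP[nd1 nd2]].
move=> H HK hH.
set E := eset G in Eup Elow Erot Eclo nd1 nd2 hk dgKE hL.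
set W := vset K in hk dgKE hL nK.
pose F := eset K :\: eset H.
have sE : E \subset pairs T by apply: eset_sub_pairs.
have KE : eset K = edges_in E W by apply: kcore_eset hK.
have sFE : F \subset E.
  by apply/subsetP=> e; rewrite inE KE inE => /andP[_ /andP[]].
have FK e : e \in F -> e \subset W by rewrite inE KE inE => /andP[_ /andP[]].
have res v : v \in W -> (dgH E F W v)%:R <= (1/2 - eps) * (dgK E W v)%:R.
  move=> vW; rewrite dgKE //; apply: le_trans (hH v vW); rewrite ler_nat.
  rewrite /dgH /degree -(@card_in_imset _ _ (fun u => [set v; u])).
    apply/subset_leq_card/subsetP=> e /imsetP[u]; rewrite inE => /and3P[uW vu nF] ->.
    rewrite !inE eqxx /= andbT; move: nF; rewrite /adjE /F inE KE inE negb_and negbK.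
    by move: vu; rewrite /adjE => ->; rewrite subUset !sub1set vW uW orbF.
  move=> x y; rewrite !inE => /and3P[_ vx _] /and3P[_ vy _]; apply: set2_inj.
    exact: (adjE_neq sE vx).
  exact: (adjE_neq sE vy).
have /andP[d30 d31] := rc_d3 C; have d3d := rc_d3d C; have qd := rc_qd C.
have /andP[q0 q1] := rc_q C.
pose l := (Num.trunc (d3 C * D)).+1.
have [l1 l2] := @trunc_bounds R (d3 C * D) (mulr_ge0 (ltW d30) D_ge0).
have l3 : l%:R <= 2 * (d3 C * D) by rewrite /l -natr1; move: l1 cD3; lra.
have dD400 : d3 C * D <= 1/(20*20) * D by rewrite ler_wpM2r.
have [] := @expand_small R T p eps E F W p_gt0 e0 e1 sE sFE FK res k l a0_of (d3 C) _ (ltW l2).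
- by rewrite d30; move: d31; lra.
- by move: l3 dD400; lra.
- by move: hDk; lra.
- exact: hk.
- exact: hL.
- exact: nd1.
- exact: nd2.
move=> G0 G0F [G0n G0exp].
pose a := Num.trunc (sg C * n%:R).
have [a1 a2] := @trunc_bounds R (sg C * n%:R) (mulr_ge0 (ltW sg_gt0) (ltW nr)).
have [_ sg80] := rc_sg C.
have a16 : 16 * a%:R <= #|W|%:R :> R.
  have h := ler_wpM2r (ltW nr) sg80.
  have h2 : eps * gm C * n%:R <= 1/4 * (gm C * n%:R) by rewrite -mulrA ler_wpM2r // mulr_ge0 // ltW.
  have h3 : 0 <= gm C * n%:R by rewrite mulr_ge0 // ltW.
  by move: a1 nK; rewrite /a; lra.
have /andP[eta00 eta01] := rc_eta0 C; have /andP[eta_0 eta_1] := rc_eta1 C.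
have eta02 : eta0 C <= 1/2 by move: eta01 eta_1; lra.
have [S1 S1F [S1B S1exp]] := @expand_large R T p eps (eta0 C) E F W p_gt0 e0 e1 sE sFE res Eup Elow
   (qq C) (sg0 C) (gm C) a (rc_q C) sg00 eta00 eta02 (rc_eta0s C) n_gt0 gm_gt0 nK a16 cD2.
have [b1 b2] := @trunc_bounds R (sg0 C * n%:R) (mulr_ge0 (ltW sg00) (ltW nr)).
have BE : B = D * n%:R by rewrite expr2 mulrA.
have [] := @resilient_cycle R T p eps (eta C) (eta0 C) (sg C) (gm C) (delta C) (qq C) a E F (G0 :|: S1) W
  p_gt0 e0 e1 sE sFE FK res Eup Elow Erot Eclo n_gt0 gm_gt0 nK sg_gt0 sg80 (ltW a2).
- by rewrite -natr1; move: a1 n_sg; rewrite /a; lra.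
- exact: rc_eta.
- exact: eta00.
- exact: eta01.
- exact: eta02.
- by apply: le_trans n_eps _; rewrite ler_wpM2l // ltW.
- by rewrite -(ltr_nat R); apply: le_lt_trans n_sg a2.
- by rewrite subUset G0F.
(* The two ranges of expansion meet at [a0_of], the integer part of sg0 n. *)
- move=> A AW /andP[A0 Aa]; have [h|h] := leqP #|A| a0_of.
    apply: leq_trans (G0exp A AW _) _; first by rewrite A0.
    exact/subset_leq_card/closed_nbhS/subsetUl.
  apply: leq_trans (S1exp A AW _ Aa) _; last exact/subset_leq_card/closed_nbhS/subsetUr.
  by apply: le_trans (ltW b2) _; rewrite ler_nat.
- exact: rc_q.
(* Budget in units of delta B: at most 1/8 for [G0], 1/8 for [S1], 1/4 for the path and 1/8 for the
   later random subset. *)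
- have h1 : #|G0 :|: S1|%:R <= n%:R * l%:R + 3 * qq C * B.
    apply: le_trans (_ : #|G0|%:R + #|S1|%:R <= _).
      by rewrite -natrD ler_nat leq_card_setU.
    by rewrite lerD // -natrM ler_nat.
  have h2 := ler_wpM2l (ltW nr) l3.
  have h3 := ler_wpM2r (ltW nr) cD1.
  have B0 : 0 <= B by rewrite BE mulr_ge0.
  have h4 := ler_wpM2r B0 qd; have h5 := ler_wpM2r B0 d3d.
  have h6 : 0 <= delta C * B by rewrite mulr_ge0 //; case/andP: (rc_delta C) => /ltW.
  by move: h1 h2 h3 h4 h5 h6; rewrite !BE; lra.
- exact: cD4.
move=> c [c1 c2 c3]; exists c; split=> //.
Qed.

End BadEvent.

Lemma Pr_or_le (R : realType) (I : finType) (U : {set I}) (p a b : R) (P Q : pred {set I}) :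
  (0 <= p <= 1)%R -> (Pr p U P <= a)%R -> (Pr p U Q <= b)%R ->
  (Pr p U (fun E => P E || Q E) <= a + b)%R.
Proof. by move=> p01 hP hQ; apply: le_trans (Pr_or _ p01 _ _) (lerD hP hQ). Qed.

(** * Probability of the bad event *)

Section PrBad.
Local Open Scope ring_scope.
Variables (R : realType) (eps : R) (C : resilience_constants eps) (T : finType) (k : nat) (p : R).
Implicit Type E : {set {set T}}.
Notation n := #|T|.
Notation B := (p * n%:R ^+ 2 : R).
Notation D := (p * n%:R : R).
Notation badE := (@bad R eps C T k p).
Notation nprE := (@not_pseudorandom R eps C T k p).
Notation a0c := (a0_of C T).
Notation mc := (m_of T p).
Hypothesis n_sg : 2 <= sg C * n%:R.
Hypothesis n_eps : 10 <= eps * (gm C * n%:R).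
Hypothesis p01 : 0 <= p <= 1.

Lemma expR_ge_pow (x : R) m : 0 <= x -> (x / m.+1%:R) ^+ m.+1 <= expR x.
Proof.
move=> x0; have -> : expR x = expR (x / m.+1%:R) ^+ m.+1.
  by rewrite -expRM_natl mulrCA mulfV ?mulr1 // pnatr_eq0.
have h : 0 <= x / m.+1%:R by rewrite divr_ge0.
rewrite lerXn2r ?nnegrE ?expR_ge0 //.
by apply: le_trans (expR_ge1Dx _); rewrite lerDr.
Qed.

Lemma card_set_type : #|{set T}| = (2 ^ n)%N.
Proof. by rewrite -[LHS]cardsT -powersetT card_powerset cardsT. Qed.

(** The largest index family has five coordinates of at most 2^n values each. An exponent of -6 n
    beats 2^(5 n) and leaves exp(-n) <= (9 / n)^9. *)
Lemma small_exponential (c9 c J X : R) : c9 = 9 -> (0 < n)%N ->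
  c * n%:R <= - (6 * n%:R) -> 0 <= J -> J <= (2 ^ (5 * n))%:R -> X <= J * expR (c * n%:R) ->
  X <= c9 ^+ 9 / n%:R ^+ 9.
Proof.
move=> c9E n0 hc J0 hJ hX; apply: (le_trans hX).
have nr : 0 < n%:R :> R by rewrite ltr0n.
have e2 : 2 <= expR 1 :> R by have := @expR_ge1Dx R 1; lra.
have h5 : (2 ^ (5 * n))%:R <= expR (5 * n%:R) :> R.
  rewrite natrX -natrM -[X in expR X]mulr1 expRM_natl lerXn2r ?nnegrE ?expR_ge0 //.
apply: le_trans (_ : expR (5 * n%:R) * expR (- (6 * n%:R)) <= _).
  by apply: ler_pM; rewrite ?expR_ge0 ?ler_expR //; apply: le_trans h5.
rewrite -expRD (_ : 5 * n%:R - 6 * n%:R = - n%:R); last by ring.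
have c90 : 0 < c9 by rewrite c9E.
rewrite expRN -[leRHS]invrK lef_pV2 ?posrE ?expR_gt0 ?invr_gt0 ?divr_gt0 ?exprn_gt0 //.
rewrite invf_div -expr_div_n c9E; exact: (expR_ge_pow 8 (ltW nr)).
Qed.

Let e0 : 0 < eps. Proof. by case/andP: (rc_eps C). Qed.
Let e1 : eps <= 1/4. Proof. by case/andP: (rc_eps C). Qed.
Let gm_gt0 : 0 < gm C.
Proof. by have := rc_gm C; case: (ltP 0 (gm C)) => // h; move: h; lra. Qed.
Let n_gt0 : (0 < n)%N.
Proof. by rewrite lt0n; apply: contraTneq n_sg => ->; rewrite mulr0 -ltNge. Qed.
Let nr : 0 < n%:R :> R. Proof. by rewrite ltr0n. Qed.
Let sg_gt0 : 0 < sg C. Proof. by case: (rc_sg C). Qed.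
Let sg00 : 0 < sg0 C.
Proof. by rewrite (rc_sg0 C) divr_gt0 // exprn_gt0 // divr_gt0 //; case/andP: (rc_d3 C). Qed.

Let D_ge0 : 0 <= D. Proof. by case/andP: p01 => p0 _; rewrite mulr_ge0. Qed.
Let rho s : 0 <= s%:R / n%:R :> R. Proof. by rewrite divr_ge0. Qed.
Let sp s : s%:R * p = s%:R / n%:R * D. Proof. by field; rewrite gt_eqF. Qed.
Let BE (x : R) : B * x = D * x * n%:R. Proof. by rewrite expr2; ring. Qed.

Lemma dense_bound_eq (A : R) : n%:R * (A / n%:R) ^+ 10 = A ^+ 10 / n%:R ^+ 9.
Proof.
rewrite expr_div_n [n%:R ^+ 10]exprS; have h : n%:R ^+ 9 != 0 :> R by rewrite expf_neq0 // gt_eqF.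
have h2 : n%:R != 0 :> R by rewrite gt_eqF.
by move: h; move: (n%:R ^+ 9) (A ^+ 10) => u v h; field; rewrite h h2.
Qed.

Lemma half_pow10 (A : R) : 0 <= A <= 1 -> 4 * A * (1/2) ^+ 10 <= 1.
Proof. by case/andP=> A0 A1; rewrite !exprS expr0; lra. Qed.

(** [Pr_dense] with A = b = 1/2 covers all sizes: below k / 6 the quantity to square is at most 2 r
    / 3, and (2 r / 3)^2 <= r / 2 for r <= 1. *)
Lemma Pr_dense_subcritical (c2 : R) : c2 = 1/2 -> 84 <= k%:R :> R -> D < k%:R / 6 ->
  Pr p (pairs T) (dense_subset (k%:R / 2 : R) predT) <= c2 ^+ 10 / n%:R ^+ 9.
Proof.
move=> c2E k84 hDk.
have c20 : 0 < c2 by rewrite c2E; lra.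
have k0 : 0 < k%:R :> R by move: k84; lra.
have rho1 s : (s <= n)%N -> s%:R / n%:R <= 1 :> R by move=> h; rewrite ler_pdivrMr // mul1r ler_nat.
have h42 : 42 <= k%:R / 2 :> R by move: k84; lra.
rewrite -dense_bound_eq; apply: (Pr_dense p01 (b := 1/2)) h42 _ _ _ _ => //.
  by rewrite c2E; apply: half_pow10; rewrite divr_ge0 //=; lra.
move=> s /andP[s0 sn] _; have r0 := rho s; have r1 := rho1 s sn.
rewrite c2E -[1/2 * _ / _]mulrA; move: r0 r1 (sp s); set r := s%:R / n%:R => r0 r1 spE.
have -> : 2 * s%:R * p / (k%:R / 2) = 4 * (r * D) / k%:R by rewrite -spE; field; rewrite gt_eqF.
have w1 : 4 * (r * D) / k%:R <= 2/3 * r.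
  rewrite ler_pdivrMr //; have := ler_wpM2l r0 (ltW hDk); lra.
have w0 : 0 <= 4 * (r * D) / k%:R by rewrite divr_ge0 ?(ltW k0) // mulr_ge0 // mulr_ge0.
have w2 := ler_pM w0 w0 w1 w1; have r2 := ler_wpM2l r0 r1.
by rewrite expr2; move: w2 r2 r1; lra.
Qed.

Section LargeDegree.
Variable c9 : R.
Hypothesis c9E : c9 = 9.
Hypothesis hD : D0 C <= D.

Let D12 : 12 <= D. Proof. by apply: le_trans hD; apply: rc_D0. Qed.
Let D2 : 12 * 12 <= D ^+ 2. Proof. by rewrite expr2; apply: ler_pM. Qed.
Let c90 : 0 < c9. Proof. by rewrite c9E. Qed.
Let eta0_gt0 : 0 < eta0 C. Proof. by case/andP: (rc_eta0 C). Qed.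
Let eta_gt0 : 0 < eta C. Proof. by case/andP: (rc_eta1 C). Qed.
Let eta_le1 : eta C <= 1. Proof. by case/andP: (rc_eta1 C) => _; lra. Qed.
Let eta0_le1 : eta0 C <= 1. Proof. by case/andP: (rc_eta0 C) => _ /le_trans; apply. Qed.
Let cJ2 : (#|{: {set T} * {set T}}| <= 2 ^ (5 * n))%N.
Proof. by rewrite card_prod card_set_type -expnD leq_exp2l // addnn -mul2n leq_mul2r orbT. Qed.

Lemma Pr_fam_up : Pr p (pairs T) (family_high p (@fam_up T) (eta0 C)) <= c9 ^+ 9 / n%:R ^+ 9.
Proof.
have [_ [_ _ _ cD7]] := rc_D hD.
apply: (@small_exponential c9 (D * (- (eta0 C ^+ 2 / 8))) #|{: bool * {set T} * {set T}}|%:R) => //.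
- by rewrite -[leRHS]mulNr ler_wpM2r //; move: cD7; lra.
- rewrite ler_nat !card_prod card_bool card_set_type -expnS -expnD leq_exp2l //; move: n_gt0; clear; lia.
- rewrite -BE mulrN mulrA; apply: Pr_family_high => //; exact: fam_up_pairs.
Qed.

Lemma Pr_fam_stars :
  Pr p (pairs T) (sparse_guess_low p (@fam_stars T) (0 * B) (eta0 C)) <= c9 ^+ 9 / n%:R ^+ 9.
Proof.
have [_ [_ _ _ cD7]] := rc_D hD.
have z0 : 0 < eta0 C ^+ 2 / 16 by rewrite divr_gt0 // exprn_gt0.
have z1 : eta0 C ^+ 2 / 16 <= 1.
  have : eta0 C ^+ 2 <= 1 by rewrite exprn_ile1 // ?(ltW eta0_gt0) //; move: eta0_le1; lra.
  lra.
apply: (@small_exponential c9 (D * (eta0 C ^+ 2 / 16 + 0 * ln (eta0 C ^+ 2 / 16)^-1 - eta0 C ^+ 2 / 8))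
   #|{: {set T} * {set T}}|%:R) => //.
- by rewrite -[leRHS]mulNr ler_wpM2r // mul0r; move: cD7; lra.
- by rewrite ler_nat.
- rewrite -BE; apply: Pr_sparse_guess_low => //.
  + by move=> S i; apply: stars_pairs.
  + by rewrite divr_ge0 // ltW.
Qed.

Let key : D * (zt C + delta C * ln (zt C)^-1 - eta C ^+ 2 / 8) * n%:R <= - (6 * n%:R).
Proof.
have [_ [_ _ cD6 _]] := rc_D hD.
rewrite -[leRHS]mulNr ler_wpM2r //; have h := ler_wpM2l D_ge0 (rc_key C); move: h cD6; lra.
Qed.

Lemma Pr_fam_rotations :
  Pr p (pairs T) (sparse_guess_low p (@fam_rotations T) (delta C * B) (eta C)) <= c9 ^+ 9 / n%:R ^+ 9.
Proof.
have /andP[zt0 zt1] := rc_zt C; have /andP[de0 de1] := rc_delta C.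
apply: (small_exponential c9E n_gt0 key (ler0n R #|{: T * {set T} * {set T} * {set T} * {set T}}|)).
- rewrite ler_nat !card_prod !card_set_type.
  apply: leq_trans (_ : 2 ^ n * 2 ^ n * 2 ^ n * 2 ^ n * 2 ^ n <= _)%N.
    by rewrite !leq_mul2r (ltnW (ltn_expl _ _)) ?orbT.
  by rewrite -!expnD leq_exp2l //; clear; lia.
- rewrite -BE; apply: Pr_sparse_guess_low => //; try exact: ltW.
    by move=> S [[[[s A] Y] V] K]; apply: stars_pairs.
Qed.

Lemma Pr_fam_closing :
  Pr p (pairs T) (sparse_guess_low p (@fam_closing T) (delta C * B) (eta C)) <= c9 ^+ 9 / n%:R ^+ 9.
Proof.
have /andP[zt0 zt1] := rc_zt C; have /andP[de0 de1] := rc_delta C.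
apply: (small_exponential c9E n_gt0 key (ler0n R #|{: {set T} * {set T}}|)).
- by rewrite ler_nat.
- rewrite -BE; apply: Pr_sparse_guess_low => //; try exact: ltW.
    by move=> S i; apply: stars_pairs.
Qed.

Lemma Pr_dense_small : Pr p (pairs T) (dense_subset (d3 C * D / 18) (fun s => s <= 9 * a0c)%N) <=
    (36 / d3 C) ^+ 10 / n%:R ^+ 9.
Proof.
have /andP[d30 d31] := rc_d3 C; have [[_ _ cD3] _] := rc_D hD.
rewrite -dense_bound_eq; apply: (Pr_dense p01 (b := d3 C / 144)).
- by move: cD3; lra.
- by rewrite divr_gt0.
- by move: d31; lra.
- have -> : 4 * (36 / d3 C) * (d3 C / 144) ^+ 10 = (d3 C / 144) ^+ 9.
    by rewrite [_ ^+ 10]exprS; move: (_ ^+ 9) => u; field; rewrite gt_eqF.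
  by rewrite exprn_ile1 // ?divr_ge0 ?(ltW d30) //; move: d31; lra.
- move=> s /andP[s0 sn] s9; have r0 := rho s.
  rewrite -[36 / d3 C * _ / _]mulrA; move: r0 (sp s); set r := s%:R / n%:R => r0 spE.
  have Dp : 0 < D by move: D12; lra.
  have -> : 2 * s%:R * p / (d3 C * D / 18) = 36 / d3 C * r.
    have -> : 2 * s%:R * p = 2 * (r * D) by rewrite -spE mulrA.
    by move: Dp; set DD := D => Dp; field; rewrite !gt_eqF.
  have rs : r <= 9 * sg0 C.
    rewrite /r ler_pdivrMr //.
    have [h _] := @trunc_bounds R (sg0 C * n%:R) (mulr_ge0 (ltW sg00) (ltW nr)).
    have : s%:R <= 9 * a0c%:R :> R by rewrite -natrM ler_nat.
    by move: h; rewrite -/a0c; lra.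
  have w1 : 36 / d3 C * r <= d3 C / 144.
    rewrite mulrAC ler_pdivrMr //; move: rs; rewrite (rc_sg0 C) expr_div_n !expr2; lra.
  have w0 : 0 <= 36 / d3 C * r by rewrite mulr_ge0 // divr_ge0 // ltW.
  rewrite w1 andbT expr2 ler_piMl //; move: w1 d31; lra.
Qed.

Lemma Pr_dense_tiny : 42 * 60 <= d3 C * k%:R ->
  Pr p (pairs T) (dense_subset (d3 C * k%:R / 60) (fun s => s%:R * D ^+ 2 <= 5 * n%:R)) <=
  1 ^+ 10 / n%:R ^+ 9.
Proof.
move=> kd3.
have h42 : 42 <= d3 C * k%:R / 60 by move: kd3; lra.
rewrite -dense_bound_eq; apply: (Pr_dense p01 (b := 1/2)) (h42) _ _ _ _ => //.
  by apply: half_pow10; rewrite ler01 lexx.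
move=> s /andP[s0 sn] sD; have r0 := rho s.
rewrite -[1 * s%:R / _]mulrA ![1 * (_ / _)]mul1r; move: r0 (sp s); set r := s%:R / n%:R => r0 spE.
have rD : r * D ^+ 2 <= 5 by rewrite /r mulrAC ler_pdivrMr.
have r2 : r * (12 * 12) <= r * D ^+ 2 by rewrite ler_wpM2l.
apply/andP; split; last by move: rD r2; lra.
set h := d3 C * k%:R / 60 in h42 *.
have hp : 0 < h by move: h42; lra.
have -> : 2 * s%:R * p / h = 2 * (r * D) / h by rewrite -spE mulrA.
have w1 : 2 * (r * D) / h <= 2 * (r * D) / 42.
  by apply: ler_wpM2l; [apply: mulr_ge0 => //; apply: mulr_ge0|rewrite lef_pV2 ?posrE].
have w0 : 0 <= 2 * (r * D) / h by rewrite divr_ge0 ?(ltW hp) // mulr_ge0 // mulr_ge0.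
have w2 := ler_pM w0 w0 w1 w1; rewrite expr2; apply: (le_trans w2).
have := ler_wpM2l r0 rD; rewrite expr2; lra.
Qed.

Lemma Pr_not_pseudorandom : 42 * 60 <= d3 C * k%:R -> Pr p (pairs T) nprE <=
  4 * (c9 ^+ 9 / n%:R ^+ 9) + (36 / d3 C) ^+ 10 / n%:R ^+ 9 + 1 ^+ 10 / n%:R ^+ 9.
Proof.
move=> kd3.
have h := Pr_or_le p01 Pr_fam_up (Pr_or_le p01 Pr_fam_stars (Pr_or_le p01 Pr_fam_rotations
  (Pr_or_le p01 Pr_fam_closing (Pr_or_le p01 Pr_dense_small (Pr_dense_tiny kd3))))).
by apply: (le_trans h); lra.
Qed.

(** [Pr_dense] with A = 300, b = 1/4: for r <= 1/1200, (400 r)^2 <= 300 r <= 1/4. *)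
Lemma Pr_dense_core (c300 : R) : c300 = 3 * (10 * 10) -> 84 <= k%:R :> R -> D < 100 * k%:R ->
  Pr p (pairs T) (dense_subset (k%:R / 2 : R) (fun s => 30 * (40 * s) <= n)%N) <=
  c300 ^+ 10 / n%:R ^+ 9.
Proof.
move=> c300E k84 hk2.
have c30 : 0 < c300 by rewrite c300E !mulr_gt0.
have k0 : 0 < k%:R :> R by move: k84; lra.
have h42 : 42 <= k%:R / 2 :> R by move: k84; lra.
rewrite -dense_bound_eq; apply: (Pr_dense p01 (b := 1/4)) h42 _ _ _ _ => //.
- by lra.
- by rewrite c300E !exprS expr0; lra.
- move=> s /andP[s0 sn] s12; have r0 := rho s.
  rewrite c300E -[3 * (10 * 10) * _ / _]mulrA; move: r0 (sp s); set r := s%:R / n%:R => r0 spE.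
  have rs : 30 * (40 * r) <= 1.
    by rewrite /r !mulrA ler_pdivrMr // mul1r -!mulrA -!natrM ler_nat.
  have -> : 2 * s%:R * p / (k%:R / 2) = 4 * (r * D) / k%:R by rewrite -spE; field; rewrite gt_eqF.
  have w1 : 4 * (r * D) / k%:R <= 4 * (r * 100).
    by rewrite ler_pdivrMr //; have := ler_wpM2l r0 (ltW hk2); lra.
  have w0 : 0 <= 4 * (r * D) / k%:R by rewrite divr_ge0 ?(ltW k0) // mulr_ge0 // mulr_ge0.
  have w2 := ler_pM w0 w0 w1 w1; have r2 := ler_wpM2l r0 rs.
  by rewrite expr2; apply/andP; split; [move: w2 r2|]; lra.
Qed.

(** Here m D is only known to be of order at least the square root of n, so the power 18 of x = m D
    / 30 is used to reach n^-9. *)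
Lemma Pr_sparse_cover_pow (c18 : R) : c18 = 18 ^+ 2 * 30 ^+ 2 ->
  Pr p (pairs T) (sparse_cover mc (mc%:R * D / 100)) <= c18 ^+ 9 / n%:R ^+ 9.
Proof.
move=> c18E; have /andP[p0 _] := p01; have c180 : 0 < c18 by rewrite c18E mulr_gt0 ?exprn_gt0.
have [_ [_ cD5 _ _]] := rc_D hD.
have D2p : 0 < D ^+ 2 by move: D2; lra.
have [m1 m2] := @trunc_bounds R (n%:R / D ^+ 2) (divr_ge0 (ltW nr) (ltW D2p)).
have nm : n%:R <= mc%:R * D ^+ 2 by rewrite -ler_pdivrMr // ltW.
have gm1 : gm C <= 1 by have := rc_gm C; move: gm_gt0; lra.
have n40 : 40 <= n%:R :> R.
  have h1 : gm C * n%:R <= n%:R by rewrite ler_piMl // ltW.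
  have h2 : eps * (gm C * n%:R) <= 1/4 * n%:R by rewrite ler_pM // ?(ltW e0) // mulr_ge0 // ltW.
  by move: n_eps h2; lra.
have m3 : (3 * mc <= n)%N.
  rewrite -(ler_nat R) natrM /m_of -natr1.
  have : n%:R / D ^+ 2 <= n%:R / 144.
    rewrite ler_wpM2l ?(ltW nr) // lef_pV2 ?posrE //; move: D2; lra.
  by move: m1 n40; lra.
apply: le_trans (Pr_sparse_cover p01 (isT : (0 < mc)%N) m3 erefl nm cD5) _.
set x := mc%:R * D / 30.
have x0 : 0 <= x by rewrite /x divr_ge0 // mulr_ge0.
have x2 : n%:R / 30 ^+ 2 <= x ^+ 2.
  rewrite /x expr_div_n ler_wpM2r ?invr_ge0 ?exprn_ge0 // exprMn; apply: (le_trans nm).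
  by rewrite ler_wpM2r ?(ltW D2p) // expr2 ler_peMr // ler1n.
rewrite expRN -[leRHS]invrK lef_pV2 ?posrE ?expR_gt0 ?invr_gt0 ?divr_gt0 ?exprn_gt0 //.
rewrite invf_div -expr_div_n; apply: le_trans (expR_ge_pow 17 x0).
have -> : (x / 18) ^+ 18 = ((x / 18) ^+ 2) ^+ 9 by rewrite -exprM.
rewrite lerXn2r ?nnegrE ?divr_ge0 ?exprn_ge0 ?(ltW nr) ?(ltW c180) ?divr_ge0 ?mulr_ge0 //.
have -> : n%:R / c18 = n%:R / 30 ^+ 2 / 18 ^+ 2 by rewrite c18E invfM [_^-1 * _]mulrC mulrA.
by rewrite expr_div_n ler_wpM2r // invr_ge0 exprn_ge0.
Qed.

End LargeDegree.

Definition bad_const (c2 c300 c9 c18 : R) : R :=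
  c2 ^+ 10 + c300 ^+ 10 + 4 * c9 ^+ 9 + (36 / d3 C) ^+ 10 + 1 ^+ 10 + c18 ^+ 9.

Lemma bad_const_ge0 (c2 c300 c9 c18 : R) :
  0 <= c2 -> 0 <= c300 -> 0 <= c9 -> 0 <= c18 -> 0 <= bad_const c2 c300 c9 c18.
Proof.
move=> h2 h300 h9 h18; have d30 : 0 <= d3 C by case/andP: (rc_d3 C) => /ltW.
by rewrite /bad_const !addr_ge0 ?exprn_ge0 ?divr_ge0 // mulr_ge0 ?exprn_ge0.
Qed.

(* The numerical constants are variables so that no tactic evaluates their powers. *)
Theorem Pr_bad (c2 c300 c9 c18 : R) : c2 = 1/2 -> c300 = 3 * (10 * 10) -> c9 = 9 -> c18 = 18 ^+ 2 * 30 ^+ 2 ->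
  6 * D0 C <= k%:R -> 42 * 60 <= d3 C * k%:R -> 84 <= k%:R :> R ->
  Pr p (pairs T) badE <= bad_const c2 c300 c9 c18 / n%:R ^+ 9.
Proof.
move=> c2E c300E c9E c18E kD kd3 k84.
have c20 : 0 < c2 by rewrite c2E; lra.
have c30 : 0 < c300 by rewrite c300E !mulr_gt0.
have c90 : 0 < c9 by rewrite c9E.
have c180 : 0 < c18 by rewrite c18E mulr_gt0 ?exprn_gt0.
have /andP[d30 _] := rc_d3 C.
have n9 : 0 < n%:R ^+ 9 :> R by rewrite exprn_gt0.
have t1 : 0 <= c2 ^+ 10 / n%:R ^+ 9 by rewrite divr_ge0 ?exprn_ge0 // ltW.
have t2 : 0 <= c300 ^+ 10 / n%:R ^+ 9 by rewrite divr_ge0 ?exprn_ge0 // ltW.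
have t3 : 0 <= c9 ^+ 9 / n%:R ^+ 9 by rewrite divr_ge0 ?exprn_ge0 // ltW.
have t4 : 0 <= (36 / d3 C) ^+ 10 / n%:R ^+ 9 by rewrite divr_ge0 ?exprn_ge0 // divr_ge0 // ltW.
have t5 : 0 <= 1 ^+ 10 / n%:R ^+ 9 :> R by rewrite divr_ge0 ?exprn_ge0.
have t6 : 0 <= c18 ^+ 9 / n%:R ^+ 9 by rewrite divr_ge0 ?exprn_ge0 // ltW.
have -> : bad_const c2 c300 c9 c18 / n%:R ^+ 9 = c2 ^+ 10 / n%:R ^+ 9 + c300 ^+ 10 / n%:R ^+ 9 +
   4 * (c9 ^+ 9 / n%:R ^+ 9) + (36 / d3 C) ^+ 10 / n%:R ^+ 9 + 1 ^+ 10 / n%:R ^+ 9 +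
   c18 ^+ 9 / n%:R ^+ 9 by rewrite /bad_const !mulrDl mulrA.
have [hDk|hDk] := ltP D (k%:R / 6).
  apply: le_trans (_ : Pr p (pairs T) (dense_subset (k%:R / 2 : R) predT) <= _).
    by apply: Pr_le => // E _; rewrite /bad hDk.
  by apply: le_trans (Pr_dense_subcritical c2E k84 hDk) _; move: t1 t2 t3 t4 t5 t6; lra.
have hD : D0 C <= D by move: kD hDk; lra.
apply: le_trans (_ : Pr p (pairs T) (fun E => nprE E ||
  (if D < 100 * k%:R then dense_subset (k%:R / 2 : R) (fun s => 30 * (40 * s) <= n)%N E
   else sparse_cover mc (mc%:R * D / 100) E)) <= _).
  by apply: Pr_le => // E _; rewrite /bad ltNge hDk.
apply: le_trans (Pr_or _ p01 _ _) _; have psr := Pr_not_pseudorandom c9E hD kd3.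
suff rest : Pr p (pairs T) (fun E =>
  if D < 100 * k%:R then dense_subset (k%:R / 2 : R) (fun s => 30 * (40 * s) <= n)%N E
   else sparse_cover mc (mc%:R * D / 100) E) <=
   c300 ^+ 10 / n%:R ^+ 9 + c18 ^+ 9 / n%:R ^+ 9 by move: psr rest t1; lra.
have [hk2|hk2] := ltP D (100 * k%:R).
  by apply: le_trans (Pr_dense_core c300E k84 hk2) _; rewrite lerDl.
by apply: le_trans (Pr_sparse_cover_pow hD c18E) _; rewrite lerDr.
Qed.

End PrBad.

(** * Union bound over the times of the process *)

Local Open Scope ring_scope.

Lemma exists_nat_scale_ge (R : realType) (a b : R) : 0 < a ->
  exists n0 : nat, forall n : nat, (n0 <= n)%N -> b <= a * n%:R.
Proof.
move=> a0; exists (Num.trunc (`|b| / a)).+1 => n hn.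
have [_ h] := @trunc_bounds R (`|b| / a) (divr_ge0 (normr_ge0 b) (ltW a0)).
apply: le_trans (ler_norm b) _; rewrite mulrC -ler_pdivrMr //.
by apply: le_trans (ltW h) _; rewrite ler_nat.
Qed.

Theorem theorem1p3 (R : realType) (eps : R) (heps : 0 < eps) :
  exists k0 : nat, forall k : nat, (k0 <= k)%N ->
    almost_every_process R (fun (n : nat) (G : process n) =>
      forall (M : 'I_('C(n, 2)).+1) (K : graph 'I_n),
        is_kcore k (G M) K -> vset K <> finset.set0 ->
        resiliently_hamiltonian (1 / 2 - eps) K /\
        ~ resiliently_hamiltonian (1 / 2 + eps) K).
Proof.
(* The positive half is proved for the smaller [e] and transferred by monotonicity; the negative
   half uses [eps] itself. *)
pose e := Num.min eps (1/4).
have e01 : 0 < e <= 1/4 by rewrite lt_min heps ge_min lexx orbT andbT divr_gt0.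
have ee : 1 / 2 - eps <= 1 / 2 - e by rewrite lerD2l lerN2 ge_min lexx.
have [C] := exists_resilience_constants e01.
have /andP[e0 _] := e01; have /andP[d30 _] := rc_d3 C; have [sg_gt0 _] := rc_sg C.
have gm_gt0 : 0 < gm C by have := rc_gm C; case: (ltP 0 (gm C)) => // h; move: h; lra.
have [k1 hk1] := exists_nat_scale_ge (6 * D0 C) (@ltr01 R).
have [k2 hk2] := exists_nat_scale_ge (42 * 60) d30.
have [k3 hk3] := exists_nat_scale_ge 84 (@ltr01 R).
have [k4 hk4] := exists_nat_scale_ge 2 heps.
exists (k1 + k2 + k3 + k4 + 3)%N => k hk.
have kD : 6 * D0 C <= k%:R by rewrite -[leRHS]mul1r hk1 //; move: hk; clear; lia.
have kd3 : 42 * 60 <= d3 C * k%:R by apply: hk2; move: hk; clear; lia.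
have k84 : 84 <= k%:R :> R by rewrite -[leRHS]mul1r hk3 //; move: hk; clear; lia.
have keps : 2 <= eps * k%:R by apply: hk4; move: hk; clear; lia.
have k2' : (2 < k)%N by move: hk; clear; lia.
pose c := bad_const C (1/2) (3 * (10 * 10)) 9 (18 ^+ 2 * 30 ^+ 2).
have c0 : 0 <= c.
  apply: bad_const_ge0; first by rewrite divr_ge0.
  - by rewrite !mulr_ge0.
  - by [].
  - by rewrite mulr_ge0 ?exprn_ge0.
rewrite /almost_every_process; apply/cvgrPdist_le => /= r r0.
have [n1 hn1] := exists_nat_scale_ge 2 sg_gt0.
have [n2 hn2] := exists_nat_scale_ge 10 (mulr_gt0 e0 gm_gt0).
have [n3 hn3] := exists_nat_scale_ge c r0.
exists (n1 + n2 + n3 + 2)%N => //= n /= hn.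
have n_sg : 2 <= sg C * #|'I_n|%:R by rewrite card_ord; apply: hn1; move: hn; clear; lia.
have n_eps : 10 <= e * (gm C * #|'I_n|%:R).
  by rewrite card_ord mulrA; apply: hn2; move: hn; clear; lia.
have n_r : c <= r * n%:R by apply: hn3; move: hn; clear; lia.
have n_2 : (2 <= n)%N by move: hn; clear; lia.
set A : set (process n) := fun G => _.
have N0 : (0 < 'C(n, 2))%N by rewrite bin_gt0.
have Nn : ('C(n, 2).+1 <= n ^ 2)%N.
  rewrite bin2 (leq_ltn_trans (half_leq (leq_mul (leqnn n) (leq_pred n)))) //.
  by rewrite mulnn; move: n_2; clear; nia.
pose B (M : nat) : pred {set {set 'I_n}} := bad C k (M%:R / 'C(n, 2)%:R : R).
have p01 (M : 'I_('C(n, 2)).+1) : 0 <= (M%:R / 'C(n, 2)%:R : R) <= 1.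
  by rewrite divr_ge0 //= ler_pdivrMr ?ltr0n // mul1r ler_nat -ltnS.
have hA (G : process n) :
    (forall M : 'I_('C(n, 2)).+1, vset (G M) = setT /\ ~~ B M (eset (G M))) -> A G.
  move=> hG M K hK /eqP K0; have [vT hB] := hG M; have [_ Kd _] := hK; split.
    apply: resiliently_hamiltonian_le ee _.
    apply: (kcore_resilient kD n_sg n_eps _ _ vT hB hK K0); by case/andP: (p01 M).
  exact: not_resiliently_hamiltonian heps keps k2' Kd K0.
have /andP[lo hi] := process_prob_bounds R N0 hA.
rewrite ger0_norm ?subr_ge0 // lerBlDr -lerBlDl; apply: le_trans lo.
rewrite lerD2l lerN2.
have nr : 0 < n%:R :> R by rewrite ltr0n; apply: leq_trans n_2.
(* At most n^2 times, each with comparison factor at most n^2, leave c / n^5. *)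
apply: le_trans (_ : \sum_(M < 'C(n, 2).+1) n%:R ^+ 2 * (c / n%:R ^+ 9) <= _).
  apply: ler_sum => M _.
  apply: ler_pM; [by [] | by apply: Pr_ge0 | by rewrite -natrX ler_nat |].
  have := Pr_bad n_sg n_eps (p01 M) erefl erefl erefl erefl kD kd3 k84.
  by rewrite card_ord.
rewrite sumr_const card_ord -[leLHS]mulr_natl.
apply: le_trans (_ : n%:R ^+ 2 * (n%:R ^+ 2 * (c / n%:R ^+ 9)) <= _).
  by rewrite ler_wpM2r ?mulr_ge0 ?invr_ge0 ?exprn_ge0 // -natrX ler_nat.
rewrite [leLHS]mulrA -exprD [leLHS]mulrA ler_pdivrMr ?exprn_gt0 //.
have -> : r * n%:R ^+ 9 = n%:R ^+ (2 + 2) * (r * n%:R ^+ 5) by rewrite [RHS]mulrCA -exprD.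
rewrite ler_wpM2l ?exprn_ge0 //; apply: (le_trans n_r).
rewrite ler_wpM2l ?(ltW r0) // -[leLHS]expr1 ler_weXn2l // ler1n.
by apply: leq_trans n_2.
Qed.
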